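(* $\overline{p}_H^\Psi\in\mathcal{D}(\hat{L},\mathbb{R}^* )$ and $$\hat{L}\,\overline{p}_H^\Psi(\lambda,x)=L(p_H)(\Psi(\lambda),x).$$
   Context: Notation: $\mathbf{H}^*=\{\lambda\in\mathbb{C}:\Re(\lambda)>0\}$, $\mathbb{R}^*=\mathbb{R}\setminus\{0\}$; $\mathcal{L}[f(\cdot)](\lambda)=\int_0^{+\infty}e^{-\lambda t}f(t)\,dt$ is the Laplace transform in $t$. The identity in the claim is for $\lambda\in\mathbf{H}^*$ and $x\in\mathbb{R}^*$. Fix $H\in(\frac12,1)$ and $\theta>0$. The fractional Ornstein-Uhlenbeck process $U_H(t)=e^{-t/\theta}\int_0^t e^{s/\theta}\,dB^H(s)$ ($B^H$ a fractional Brownian motion with Hurst index $H$) is centered Gaussian with variance $$V_{2,H}(t)=H(2H-1)\theta^{2H}\int_0^{t/\theta}\int_0^{t/\theta}e^{-s-u}|u-s|^{2H-2}\,du\,ds$$ and density $p_H(t,x)=\frac{1}{\sqrt{2\pi V_{2,H}(t)}}e^{-x^2/(2V_{2,H}(t))}$, $t>0$. The transform $\mathcal{L}[V'_{2,H}(\cdot)](\lambda)$ is defined for $\Re(\lambda)>-\frac1\theta$. Let $\sigma$ be a driftless subordinator with Lévy measure $\nu$ on $(0,+\infty)$, $\int_0^{+\infty}(1\wedge x)\nu(dx)<+\infty$, $\nu(0,+\infty)=+\infty$, so $\mathbb{E}[e^{-\lambda\sigma(y)}]=e^{-y\Psi(\lambda)}$ with $\Psi(\lambda)=\int_0^{+\infty}(1-e^{-\lambda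 x})\nu(dx)$, which is holomorphic on $\mathbf{H}^*$. Let $E(t)=\inf\{y>0:\sigma(y)>t\}$, independent of $U_H$, with probability density function $f_E(t,\cdot)$ for $t>0$. The time-changed process is $U_H^\Psi(t)=U_H(E(t))$, and $p_H^\Psi(t,x)$ denotes its probability density function. Assume $\mathbb{E}[E^{-H}(t)]<+\infty$ for any $t>0$; then $p_H^\Psi(t,x)$ exists for all $t>0$ and satisfies $p_H^\Psi(t,x)=\int_0^{+\infty}p_H(y,x)f_E(t,y)\,dy$. Put $\overline{p}_H^\Psi(\lambda,x)=\mathcal{L}[p_H^\Psi(\cdot,x)](\lambda)$. Operator $L$: $L(u)(\lambda,x)=\int_0^{+\infty}e^{-\lambda s}V'_{2,H}(s)u(s,x)\,ds$, $\lambda\in\mathbf{H}^*$. Operator $\hat L$: fix $c_1<0<c_2$ with $c_1-c_2>-\frac1\theta$. Let $Z$ be the (at most countable) set of zeros of $\Psi'$ in $\mathbf{H}^*$; local inverses of $\Psi$ are denoted $\Psi^{-1}$. Let $I\subseteq\mathbb{R}$ and $v:\mathbf{H}^*\times I\to\mathbb{C}$. Then $v\in\mathcal{D}(\hat L,I)$ if for all $\lambda\in\mathbf{H}^*$, $x\in I$ and for any $z\in\mathbb{R}$ such that $c_2+iz\notin Z$, the quantity $\frac{\Psi^{-1}(c_2+iz)}{c_2+iz}v(\Psi^{-1}(c_2+iz),x)$ is independent of the choice of the local inverse map $\Psi^{-1}$ of $\Psi$ in $c_2+iz$, and $$\hat{L}v(\lambda,x):=\frac{1}{4\pi^2}\int_0^{+\infty}e^{-\Psi(\lambda)t}\lim_{R_2\to+\infty}\int_{-\infty}^{+\infty}e^{(c_1+iw)t}\int_{-R_2}^{R_2}\mathcal{L}[V'_{2,H}(\cdot)](c_1-c_2+i(w-z))\,\frac{\Psi^{-1}(c_2+iz)}{c_2+iz}\,v(\Psi^{-1}(c_2+iz),x)\,dz\,dw\,dt$$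 is well defined, i.e. is some complex number.
   Formalization: It is assumed in addition that for almost every real z, Ψ has a local inverse at c₂+iz with values in H*; otherwise (e.g. Ψ(λ)=λ^{1/2}, |z|>c₂) the integrand of L̂ is undefined, as v lives only on H*. *)

(* Defs.v *)
From mathcomp Require Import all_boot all_order all_algebra.
From mathcomp Require Import all_classical all_reals all_analysis.
From mathcomp Require Import complex.

Set Implicit Arguments.
Unset Strict Implicit.
Unset Printing Implicit Defensive.

Import Order.TTheory GRing.Theory Num.Theory.
Import numFieldNormedType.Exports.

Local Open Scope classical_set_scope.
Local Open Scope ring_scope.
Local Open Scope complex_scope.

(* The topology and the derivatives of the library live on the regular module
   R[i]^o; the type [R[i]^o] is convertible to [R[i]]. *)

Section complex_analysis.
Context {R : realType}.

Definition Hstar : set R[i] := [set l | 0 < complex.Re l].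

Definition cexp (z : R[i]) : R[i] :=
  let: a +i* b := z in (expR a * cos b) +i* (expR a * sin b).

Section integral.
Context {d} {T : measurableType d} (mu : {measure set T -> \bar R}).

Definition cintegrable (D : set T) (f : T -> R[i]) : Prop :=
  mu.-integrable D (fun x => (complex.Re (f x))%:E) /\
  mu.-integrable D (fun x => (complex.Im (f x))%:E).

(* Meaningful when [cintegrable D f] holds. *)
Definition cintegral (D : set T) (f : T -> R[i]) : R[i] :=
  (\int[mu]_(x in D) complex.Re (f x)) +i* (\int[mu]_(x in D) complex.Im (f x)).

End integral.

Definition laplace (f : R -> R) (l : R[i]) : R[i] :=
  cintegral lebesgue_measure `]0, +oo[
    (fun t => cexp (- (l * t%:C)) * (f t)%:C).

End complex_analysis.

Section probability.
Context {R : realType} {d} {T : measurableType d} (P : probability T R).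

Definition is_pdf (X : T -> R) (f : R -> R) : Prop :=
  [/\ measurable_fun setT X, measurable_fun setT f, forall x, 0 <= f x &
      forall A, measurable A ->
        P (X @^-1` A) = (\int[lebesgue_measure]_(x in A) (f x)%:E)%E].

Definition gaussian (X : T -> R) : Prop :=
  measurable_fun setT X /\
  exists m, P (X @^-1` [set m]) = 1%E \/
    exists2 s, 0 < s &
      forall A, measurable A -> P (X @^-1` A) = normal_prob m s A.

(* Processes are indexed by R; only the times t >= 0 matter. *)

Definition gaussian_process (X : R -> T -> R) : Prop :=
  forall n (t a : 'I_n -> R), (forall i, 0 <= t i) ->
    gaussian (fun w => \sum_(i < n) a i * X (t i) w).

Definition fractional_brownian_motion (H : R) (B : R -> T -> R) : Prop :=
  [/\ gaussian_process B,
      forall t, 0 <= t -> ('E_P[B t] = 0)%E,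
      forall s t, 0 <= s -> 0 <= t ->
        covariance P (B s) (B t) =
        ((s `^ (2 * H) + t `^ (2 * H) - `|t - s| `^ (2 * H)) / 2)%:E &
      forall w, {within `[0, +oo[, continuous (fun t => B t w)}].

Definition indep_processes (X Y : R -> T -> R) : Prop :=
  forall n m (s : 'I_n -> R) (t : 'I_m -> R)
    (A : 'I_n -> set R) (B : 'I_m -> set R),
  (forall i, 0 <= s i) -> (forall j, 0 <= t j) ->
  (forall i, measurable (A i)) -> (forall j, measurable (B j)) ->
  let EX := \bigcap_(i in [set: 'I_n]) (X (s i) @^-1` A i) in
  let EY := \bigcap_(j in [set: 'I_m]) (Y (t j) @^-1` B j) in
  P (EX `&` EY) = (P EX * P EY)%E.

Definition independent_increments (X : R -> T -> R) : Prop :=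
  forall n (t : nat -> R) (A : nat -> set R),
  0 <= t 0%N -> (forall k, t k <= t k.+1) -> (forall k, measurable (A k)) ->
  let D k := [set w | A k (X (t k.+1) w - X (t k) w)] in
  fine (P (\bigcap_(k < n) D k)) = \prod_(k < n) fine (P (D k)).

Definition stationary_increments (X : R -> T -> R) : Prop :=
  forall s h (A : set R), 0 <= s -> 0 <= h -> measurable A ->
  P [set w | A (X (s + h) w - X s w)] = P [set w | A (X h w - X 0 w)].

Record subordinator (sigma : R -> T -> R) : Prop := {
  sub_measurable : forall y, 0 <= y -> measurable_fun setT (sigma y);
  sub_0 : forall w, sigma 0 w = 0;
  sub_nondecreasing :
    forall w y z, 0 <= y -> y <= z -> sigma y w <= sigma z w;
  sub_rcontinuous :
    forall w y, 0 <= y -> sigma z w @[z --> y^'+] --> sigma y w;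
  sub_indep : independent_increments sigma;
  sub_stationary : stationary_increments sigma }.

End probability.

Section subordinators.
Context {R : realType}.

(* A measure on (0, +oo) is represented by a measure on R of which only the
   restriction to ]0, +oo[ is used. *)
Definition infinite_levy_measure (nu : {measure set R -> \bar R}) : Prop :=
  (\int[nu]_(x in `]0%R, +oo[) (Num.min 1 x)%:E < +oo)%E /\
  nu `]0, +oo[%classic = +oo%E.

Definition laplace_exponent (nu : {measure set R -> \bar R}) (l : R[i]) : R[i] :=
  cintegral nu `]0, +oo[ (fun x => 1 - cexp (- (l * x%:C))).

Context {d} {T : measurableType d} (P : probability T R).

Definition driftless_subordinator (nu : {measure set R -> \bar R})
    (sigma : R -> T -> R) : Prop :=
  subordinator P sigma /\
  forall y (l : R[i]), 0 <= y -> Hstar l ->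
    cintegral P setT (fun w => cexp (- (l * (sigma y w)%:C))) =
    cexp (- (y%:C * laplace_exponent nu l)).

(* The set is empty only if the path of sigma is bounded, which has
   probability 0 when nu is infinite; [inf set0] is 0. *)
Definition inverse_process (sigma : R -> T -> R) (t : R) (w : T) : R :=
  inf [set y | 0 < y /\ t < sigma y w].

End subordinators.

Section fOU.
Context {R : realType} (H theta : R).

(* The Wiener integral of the smooth integrand e^(s/theta) is the pathwise
   Riemann-Stieltjes integral, here along the uniform partitions of [0, t]. *)
Definition fOU {T : Type} (B : R -> T -> R) (t : R) (w : T) : R :=
  expR (- (t / theta)) *
  lim ((\sum_(k < n) expR (t * (k%:R / n%:R) / theta) *
          (B (t * (k.+1%:R / n%:R)) w - B (t * (k%:R / n%:R)) w))
       @[n --> \oo]).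

Definition V2 (t : R) : R :=
  H * (2 * H - 1) * theta `^ (2 * H) *
  \int[lebesgue_measure]_(s in `[0, t / theta])
    \int[lebesgue_measure]_(u in `[0, t / theta])
      (expR (- s - u) * `|u - s| `^ (2 * H - 2)).

Definition dV2 : R -> R := (V2^`())%classic.

Definition pH (t x : R) : R :=
  (Num.sqrt (2 * pi * V2 t))^-1 * expR (- (x ^+ 2 / (2 * V2 t))).

Definition opL (u : R -> R -> R) (l : R[i]) (x : R) : R[i] :=
  cintegral lebesgue_measure `]0, +oo[
    (fun s => cexp (- (l * s%:C)) * (dV2 s)%:C * (u s x)%:C).

End fOU.

Section Lhat.
Context {R : realType} (H theta c1 c2 : R).
Variable Psi : R[i] -> R[i].

Definition local_inverse (w : R[i]) (phi : R[i] -> R[i]) : Prop :=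
  exists U : set R[i]^o, [/\ open U, U w &
    forall z, U z ->
      [/\ derivable (phi : R[i]^o -> R[i]^o) z 1, Hstar (phi z) &
          Psi (phi z) = z]].

Definition critical_points : set R[i] :=
  [set l | Hstar l /\ ((Psi : R[i]^o -> R[i]^o)^`())%classic l = 0].

Definition branch_value (v : R[i] -> R -> R[i]) (x : R) (w : R[i])
    (phi : R[i] -> R[i]) : R[i] :=
  phi w / w * v (phi w) x.

(* The common value of [branch_value v x w phi] over all local inverses phi
   of Psi in w; it is 0 when there is no local inverse. *)
Definition inv_value (v : R[i] -> R -> R[i]) (x : R) (w : R[i]) : R[i] :=
  xget 0 [set branch_value v x w phi | phi in local_inverse w].

Variables (v : R[i] -> R -> R[i]).

Definition integrand_z (x w z : R) : R[i] :=
  laplace (dV2 H theta) ((c1 - c2) +i* (w - z)) * inv_value v x (c2 +i* z).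

Definition integrand_w (x R2 t w : R) : R[i] :=
  cexp ((c1 +i* w) * t%:C) *
  cintegral lebesgue_measure `[- R2, R2] (integrand_z x w).

Definition integral_w (x t R2 : R) : R[i]^o :=
  cintegral lebesgue_measure setT (integrand_w x R2 t).

Definition integrand_t (l : R[i]) (x t : R) : R[i] :=
  cexp (- (Psi l * t%:C)) * lim (integral_w x t R2 @[R2 --> +oo]).

Definition Lhat (l : R[i]) (x : R) : R[i] :=
  ((4 * pi ^+ 2)^-1)%:C *
  cintegral lebesgue_measure `]0, +oo[ (integrand_t l x).

Definition Lhat_well_defined (l : R[i]) (x : R) : Prop :=
  [/\ forall R2 w, 0 < R2 ->
        cintegrable lebesgue_measure `[- R2, R2] (integrand_z x w),
      forall t R2, 0 < t -> 0 < R2 ->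
        cintegrable lebesgue_measure setT (integrand_w x R2 t),
      forall t, 0 < t -> cvg (integral_w x t R2 @[R2 --> +oo]) &
      cintegrable lebesgue_measure `]0, +oo[ (integrand_t l x)].

Definition Lhat_domain (I : set R) : Prop :=
  forall l x, Hstar l -> I x ->
    (forall z : R, ~ critical_points (c2 +i* z) ->
       forall phi1 phi2,
         local_inverse (c2 +i* z) phi1 -> local_inverse (c2 +i* z) phi2 ->
         branch_value v x (c2 +i* z) phi1 = branch_value v x (c2 +i* z) phi2)
    /\ Lhat_well_defined l x.

End Lhat.

(* Main.v *)
(** The time change turns [pH] into an average of its time derivative against
    P(E(t) > u) = P(sigma(u) <= t), and the Laplace transform in t of the latter
    is e^(-u Psi(l)) / l.  Hence [pbar l x = (Psi l / l) F (Psi l)], where F is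
    the Laplace transform of [pH ^~ x]; so, for a local inverse phi of Psi at
    w = c2 + iz, the quantity phi(w) / w * pbar(phi(w)) is F(w), whatever phi.
    The inner integrals of the operator are then a convolution of the transform
    G of V2' on the line Re = c1 - c2 with F on the line Re = c2, and its inverse
    transform is the product of the inverse transforms, 4 pi^2 V2'(t) pH(t, x).

    Both G and F are integrable on these lines, so that Fubini's theorem and
    Fourier inversion apply.  Indeed V2' is, up to a constant, the convolution of
    e^(-2t/theta) with e^(-t/theta) t^(2H-2), so that G(a + iy) is
    O(|y|^(-1)) O(|y|^(1-2H)); and F is 1/(c2 + iy) times the transform of a
    bounded integrable function, i.e. a product of two square integrable
    functions. *)

From HB Require Import structures.
Require Import Defs.
From mathcomp Require Import all_boot all_order all_algebra.
From mathcomp Require Import all_classical all_reals all_analysis.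
From mathcomp Require Import complex.
From mathcomp Require Import measurable_realfun ring lra.

Import Order.TTheory GRing.Theory Num.Theory.
Import numFieldNormedType.Exports.
Import ComplexField.Normc.

Local Open Scope classical_set_scope.
Local Open Scope ring_scope.
Local Open Scope complex_scope.

Set Implicit Arguments.
Unset Strict Implicit.
Unset Printing Implicit Defensive.

(** * Real and complex Lebesgue integrals *)

Lemma ae_eq_integrable {d} {T : measurableType d} {R : realType}
    (mu : {measure set T -> \bar R}) (D : set T) (f g : T -> \bar R) :
  measurable D -> measurable_fun D g -> ae_eq mu D f g ->
  mu.-integrable D f -> mu.-integrable D g.
Proof.
move=> mD mg fg /integrableP[mf fi]; apply/integrableP; split => //.
rewrite -(@ge0_ae_eq_integral _ _ _ _ _ (abse \o f) (abse \o g))//.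
- exact: measurableT_comp.
- exact: measurableT_comp.
- by move=> x _; exact: abse_ge0.
- by move=> x _; exact: abse_ge0.
- by move: fg; apply: filterS => x /[apply] /= ->.
Qed.

Section real_fubini.
Context {d1 d2} {T1 : measurableType d1} {T2 : measurableType d2} {R : realType}.
Variable m1 : {sigma_finite_measure set T1 -> \bar R}.
Variable m2 : {sigma_finite_measure set T2 -> \bar R}.
Variable f : T1 * T2 -> R.
Hypothesis fi : (m1 \x m2)%E.-integrable setT (EFin \o f).

Lemma ae_eq_fubini_F :
  ae_eq m1 setT (fubini_F m2 (EFin \o f)) (fun x => (\int[m2]_y f (x, y))%:E).
Proof.
have := integrable_ae measurableT (integrable_fubini_F fi).
by apply: filterS => x /(_ I) fx _; rewrite /Rintegral fineK.
Qed.

Lemma integrable_Rfubini1 :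
  m1.-integrable setT (fun x => (\int[m2]_y f (x, y))%:E).
Proof.
have Fi := integrable_fubini_F fi.
apply: (ae_eq_integrable _ _ ae_eq_fubini_F Fi) => //.
have /integrableP[mF _] := Fi.
by apply/measurable_EFinP; exact: measurableT_comp mF.
Qed.

Lemma Rintegral_fubini1 :
  \int[m1]_x \int[m2]_y f (x, y) = \int[(m1 \x m2)%E]_z f z.
Proof.
rewrite /Rintegral -(integral12_prod_meas1 fi); congr fine.
apply: ae_eq_integral => //.
- by have /integrableP[] := integrable_Rfubini1.
- by have /integrableP[] := integrable_fubini_F fi.
- by apply: ae_eq_sym; exact: ae_eq_fubini_F.
Qed.

End real_fubini.

Section real_fubini2.
Context {d1 d2} {T1 : measurableType d1} {T2 : measurableType d2} {R : realType}.
Variable m1 : {sigma_finite_measure set T1 -> \bar R}.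
Variable m2 : {sigma_finite_measure set T2 -> \bar R}.

Lemma integrable_prod_swap (f : T1 * T2 -> R) :
  (m1 \x m2)%E.-integrable setT (EFin \o f) ->
  (m2 \x m1)%E.-integrable setT (fun z => (f (z.2, z.1))%:E).
Proof.
move=> fi; have [mf _] := integrableP _ _ _ fi.
apply/integrable12ltyP; last exact/(integrable21ltyP m1 m2 mf).
by apply: measurableT_comp mf _; exact: measurable_swap.
Qed.

Lemma integrable_Rfubini2 (f : T1 * T2 -> R) :
  (m1 \x m2)%E.-integrable setT (EFin \o f) ->
  m2.-integrable setT (fun y => (\int[m1]_x f (x, y))%:E).
Proof. by move=> /integrable_prod_swap /integrable_Rfubini1. Qed.

Lemma Rintegral_fubini2 (f : T1 * T2 -> R) :
  (m1 \x m2)%E.-integrable setT (EFin \o f) ->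
  \int[m2]_y \int[m1]_x f (x, y) = \int[(m1 \x m2)%E]_z f z.
Proof.
move=> fi; rewrite /Rintegral -(integral21_prod_meas1 fi).
have fi' := integrable_prod_swap fi.
congr fine; apply: ae_eq_integral => //.
- by have /integrableP[] := integrable_Rfubini2 fi.
- by have /integrableP[] := integrable_fubini_F fi'.
- by apply: ae_eq_sym; exact: ae_eq_fubini_F fi'.
Qed.

Lemma Rintegral_fubini (f : T1 * T2 -> R) :
  (m1 \x m2)%E.-integrable setT (EFin \o f) ->
  \int[m1]_x \int[m2]_y f (x, y) = \int[m2]_y \int[m1]_x f (x, y).
Proof. by move=> fi; rewrite Rintegral_fubini1// Rintegral_fubini2. Qed.

Lemma integrable_tensor (u : T1 -> R) (v : T2 -> R) :
  m1.-integrable setT (EFin \o u) -> m2.-integrable setT (EFin \o v) ->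
  (m1 \x m2)%E.-integrable setT (EFin \o (fun z => u z.1 * v z.2)).
Proof.
move=> ui vi.
have [/measurable_EFinP mu _] := integrableP _ _ _ ui.
have [/measurable_EFinP mv _] := integrableP _ _ _ vi.
apply/integrable12ltyP.
  apply/measurable_EFinP; apply: measurable_funM.
    exact: measurableT_comp mu (measurable_fst).
  exact: measurableT_comp mv (measurable_snd).
under eq_integral => x _.
  under eq_integral => y _ do rewrite /= normrM EFinM.
  rewrite ge0_integralZl//; last exact/measurable_EFinP/measurableT_comp.
  over.
rewrite ge0_integralZr//; first last.
- by apply: integral_ge0 => x _.
- by apply/measurable_EFinP; exact: measurableT_comp.
rewrite lte_mul_pinfty//.
- by apply: integral_ge0 => x _.
- by apply: integrable_fin_num => //; exact: (integrable_abse ui).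
- by have /integrableP[] := vi.
Qed.

End real_fubini2.

Section affine.
Context {R : realType}.
Notation leb := (@lebesgue_measure R).

Let aff (a b : R) (x : measurableTypeR R) : measurableTypeR R := a * x + b.

Lemma measurable_affine (a b : R) :
  measurable_fun setT (fun x : R => a * x + b).
Proof.
by apply: measurable_funD => //; apply: measurable_funM => //.
Qed.

Lemma lebesgue_measure_affine (a b : R) (A : set R) : 0 < a -> measurable A ->
  leb A = (a%:E * leb ((fun x : R => (a * x + b)%R) @^-1` A))%E.
Proof.
move=> a0 mA; have a0' : 0 <= a by exact: ltW.
apply: (@lebesgue_measure_unique R (mscale (NngNum a0') (pushforward leb (aff a b))) _ _ mA).
  exact: measurable_affine.
move=> mf X [[p q] _ <-].
transitivity (a%:E * leb (aff a b @^-1` `]p, q]))%E; last reflexivity.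
have -> : aff a b @^-1` `]p, q] = `](p - b) / a, (q - b) / a]%classic.
  apply/seteqP; split => x /=; rewrite /aff !in_itv/=.
    by rewrite ltr_pdivrMr// ler_pdivlMr// ltrBlDr lerBrDr mulrC.
  by rewrite ltr_pdivrMr// ler_pdivlMr// ltrBlDr lerBrDr [x * a]mulrC.
rewrite lebesgue_measure_itv/= lebesgue_measure_itv/= !lte_fin.
rewrite ltr_pM2r ?invr_gt0// ltrD2r; case: ifPn => _; last by rewrite mule0.
rewrite -!EFinD -EFinM; congr EFin.
by field; rewrite gt_eqF.
Qed.

Lemma ge0_integral_affine (a b : R) (f : R -> \bar R) : 0 < a ->
  measurable_fun setT f -> (forall x, 0 <= f x)%E ->
  (\int[leb]_x f x = a%:E * \int[leb]_x f (a * x + b)%R)%E.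
Proof.
move=> a0 mf f0; have a0' : 0 <= a by exact: ltW.
have maff : measurable_fun setT (aff a b) by exact: measurable_affine.
rewrite -(@ge0_integral_pushforward _ _ _ _ _ (aff a b) maff leb setT f)//.
rewrite -[in RHS](@ge0_integral_mscale _ _ _ _ setT _ (NngNum a0'))//.
apply: eq_measure_integral => A mA _.
by rewrite /mscale /pushforward/= (lebesgue_measure_affine b a0 mA).
Qed.

Lemma integrable_affine (a b : R) (f : R -> R) : 0 < a ->
  leb.-integrable setT (EFin \o f) ->
  leb.-integrable setT (fun x => (f (a * x + b)%R)%:E).
Proof.
move=> a0 /integrableP[mf fi]; apply/integrableP; split.
  exact: (measurableT_comp mf (measurable_affine a b)).
move: fi; rewrite (@ge0_integral_affine a b)//; last exact: measurableT_comp.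
apply: contraTT; rewrite -!leNgt !leye_eq => /eqP ->.
by rewrite gt0_muley.
Qed.

Lemma Rintegral_affine (a b : R) (f : R -> R) : 0 < a ->
  leb.-integrable setT (EFin \o f) ->
  \int[leb]_x f x = a * \int[leb]_x f (a * x + b).
Proof.
move=> a0 fi; have [mf _] := integrableP _ _ _ fi.
have fi' := integrable_affine b a0 fi.
have pf := integrable_pos_fin_num measurableT fi'.
have qf := integrable_neg_fin_num measurableT fi'.
have Ep := ge0_integral_affine b a0 (measurable_funepos mf) (fun x => funepos_ge0 _ x).
have Eq := ge0_integral_affine b a0 (measurable_funeneg mf) (fun x => funeneg_ge0 _ x).
rewrite /Rintegral [in LHS]integralE [in RHS]integralE Ep Eq.
move: pf qf; set p := (X in X \is a fin_num) => pf.
set q := (X in X \is a fin_num) => qf.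
rewrite [X in (a%:E * X - _)%E](_ : _ = p); last first.
  by apply: eq_integral => x _; rewrite !funeposE.
rewrite [X in (_ - a%:E * X)%E](_ : _ = q); last first.
  by apply: eq_integral => x _; rewrite !funenegE.
rewrite -[X in _ = a * X]/(fine (p - q)%E).
by rewrite -(fineK pf) -(fineK qf) -!EFinM/= mulrBr.
Qed.

Lemma ge0_integral_reflect (f : R -> \bar R) :
  measurable_fun setT f -> (forall x, 0 <= f x)%E ->
  (\int[leb]_x f x = \int[leb]_x f (- x)%R)%E.
Proof.
move=> mf f0.
have mN : measurable_fun setT (-%R : measurableTypeR R -> measurableTypeR R) by [].
rewrite -(@ge0_integral_pushforward _ _ _ _ _ (-%R : measurableTypeR R -> measurableTypeR R) mN leb setT f)//.
by apply: eq_measure_integral => A mA _; exact/esym/lebesgue_measureN.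
Qed.

Lemma integrable_reflect (f : R -> R) :
  leb.-integrable setT (EFin \o f) ->
  leb.-integrable setT (fun x => (f (- x)%R)%:E).
Proof.
move=> /integrableP[mf fi]; apply/integrableP; split.
  by apply: (measurableT_comp mf); exact: oppr_measurable.
by move: fi; rewrite ge0_integral_reflect//; exact: measurableT_comp.
Qed.

Lemma Rintegral_reflect (f : R -> R) :
  leb.-integrable setT (EFin \o f) ->
  \int[leb]_x f x = \int[leb]_x f (- x).
Proof.
move=> /integrableP[mf fi].
have Ep := ge0_integral_reflect (measurable_funepos mf) (fun x => funepos_ge0 _ x).
have Eq := ge0_integral_reflect (measurable_funeneg mf) (fun x => funeneg_ge0 _ x).
rewrite /Rintegral [in LHS]integralE [in RHS]integralE Ep Eq.
congr (fine (_ - _)%E).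
  by apply: eq_integral => x _; rewrite !funeposE.
by apply: eq_integral => x _; rewrite !funenegE.
Qed.

Lemma ge0_integral_shift (c : R) (f : R -> \bar R) :
  measurable_fun setT f -> (forall x, 0 <= f x)%E ->
  (\int[leb]_x f (x - c)%R = \int[leb]_x f x)%E.
Proof.
move=> mf f0; rewrite [RHS](@ge0_integral_affine 1 (- c))// mul1e.
by apply: eq_integral => x _; rewrite mul1r.
Qed.

Lemma integrable_shift (c : R) (f : R -> R) :
  leb.-integrable setT (EFin \o f) ->
  leb.-integrable setT (fun x => (f (x - c)%R)%:E).
Proof.
move=> /(integrable_affine (- c) ltr01); apply: eq_integrable => // x _ /=.
by rewrite mul1r.
Qed.

Lemma Rintegral_shift (c : R) (f : R -> R) :
  leb.-integrable setT (EFin \o f) ->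
  \int[leb]_x f (x - c) = \int[leb]_x f x.
Proof.
move=> fi; rewrite [RHS](@Rintegral_affine 1 (- c))// mul1r.
by apply: eq_Rintegral => x _; rewrite mul1r.
Qed.

Lemma integrable_conv (u v : R -> R) :
  leb.-integrable setT (EFin \o u) -> leb.-integrable setT (EFin \o v) ->
  (leb \x leb)%E.-integrable setT
    (EFin \o (fun z : R * R => u (z.1 - z.2) * v z.2)).
Proof.
move=> ui vi.
have [/measurable_EFinP mu ufin] := integrableP _ _ _ ui.
have [/measurable_EFinP mv vfin] := integrableP _ _ _ vi.
have ma : measurable_fun setT (fun z : R * R => u (z.1 - z.2) * v z.2).
  apply: measurable_funM; last exact: measurableT_comp mv measurable_snd.
  by apply: measurableT_comp mu _; exact: measurable_funB.
apply/integrable21ltyP; first exact/measurable_EFinP.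
under eq_integral => y _.
  under eq_integral => x _ do rewrite /= normrM EFinM.
  rewrite ge0_integralZr//; last first.
    apply/measurable_EFinP/measurableT_comp => //.
    by apply: measurableT_comp mu _; exact: measurable_funB.
  rewrite (ge0_integral_shift y (f := fun x => `|u x|%:E))//; last first.
    exact/measurable_EFinP/measurableT_comp.
  over.
rewrite ge0_integralZl//; last 2 first.
- exact/measurable_EFinP/measurableT_comp.
- exact: integral_ge0.
rewrite lte_mul_pinfty//; first exact: integral_ge0.
by apply: integrable_fin_num => //; exact: (integrable_abse ui).
Qed.
End affine.

Section complex_facts.
Context {R : realType}.
Implicit Types z w : R[i].

Lemma cReD z w : complex.Re (z + w) = complex.Re z + complex.Re w.
Proof. by case: z w => a b [c e]. Qed.

Lemma cImD z w : complex.Im (z + w) = complex.Im z + complex.Im w.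
Proof. by case: z w => a b [c e]. Qed.

Lemma cReM z w : complex.Re (z * w) =
  complex.Re z * complex.Re w - complex.Im z * complex.Im w.
Proof. by case: z w => a b [c e]. Qed.

Lemma cImM z w : complex.Im (z * w) =
  complex.Re z * complex.Im w + complex.Im z * complex.Re w.
Proof. by case: z w => a b [c e]. Qed.

Lemma cReN z : complex.Re (- z) = - complex.Re z.
Proof. by case: z. Qed.

Lemma cImN z : complex.Im (- z) = - complex.Im z.
Proof. by case: z. Qed.

Lemma complex_eqP z w :
  complex.Re z = complex.Re w -> complex.Im z = complex.Im w -> z = w.
Proof. by case: z w => a b [c e] /= -> ->. Qed.

Lemma normcE2 z : normc z = Num.sqrt (complex.Re z ^+ 2 + complex.Im z ^+ 2).
Proof. by case: z. Qed.

Lemma normc_ge0 z : 0 <= normc z.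
Proof. by rewrite normcE2 sqrtr_ge0. Qed.

Lemma le_Re_normc z : `|complex.Re z| <= normc z.
Proof. by rewrite normcE2 -sqrtr_sqr ler_wsqrtr// lerDl sqr_ge0. Qed.

Lemma le_Im_normc z : `|complex.Im z| <= normc z.
Proof. by rewrite normcE2 -sqrtr_sqr ler_wsqrtr// lerDr sqr_ge0. Qed.

Lemma normc_sqr z : normc z ^+ 2 = complex.Re z ^+ 2 + complex.Im z ^+ 2.
Proof. by rewrite normcE2 sqr_sqrtr// addr_ge0// sqr_ge0. Qed.

Lemma normc_le_ReIm z : normc z <= `|complex.Re z| + `|complex.Im z|.
Proof.
rewrite -ler_sqr ?nnegrE ?normc_ge0 ?addr_ge0// normc_sqr sqrrD !real_normK ?num_real//.
by rewrite addrAC lerDl mulrn_wge0// mulr_ge0.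
Qed.

Lemma normc_real (x : R) : normc (x%:C) = `|x|.
Proof. by rewrite normcE2/= expr0n addr0 sqrtr_sqr. Qed.

Lemma cexpD z w : cexp (z + w) = cexp z * cexp w.
Proof.
case: z w => a b [c e]; apply: complex_eqP; rewrite /= expRD ?cosD ?sinD; ring.
Qed.

Lemma normc_cexp z : normc (cexp z) = expR (complex.Re z).
Proof.
case: z => a b; rewrite normcE2/= !exprMn -mulrDr cos2Dsin2 mulr1 sqrtr_sqr.
by rewrite ger0_norm// expR_ge0.
Qed.

End complex_facts.

Section complex_integral.
Context {R : realType} {d} {T : measurableType d} (mu : {measure set T -> \bar R}).
Implicit Types (D : set T) (f g : T -> R[i]).

Definition cmeasurable D f :=
  measurable_fun D (fun x => complex.Re (f x)) /\
  measurable_fun D (fun x => complex.Im (f x)).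

Lemma cmeasurableM D f g : cmeasurable D f -> cmeasurable D g ->
  cmeasurable D (fun x => f x * g x).
Proof.
move=> [f1 f2] [g1 g2]; split.
  under eq_fun do rewrite cReM.
  by apply: measurable_funB; exact: measurable_funM.
under eq_fun do rewrite cImM.
by apply: measurable_funD; exact: measurable_funM.
Qed.

Lemma cmeasurableD D f g : cmeasurable D f -> cmeasurable D g ->
  cmeasurable D (fun x => f x + g x).
Proof.
move=> [f1 f2] [g1 g2]; split.
  by under eq_fun do rewrite cReD; exact: measurable_funD.
by under eq_fun do rewrite cImD; exact: measurable_funD.
Qed.

Lemma cmeasurableN D f : cmeasurable D f -> cmeasurable D (fun x => - f x).
Proof.
move=> [f1 f2]; split.
  by under eq_fun do rewrite cReN; exact: measurableT_comp.
by under eq_fun do rewrite cImN; exact: measurableT_comp.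
Qed.

Lemma cmeasurable_cst D (c : R[i]) : cmeasurable D (fun=> c).
Proof. by split; exact: measurable_cst. Qed.

Lemma cmeasurable_real D (h : T -> R) :
  measurable_fun D h -> cmeasurable D (fun x => (h x)%:C).
Proof. by move=> mh; split => //; exact: measurable_cst. Qed.

Lemma cmeasurable_cexp D f : cmeasurable D f -> cmeasurable D (fun x => cexp (f x)).
Proof.
have E z : cexp z = (expR (complex.Re z) * cos (complex.Im z)) +i*
                    (expR (complex.Re z) * sin (complex.Im z)) :> R[i].
  by case: z.
have mcos : measurable_fun setT (cos : R -> R).
  by apply: continuous_measurable_fun; exact: continuous_cos.
have msin : measurable_fun setT (sin : R -> R).
  by apply: continuous_measurable_fun; exact: continuous_sin.
move=> [f1 f2]; split; under eq_fun do rewrite E /=.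
  by apply: measurable_funM; exact: measurableT_comp.
by apply: measurable_funM; exact: measurableT_comp.
Qed.

Lemma measurable_normc D f : cmeasurable D f ->
  measurable_fun D (fun x => normc (f x)).
Proof.
move=> [f1 f2]; under eq_fun do rewrite normcE2.
apply: (@measurableT_comp _ _ _ _ _ _ (@Num.sqrt R)) => //.
  by apply: continuous_measurable_fun; exact: sqrt_continuous.
by apply: measurable_funD; exact: measurable_funX.
Qed.

Lemma cmeasurableS D E f : measurable E -> D `<=` E ->
  cmeasurable E f -> cmeasurable D f.
Proof. by move=> mE DE [? ?]; split; exact: (measurable_funS mE DE). Qed.

Lemma cintegrable_le D f (h : T -> R) : measurable D -> cmeasurable D f ->
  mu.-integrable D (EFin \o h) -> (forall x, D x -> normc (f x) <= h x) ->
  cintegrable mu D f.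
Proof.
move=> mD [f1 f2] hi fh; split; apply: le_integrable hi => //.
- exact/measurable_EFinP.
- move=> x Dx /=; rewrite lee_fin (le_trans (le_Re_normc _))//.
  by rewrite (le_trans (fh x Dx))// ler_norm.
- exact/measurable_EFinP.
- move=> x Dx /=; rewrite lee_fin (le_trans (le_Im_normc _))//.
  by rewrite (le_trans (fh x Dx))// ler_norm.
Qed.

Lemma cintegrable_meas D f : cintegrable mu D f -> cmeasurable D f.
Proof.
by move=> [/integrableP[/measurable_EFinP ? _] /integrableP[/measurable_EFinP ? _]].
Qed.

Lemma cintegrable_normc D f : measurable D -> cintegrable mu D f ->
  mu.-integrable D (fun x => (normc (f x))%:E).
Proof.
move=> mD fi; have [f1 f2] := fi; have mf := cintegrable_meas fi.
apply: le_integrable (integrableD mD (integrable_abse f1) (integrable_abse f2)) => //.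
  exact/measurable_EFinP/measurable_normc.
move=> x Dx /=; rewrite ger0_norm ?normc_ge0// lee_fin.
by rewrite (le_trans (normc_le_ReIm _))// ler_norm.
Qed.

Lemma eq_cintegral D f g : {in D, f =1 g} ->
  cintegral mu D f = cintegral mu D g.
Proof.
move=> fg; rewrite /cintegral; congr (_ +i* _); apply: eq_Rintegral => x xD;
  by rewrite fg.
Qed.

Lemma eq_cintegrable D f g : measurable D -> {in D, f =1 g} ->
  cintegrable mu D f -> cintegrable mu D g.
Proof.
move=> mD fg [f1 f2]; split.
  by apply: eq_integrable f1 => // x xD; rewrite fg.
by apply: eq_integrable f2 => // x xD; rewrite fg.
Qed.

Lemma cintegral_mkcond D f :
  cintegral mu D f = cintegral mu setT (fun x => (\1_D x)%:C * f x).
Proof.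
rewrite /cintegral; congr (_ +i* _); rewrite Rintegral_mkcond;
  apply: eq_Rintegral => x _; rewrite patchE indicE; case: ifPn => _ /=;
  by rewrite ?cReM ?cImM/= ?(mul1r, mul0r, subr0, addr0).
Qed.

Lemma cintegrable_mkcond D f : measurable D ->
  cintegrable mu D f <-> cintegrable mu setT (fun x => (\1_D x)%:C * f x).
Proof.
move=> mD; rewrite /cintegrable !(integrable_mkcond _ mD).
have -> : ((fun x => (complex.Re (f x))%:E) \_ D) =
   (fun x => (complex.Re ((\1_D x)%:C * f x))%:E).
  apply/funext => x; rewrite patchE indicE; case: ifPn => _ /=;
  by rewrite ?cReM ?cImM/= ?(mul1r, mul0r, subr0, addr0).
have -> : ((fun x => (complex.Im (f x))%:E) \_ D) =
   (fun x => (complex.Im ((\1_D x)%:C * f x))%:E).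
  apply/funext => x; rewrite patchE indicE; case: ifPn => _ /=;
  by rewrite ?cReM ?cImM/= ?(mul1r, mul0r, subr0, addr0).
by [].
Qed.

Lemma cintegrableZl D c f : measurable D -> cintegrable mu D f ->
  cintegrable mu D (fun x => c * f x).
Proof.
move=> mD fi; apply: (@cintegrable_le _ _ (fun x => normc c * normc (f x))) => //.
- by apply: cmeasurableM; [exact: cmeasurable_cst|exact: cintegrable_meas].
- by apply: (integrableZl mD (normc c) (cintegrable_normc mD fi)).
- by move=> x _; rewrite normcM.
Qed.

Lemma cintegralZl D c f : measurable D -> cintegrable mu D f ->
  cintegral mu D (fun x => c * f x) = c * cintegral mu D f.
Proof.
move=> mD [f1 f2]; pose z1 k := integrableZl mD k f1.
pose z2 k := integrableZl mD k f2.
apply: complex_eqP; rewrite ?cReM ?cImM/=.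
  under eq_Rintegral do rewrite cReM.
  by rewrite RintegralB ?RintegralZl//; [exact: z1|exact: z2].
under eq_Rintegral do rewrite cImM.
by rewrite RintegralD ?RintegralZl//; [exact: z2|exact: z1].
Qed.

Lemma cintegralD D f g : measurable D -> cintegrable mu D f -> cintegrable mu D g ->
  cintegral mu D (fun x => f x + g x) = cintegral mu D f + cintegral mu D g.
Proof.
move=> mD [f1 f2] [g1 g2]; apply: complex_eqP; rewrite ?cReD ?cImD/=.
  by under eq_Rintegral do rewrite cReD; rewrite RintegralD.
by under eq_Rintegral do rewrite cImD; rewrite RintegralD.
Qed.

Lemma normc_cintegral_le D f : measurable D -> cintegrable mu D f ->
  normc (cintegral mu D f) <= 2 * \int[mu]_(x in D) normc (f x).
Proof.
move=> mD fi; have [f1 f2] := fi; have ni := cintegrable_normc mD fi.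
rewrite (le_trans (normc_le_ReIm _))// mulr_natl mulr2n lerD//=.
  rewrite (le_trans (le_normr_Rintegral mD f1))// le_Rintegral//.
    exact: (integrable_abse f1).
  by move=> x _; exact: le_Re_normc.
rewrite (le_trans (le_normr_Rintegral mD f2))// le_Rintegral//.
  exact: (integrable_abse f2).
by move=> x _; exact: le_Im_normc.
Qed.

Lemma cintegral_ae_eq D f g : measurable D -> cmeasurable D f -> cmeasurable D g ->
  ae_eq mu D f g -> cintegral mu D f = cintegral mu D g.
Proof.
move=> mD [f1 f2] [g1 g2] fg; rewrite /cintegral /Rintegral.
congr (fine _ +i* fine _); apply: ae_eq_integral => //; try exact/measurable_EFinP.
  by move: fg; apply: filterS => x /[apply] ->.
by move: fg; apply: filterS => x /[apply] ->.
Qed.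

Lemma cintegrable_ae_eq D f g : measurable D -> cmeasurable D g ->
  ae_eq mu D f g -> cintegrable mu D f -> cintegrable mu D g.
Proof.
move=> mD [g1 g2] fg [f1 f2]; split.
  apply: ae_eq_integrable f1 => //; first exact/measurable_EFinP.
  by move: fg; apply: filterS => x /[apply] ->.
apply: ae_eq_integrable f2 => //; first exact/measurable_EFinP.
by move: fg; apply: filterS => x /[apply] ->.
Qed.

End complex_integral.

Section complex_fubini.
Context {R : realType} {d1 d2} {T1 : measurableType d1} {T2 : measurableType d2}.
Variable m1 : {sigma_finite_measure set T1 -> \bar R}.
Variable m2 : {sigma_finite_measure set T2 -> \bar R}.
Variables (f : T1 -> T2 -> R[i]) (h : T1 * T2 -> R).
Hypothesis mf : cmeasurable setT (fun z => f z.1 z.2).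
Hypothesis hi : (m1 \x m2)%E.-integrable setT (EFin \o h).
Hypothesis fh : forall x y, normc (f x y) <= h (x, y).

Lemma cintegrable_prod : cintegrable (m1 \x m2)%E setT (fun z => f z.1 z.2).
Proof. by apply: (cintegrable_le measurableT mf hi) => -[x y] _; exact: fh. Qed.

Lemma cintegrable_fubini1 :
  cintegrable m1 setT (fun x => cintegral m2 setT (f x)).
Proof.
have [p1 p2] := cintegrable_prod.
by split; [exact: (integrable_Rfubini1 p1)|exact: (integrable_Rfubini1 p2)].
Qed.

Lemma cintegrable_fubini2 :
  cintegrable m2 setT (fun y => cintegral m1 setT (f^~ y)).
Proof.
have [p1 p2] := cintegrable_prod.
by split; [exact: (integrable_Rfubini2 p1)|exact: (integrable_Rfubini2 p2)].
Qed.

Lemma cintegral_fubini :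
  cintegral m1 setT (fun x => cintegral m2 setT (f x)) =
  cintegral m2 setT (fun y => cintegral m1 setT (f^~ y)).
Proof.
have [p1 p2] := cintegrable_prod.
rewrite /cintegral/=; congr (_ +i* _); [exact: (Rintegral_fubini p1)|exact: (Rintegral_fubini p2)].
Qed.

End complex_fubini.

Section dominated.
Context {R : realType} {d} {T : measurableType d} (mu : {measure set T -> \bar R}).

Lemma Rintegral_dominated_cvg (D : set T) (f_ : nat -> T -> R) (f g : T -> R) :
  measurable D -> (forall n, measurable_fun D (f_ n)) ->
  (forall x, D x -> f_ n x @[n --> \oo] --> f x) ->
  mu.-integrable D (EFin \o g) -> (forall n x, D x -> `|f_ n x| <= g x) ->
  mu.-integrable D (EFin \o f) /\
  \int[mu]_(x in D) f_ n x @[n --> \oo] --> \int[mu]_(x in D) f x.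
Proof.
move=> mD mf_ ff gi fg.
have mf : measurable_fun D (EFin \o f).
  apply/measurable_EFinP; exact: (measurable_fun_cvg mf_ ff).
have [|||fi _ H] := @dominated_convergence _ _ _ mu D mD (fun n => EFin \o f_ n)
  (EFin \o f) (EFin \o g) _ mf _ gi.
- by move=> n; exact/measurable_EFinP.
- apply: aeW => x Dx; apply/cvg_EFin; first exact: nearW.
  exact: ff.
- by apply: aeW => x n Dx; rewrite lee_fin fg.
split=> //; apply: fine_cvg; rewrite fineK//; exact: integrable_fin_num.
Qed.

Lemma cintegral_dominated_cvg (D : set T) (f_ : nat -> T -> R[i]) (f : T -> R[i]) (g : T -> R) :
  measurable D -> (forall n, cmeasurable D (f_ n)) ->
  (forall x, D x -> complex.Re (f_ n x) @[n --> \oo] --> complex.Re (f x)) ->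
  (forall x, D x -> complex.Im (f_ n x) @[n --> \oo] --> complex.Im (f x)) ->
  mu.-integrable D (EFin \o g) -> (forall n x, D x -> normc (f_ n x) <= g x) ->
  complex.Re (cintegral mu D (f_ n)) @[n --> \oo] --> complex.Re (cintegral mu D f) /\
  complex.Im (cintegral mu D (f_ n)) @[n --> \oo] --> complex.Im (cintegral mu D f).
Proof.
move=> mD mf_ f1 f2 gi fg; split.
  apply: (Rintegral_dominated_cvg mD (fun n => (mf_ n).1) f1 gi _).2 => n x Dx.
  exact: le_trans (le_Re_normc _) (fg n x Dx).
apply: (Rintegral_dominated_cvg mD (fun n => (mf_ n).2) f2 gi _).2 => n x Dx.
exact: le_trans (le_Im_normc _) (fg n x Dx).
Qed.

End dominated.

Section complex_shift.
Context {R : realType}.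
Notation leb := (@lebesgue_measure R).

Lemma cintegral_shift (c : R) (f : R -> R[i]) : cintegrable leb setT f ->
  cintegral leb setT (fun x => f (x - c)) = cintegral leb setT f.
Proof.
move=> [f1 f2]; rewrite /cintegral; congr (_ +i* _).
  exact: (Rintegral_shift c f1).
exact: (Rintegral_shift c f2).
Qed.

Lemma cintegrable_shift (c : R) (f : R -> R[i]) : cintegrable leb setT f ->
  cintegrable leb setT (fun x => f (x - c)).
Proof.
by move=> [f1 f2]; split; [exact: (integrable_shift c f1)|exact: (integrable_shift c f2)].
Qed.

Lemma cintegral_reflect (f : R -> R[i]) : cintegrable leb setT f ->
  cintegral leb setT (fun x => f (- x)) = cintegral leb setT f.
Proof.
move=> [f1 f2]; rewrite /cintegral; congr (_ +i* _).
  exact/esym/(Rintegral_reflect f1).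
exact/esym/(Rintegral_reflect f2).
Qed.

End complex_shift.

Section exponential_integral.
Context {R : realType}.
Notation leb := (@lebesgue_measure R).

Lemma Rintegral_FTC (f F : R -> R) (a b : R) : a <= b -> continuous f ->
  (forall x : R, is_derive x (1 : R) F (f x)) ->
  \int[leb]_(x in `[a, b]) f x = F b - F a.
Proof.
rewrite le_eqVlt => /predU1P[->|ab] cf dF.
  by rewrite set_itv1 Rintegral_set1 subrr.
have cF : continuous F.
  by move=> x; apply: differentiable_continuous; apply/derivable1_diffP; case: (dF x).
rewrite /Rintegral (@continuous_FTC2 _ f F)//.
- exact: continuous_subspaceT.
- split; first by move=> x _; case: (dF x).
  + by apply: cvg_at_right_filter; exact: cF.
  + by apply: cvg_at_left_filter; exact: cF.
- by move=> x _; rewrite derive1E; case: (dF x).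
Qed.

Lemma Rintegral_FTC_0y (f F g : R -> R) : continuous f ->
  (forall x : R, is_derive x (1 : R) F (f x)) ->
  leb.-integrable `]0, +oo[ (EFin \o g) -> (forall x, 0 < x -> `|f x| <= g x) ->
  F n%:R @[n --> \oo] --> (0 : R) ->
  \int[leb]_(x in `]0, +oo[) f x = - F 0.
Proof.
move=> cf dF gi fg F0.
have mf : measurable_fun setT f by exact: continuous_measurable_fun.
pose f_ (n : nat) (x : R) := \1_(`[0, n%:R]%classic) x * f x.
have [||||_ H] := @Rintegral_dominated_cvg R _ _ leb `]0, +oo[ f_ f g _ _ _ gi.
- by [].
- move=> n; apply: measurable_funM; last exact: measurable_funTS.
  exact: measurable_indic.
- move=> x; rewrite /= in_itv/= andbT => x0.
  apply: cvg_near_cst; near=> n.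
  rewrite /f_ indicE mem_set ?mul1r//= in_itv/= (ltW x0)/=.
  near: n; exact: nbhs_infty_ger.
- move=> n x; rewrite /= in_itv/= andbT => x0; rewrite /f_ normrM.
  rewrite (le_trans _ (fg x x0))// ler_piMl// indicE; case: (_ \in _) => /=;
  by rewrite ?normr1 ?normr0.
have E n : \int[leb]_(x in `]0, +oo[) f_ n x = F n%:R - F 0.
  rewrite -(@Rintegral_FTC f F)//.
  have -> : \int[leb]_(x in `[0, n%:R]) f x = \int[leb]_(x in `]0, n%:R]) f x.
    rewrite /Rintegral integral_itv_obnd_cbnd//.
    by apply: measurable_funTS; exact/measurable_EFinP.
  rewrite Rintegral_mkcond [RHS]Rintegral_mkcond; apply: eq_Rintegral => x _.
  rewrite !patchE /f_ !mem_setE !in_itv/= !indicE.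
  rewrite mem_setE in_itv/= andbT; case: ltP => //= x0.
  by rewrite (ltW x0)/=; case: ifPn; rewrite ?mul1r ?mul0r.
move: H; under eq_fun do rewrite E.
move=> H; apply/esym/(cvg_unique _ _ H) => //=.
rewrite -[X in _ --> X]add0r; apply: cvgB => //; exact: cvg_cst.
Unshelve. all: by end_near. Qed.

Lemma integrable_expN (a : R) : 0 < a ->
  leb.-integrable `]0, +oo[ (fun x => (expR (- (a * x)))%:E).
Proof.
move=> a0.
have H := integrableZl measurableT a^-1 (integrable_exponential_pdf a0).
have : leb.-integrable `]0, +oo[ (fun x => (a^-1 * exponential_pdf a x)%:E).
  exact: integrableS H.
apply: eq_integrable => // x; rewrite inE/= in_itv/= andbT => x0.
rewrite exponential_pdfE ?(ltW x0)// mulNr mulrA mulVf ?mul1r//.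
by rewrite gt_eqF.
Qed.

Lemma is_derive_exp_trig (a b p q x : R) :
  is_derive x (1 : R) (fun t : R => expR (- (a * t)) * (p * cos (b * t) + q * sin (b * t)))
    (expR (- (a * x)) * ((b * q - a * p) * cos (b * x) - (a * q + b * p) * sin (b * x))).
Proof.
apply: is_derive_eq.
rewrite /GRing.scale/=.
ring.
Qed.

Lemma cintegral_cexp (l : R[i]) : 0 < complex.Re l ->
  cintegrable leb `]0, +oo[ (fun t => cexp (- (l * t%:C))) /\
  cintegral leb `]0, +oo[ (fun t => cexp (- (l * t%:C))) = l^-1.
Proof.
case: l => a b; rewrite [complex.Re _]/= => a0.
have E (t : R) : cexp (- ((a +i* b) * t%:C)) = (expR (- (a * t)) * cos (b * t)) +i*
   (- (expR (- (a * t)) * sin (b * t))) :> R[i].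
  apply: complex_eqP; rewrite /= ?mulr0 ?subr0 ?addr0 ?add0r ?cosN ?sinN ?mulrN//.
have n0 : a ^+ 2 + b ^+ 2 != 0.
  by rewrite gt_eqF// ltr_pwDl ?sqr_ge0// exprn_gt0.
split.
  apply: (@cintegrable_le _ _ _ leb _ _ (fun t : R => expR (- (a * t)))) => //.
  - apply: cmeasurable_cexp; apply: cmeasurableN; apply: cmeasurableM.
      exact: cmeasurable_cst.
    exact: cmeasurable_real.
  - exact: integrable_expN.
  - by move=> x _; rewrite normc_cexp/= mulr0 subr0.
have cE : continuous (fun t : R => expR (- (a * t))).
  move=> x; apply: continuous_comp; last exact: continuous_expR.
  by apply: cvgN; apply: cvgM; [exact: cvg_cst|exact: cvg_id].
have cb : continuous (fun t : R => b * t).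
  by move=> x; apply: cvgM; [exact: cvg_cst|exact: cvg_id].
have F0 (p q : R) : expR (- (a * n%:R)) * (p * cos (b * n%:R) + q * sin (b * n%:R))
    @[n --> \oo] --> (0 : R).
  apply/cvgr0Pnorm_le => /= e e0.
  have : (`|p| + `|q|) * expR (- a) ^+ n @[n --> \oo] --> (0 : R).
    rewrite -(mulr0 (`|p| + `|q|)); apply: cvgM; first exact: cvg_cst.
    by apply: cvg_expr; rewrite ger0_norm ?expR_ge0// expR_lt1 oppr_lt0.
  move=> /cvgr0Pnorm_le /(_ e e0); apply: filterS => n; apply: le_trans.
  have -> : expR (- (a * n%:R)) = expR (- a) ^+ n.
    by rewrite -expRM_natl mulr_natl mulNrn mulr_natr.
  rewrite !normrM mulrC ler_wpM2r//.
  rewrite [leRHS]ger0_norm ?addr_ge0// (le_trans (ler_normD _ _))// lerD// normrM;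
  by rewrite ler_piMr// ?(sin_le1, cos_le1) ler_norml ?sin_geN1 ?sin_le1 ?cos_geN1 ?cos_le1.
under eq_cintegral do rewrite E.
have bnd (u x : R) : `|u| <= 1 -> `|expR (- (a * x)) * u| <= expR (- (a * x)).
  by move=> u1; rewrite normrM ger0_norm ?expR_ge0// ler_piMr// expR_ge0.
rewrite /cintegral/=; congr (_ +i* _).
- have dF (x : R) : is_derive x (1 : R) (fun t : R => expR (- (a * t)) *
      (- a / (a ^+ 2 + b ^+ 2) * cos (b * t) + b / (a ^+ 2 + b ^+ 2) * sin (b * t)))
      (expR (- (a * x)) * cos (b * x)).
    apply: (is_derive_eq (is_derive_exp_trig a b _ _ x)).
    by congr (_ * _); field.
  rewrite (Rintegral_FTC_0y _ dF (integrable_expN a0) _ (F0 _ _))//.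
  + by rewrite !mulr0 cos0 sin0 oppr0 expR0 mul1r mulr0 mulr1 addr0 mulNr opprK.
  + move=> x; apply: cvgM; first exact: cE.
    by apply: continuous_comp; [exact: cb|exact: continuous_cos].
  + by move=> x _; apply: bnd; rewrite ler_norml cos_geN1 cos_le1.
- have dF (x : R) : is_derive x (1 : R) (fun t : R => expR (- (a * t)) *
      (b / (a ^+ 2 + b ^+ 2) * cos (b * t) + a / (a ^+ 2 + b ^+ 2) * sin (b * t)))
      (- (expR (- (a * x)) * sin (b * x))).
    apply: (is_derive_eq (is_derive_exp_trig a b _ _ x)).
    by field.
  rewrite (Rintegral_FTC_0y _ dF (integrable_expN a0) _ (F0 _ _))//.
  + by rewrite !mulr0 cos0 sin0 oppr0 expR0 mul1r mulr0 mulr1 addr0.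
  + move=> x; apply: cvgN; apply: cvgM; first exact: cE.
    by apply: continuous_comp; [exact: cb|exact: continuous_sin].
  + by move=> x _; rewrite normrN; apply: bnd; rewrite ler_norml sin_geN1 sin_le1.
Qed.

End exponential_integral.

Lemma cintegrableD {R : realType} {d} {T : measurableType d}
    (mu : {measure set T -> \bar R}) (D : set T) (f g : T -> R[i]) :
  measurable D -> cintegrable mu D f -> cintegrable mu D g ->
  cintegrable mu D (fun x => f x + g x).
Proof.
move=> mD fi gi.
apply: (cintegrable_le (h := fun x => normc (f x) + normc (g x))) => //.
- by apply: cmeasurableD; [exact: (cintegrable_meas fi)|exact: (cintegrable_meas gi)].
- by apply: (integrableD mD (cintegrable_normc mD fi) (cintegrable_normc mD gi)).
- by move=> x _; exact: le_normcD.
Qed.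

Lemma rcM {R : realType} (x y : R) : (x * y)%:C = x%:C * y%:C :> R[i].
Proof. by apply: complex_eqP; rewrite ?cReM ?cImM/= ?(mulr0, mul0r, subr0, addr0). Qed.

Lemma cintegral_real {R : realType} {d} {T : measurableType d}
    (mu : {measure set T -> \bar R}) (D : set T) (f : T -> R) : measurable D ->
  cintegral mu D (fun x => (f x)%:C) = (\int[mu]_(x in D) f x)%:C.
Proof.
by move=> mD; apply: complex_eqP => //=; rewrite Rintegral_cst// mul0r.
Qed.

(** * Fourier transform on the line *)

Section fourier.
Context {R : realType}.
Notation leb := (@lebesgue_measure R).

Lemma lebesgue_fubini (f : R -> R -> R[i]) (h : R * R -> R) :
  cmeasurable setT (fun z : R * R => f z.1 z.2) ->
  (leb \x leb)%E.-integrable setT (EFin \o h) ->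
  (forall x y, normc (f x y) <= h (x, y)) ->
  [/\ cintegrable leb setT (fun x => cintegral leb setT (f x)),
      cintegrable leb setT (fun y => cintegral leb setT (f^~ y)) &
      cintegral leb setT (fun x => cintegral leb setT (f x)) =
      cintegral leb setT (fun y => cintegral leb setT (f^~ y))].
Proof.
move=> mf hi fh; split.
- exact: (cintegrable_fubini1 (m1 := leb) (m2 := leb) mf hi fh).
- exact: (cintegrable_fubini2 (m1 := leb) (m2 := leb) mf hi fh).
- exact: (cintegral_fubini (m1 := leb) (m2 := leb) mf hi fh).
Qed.

Definition cis (u : R) : R[i] := cos u +i* sin u.

Lemma cexpE (a b : R) : cexp (a +i* b) = (expR a)%:C * cis b.
Proof. by apply: complex_eqP; rewrite ?cReM ?cImM/= mul0r ?subr0 ?addr0. Qed.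

Lemma cisD (u v : R) : cis (u + v) = cis u * cis v.
Proof. by apply: complex_eqP; rewrite ?cReM ?cImM/= ?cosD ?sinD// addrC. Qed.

Lemma cis0 : cis 0 = 1.
Proof. by rewrite /cis cos0 sin0. Qed.

Lemma normc_cis u : normc (cis u) = 1.
Proof. by rewrite normcE2/= cos2Dsin2 sqrtr1. Qed.

Lemma cmeasurable_cis {d} {T : measurableType d} (D : set T) (h : T -> R) :
  measurable_fun D h -> cmeasurable D (fun x => cis (h x)).
Proof.
move=> mh; split; apply: measurableT_comp => //; apply: continuous_measurable_fun.
  exact: continuous_cos.
exact: continuous_sin.
Qed.

Lemma ae_eq_neq (a : R) {V : Type} (D : set R) (f g : R -> V) :
  (forall x, D x -> x != a -> f x = g x) -> ae_eq leb D f g.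
Proof.
move=> fg; exists [set a]; split => //; first exact: lebesgue_measure_set1.
by move=> x /= H; apply: contrapT => /eqP xa; apply: H => Dx; exact: fg.
Qed.

Lemma cintegrable_reflect (f : R -> R[i]) : cintegrable leb setT f ->
  cintegrable leb setT (fun x => f (- x)).
Proof.
by move=> [f1 f2]; split; [exact: (integrable_reflect f1)|exact: (integrable_reflect f2)].
Qed.

Lemma cintegral_two_sided (f : R -> R[i]) : cmeasurable setT f ->
  cintegrable leb `]0, +oo[ f -> cintegrable leb `]0, +oo[ (fun x => f (- x)) ->
  cintegrable leb setT f /\
  cintegral leb setT f =
    cintegral leb `]0, +oo[ f + cintegral leb `]0, +oo[ (fun x => f (- x)).
Proof.
move=> mf f1 f2.
have /= /cintegrable_mkcond i1 := f1; have /= /cintegrable_mkcond i2 := f2.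
have {}i1 := i1 (measurable_itv _); have {}i2 := i2 (measurable_itv _).
have j2 := cintegrable_reflect i2.
have fE : ae_eq leb setT (fun x : R => (\1_(`]0, +oo[%classic) x)%:C * f x +
    (\1_(`]0, +oo[%classic) (- x))%:C * f (- - x)) f.
  apply: (ae_eq_neq (a := 0)) => x _ x0.
  rewrite !indicE !mem_setE !in_itv/= !andbT opprK oppr_gt0.
  by case: ltgtP x0 => //= _ _; rewrite mul0r mul1r ?addr0 ?add0r.
have k := cintegrableD measurableT i1 j2.
split; first exact: cintegrable_ae_eq fE k.
rewrite -(cintegral_ae_eq measurableT (cintegrable_meas k) mf fE).
rewrite cintegralD// [in RHS]cintegral_mkcond; congr (_ + _).
by rewrite [in RHS]cintegral_mkcond (cintegral_reflect i2).
Qed.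

Lemma cintegral_poisson (e u : R) : 0 < e ->
  cintegrable leb setT (fun y : R => (expR (- (e * `|y|)))%:C * cis (y * u)) /\
  cintegral leb setT (fun y : R => (expR (- (e * `|y|)))%:C * cis (y * u)) =
    (2 * e / (e ^+ 2 + u ^+ 2))%:C.
Proof.
move=> e0.
have n0 : e ^+ 2 + u ^+ 2 != 0 by rewrite gt_eqF// ltr_pwDl ?sqr_ge0// exprn_gt0.
have E (v y : R) : cexp (- ((e +i* v) * y%:C)) = (expR (- (e * y)))%:C * cis (y * - v).
  rewrite -cexpE; congr cexp; apply: complex_eqP => /=; ring.
have H (v : R) := @cintegral_cexp R (e +i* v) e0.
have mabs : cmeasurable setT (fun y : R => (expR (- (e * `|y|)))%:C * cis (y * u)).
  apply: cmeasurableM; first apply: cmeasurable_real.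
    apply: measurableT_comp => //; apply: measurableT_comp => //.
    exact: measurable_funM.
  by apply: cmeasurable_cis; exact: measurable_funM.
have pos (y : R) : y \in `]0%R, +oo[%classic -> 0 < y.
  by rewrite inE/= in_itv/= andbT.
have E1 : {in `]0%R, +oo[%classic, (fun y : R => cexp (- ((e +i* - u) * y%:C))) =1
    (fun y : R => (expR (- (e * `|y|)))%:C * cis (y * u))}.
  by move=> y /pos y0; rewrite [LHS]E opprK gtr0_norm.
have E2 : {in `]0%R, +oo[%classic, (fun y : R => cexp (- ((e +i* u) * y%:C))) =1
    (fun y : R => (expR (- (e * `|- y|)))%:C * cis (- y * u))}.
  by move=> y /pos y0; rewrite [LHS]E normrN gtr0_norm// mulrN mulNr.
have [i1 v1] := H (- u); have [i2 v2] := H u.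
have j1 := eq_cintegrable (mu := leb) (measurable_itv _) E1 i1.
have j2 := eq_cintegrable (mu := leb) (measurable_itv _) E2 i2.
have [ii vv] := cintegral_two_sided mabs j1 j2; split=> //.
rewrite vv -(eq_cintegral leb E1) -(eq_cintegral leb E2) v1 v2.
by apply: complex_eqP; rewrite ?cReD ?cImD/= ?sqrrN; field.
Qed.

Definition fourier (k : R -> R) (y : R) : R[i] :=
  cintegral leb setT (fun s : R => cis (- (y * s)) * (k s)%:C).

Lemma integrable_expR_abs (e : R) : 0 < e ->
  leb.-integrable setT (fun y : R => (expR (- (e * `|y|)))%:E).
Proof.
move=> e0; have [+ _] := cintegral_poisson 0 e0.
move=> /(cintegrable_normc measurableT); apply: eq_integrable => // y _.
by rewrite normcM normc_cis mulr1 normc_real ger0_norm// expR_ge0.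
Qed.

Lemma cintegrable_fourier (q : R -> R) (y : R) :
  leb.-integrable setT (EFin \o q) ->
  cintegrable leb setT (fun s : R => cis (- (y * s)) * (q s)%:C).
Proof.
move=> qi; have /integrableP[/measurable_EFinP mq _] := qi.
apply: (cintegrable_le (mu := leb) (h := fun s : R => `|q s|)) => //.
- apply: cmeasurableM; last exact: cmeasurable_real.
  by apply: cmeasurable_cis; apply: measurableT_comp => //; exact: measurable_funM.
- exact: (integrable_abse qi).
- by move=> s _; rewrite normcM normc_cis mul1r normc_real.
Qed.

Lemma fourier_poisson (q : R -> R) (e t : R) : 0 < e ->
  leb.-integrable setT (EFin \o q) ->
  cintegrable leb setT
    (fun y : R => (expR (- (e * `|y|)))%:C * cis (y * t) * fourier q y) /\
  cintegral leb setT
    (fun y : R => (expR (- (e * `|y|)))%:C * cis (y * t) * fourier q y) =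
  (\int[leb]_s (q s * (2 * e / (e ^+ 2 + (t - s) ^+ 2))))%:C.
Proof.
move=> e0 qi; have /integrableP[/measurable_EFinP mq _] := qi.
pose f (y s : R) : R[i] := (expR (- (e * `|y|)))%:C * cis (y * t) *
   (cis (- (y * s)) * (q s)%:C).
have mf : cmeasurable setT (fun z : R * R => f z.1 z.2).
  apply: cmeasurableM; apply: cmeasurableM.
  - apply: cmeasurable_real; apply: measurableT_comp => //; apply: measurableT_comp => //.
    by apply: measurable_funM => //; exact: measurableT_comp.
  - by apply: cmeasurable_cis; exact: measurable_funM.
  - by apply: cmeasurable_cis; apply: measurableT_comp => //; exact: measurable_funM.
  - by apply: cmeasurable_real; exact: measurableT_comp mq measurable_snd.
have hi := integrable_tensor (integrable_expR_abs e0) (integrable_abse qi).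
have fh x y : normc (f x y) <= expR (- (e * `|x|)) * `|q y|.
  rewrite /f !normcM !normc_cis mulr1 mul1r !normc_real.
  by rewrite [X in X * _]ger0_norm ?expR_ge0.
have E : (fun y => cintegral leb setT (f y)) =
    (fun y : R => (expR (- (e * `|y|)))%:C * cis (y * t) * fourier q y).
  by apply/funext => y; rewrite -cintegralZl//; exact: cintegrable_fourier.
have [fi _ fE] := lebesgue_fubini mf hi fh.
rewrite -E; split; first exact: fi.
rewrite fE.
have E2 (s : R) : cintegral leb setT (f^~ s) =
   (q s * (2 * e / (e ^+ 2 + (t - s) ^+ 2)))%:C.
  have [i1 v1] := cintegral_poisson (t - s) e0.
  rewrite rcM -v1 -(cintegralZl (q s)%:C measurableT i1); apply: eq_cintegral => y _.
  by rewrite /f mulrBr cisD; ring.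
under eq_cintegral do rewrite E2.
by rewrite cintegral_real.
Qed.

End fourier.

Section inversion.
Context {R : realType}.
Notation leb := (@lebesgue_measure R).

Lemma cauchy_kernel :
  leb.-integrable setT (fun v : R => (2 / (1 + v ^+ 2))%:E) /\
  \int[leb]_v (2 / (1 + v ^+ 2)) = 2 * pi.
Proof.
have H : (\int[leb]_(x in [set: R]) (2 / (1 + x ^+ 2))%:E = (2 * pi)%:E)%E.
  under eq_integral do rewrite EFinM.
  have m1 : measurable_fun setT (fun x : R => (1 + x ^+ 2)^-1).
    by apply: continuous_measurable_fun; exact: continuous_oneDsqrV.
  rewrite ge0_integralZl//; first last.
  - by move=> x _; rewrite lee_fin invr_ge0 addr_ge0// sqr_ge0.
  - exact/measurable_EFinP.
  rewrite (@ge0_symfun_integralT _ (fun x : R => (1 + x ^+ 2)^-1)).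
  - rewrite -set_itvcy.
    have := @integral0y_oneDsqr R; rewrite /oneDsqr => ->.
    by rewrite -!EFinM; congr EFin; field.
  - by move=> x; rewrite invr_ge0 addr_ge0// sqr_ge0.
  - exact: continuous_oneDsqrV.
  - by move=> x /=; rewrite sqrrN.
split; last by rewrite /Rintegral H.
apply/integrableP; split.
  apply/measurable_EFinP; apply: measurable_funM => //.
  by apply: continuous_measurable_fun; exact: continuous_oneDsqrV.
under eq_integral => x _.
  rewrite gee0_abs; last by rewrite lee_fin divr_ge0// addr_ge0// sqr_ge0.
  over.
by rewrite H ltry.
Qed.

Lemma poisson_rescale (q : R -> R) (M e t : R) : 0 < e ->
  leb.-integrable setT (EFin \o q) -> (forall s, `|q s| <= M) ->
  \int[leb]_s (q s * (2 * e / (e ^+ 2 + (t - s) ^+ 2))) =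
  \int[leb]_v (q (e * v + t) * (2 / (1 + v ^+ 2))).
Proof.
move=> e0 qi qM; have /integrableP[/measurable_EFinP mq _] := qi.
have mP : measurable_fun setT (fun s : R => 2 * e / (e ^+ 2 + (t - s) ^+ 2)).
  apply: measurable_funM => //; apply: continuous_measurable_fun => x.
  apply: cvgV; first by rewrite gt_eqF// ltr_pwDl ?sqr_ge0// exprn_gt0.
  apply: cvgD; first exact: cvg_cst.
  apply: cvgM; apply: cvgB; (exact: cvg_cst || exact: cvg_id).
have Pb s : `|2 * e / (e ^+ 2 + (t - s) ^+ 2)| <= 2 / e.
  rewrite ger0_norm; last first.
    by rewrite divr_ge0 ?addr_ge0 ?sqr_ge0// mulr_ge0// ltW.
  rewrite ler_pdivrMr; last by rewrite ltr_pwDl ?sqr_ge0// exprn_gt0.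
  rewrite mulrDr -[leLHS]addr0 lerD//.
    by rewrite expr2 mulrA divfK ?gt_eqF.
  by rewrite mulr_ge0 ?sqr_ge0// divr_ge0// ltW.
have qPi : leb.-integrable setT (fun s : R => (q s * (2 * e / (e ^+ 2 + (t - s) ^+ 2)))%:E).
  apply: (le_integrable measurableT _ _ (integrableZl measurableT (2 / e) (integrable_abse qi))).
    exact/measurable_EFinP/measurable_funM.
  move=> s _ /=; rewrite lee_fin normrM [leRHS]normrM normr_id.
  rewrite [leRHS]mulrC ler_wpM2l//.
  by apply: (le_trans (Pb s)); rewrite ler_norm.
rewrite (Rintegral_affine t e0 qPi) -RintegralZl//; last exact: (integrable_affine t e0 qPi).
apply: eq_Rintegral => v _.
rewrite opprD addrCA subrr addr0 sqrrN mulrCA; congr (_ * _).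
have v0 : 1 + v ^+ 2 != 0 by rewrite gt_eqF// ltr_pwDl ?sqr_ge0.
have en0 : e != 0 by rewrite gt_eqF.
by field; rewrite v0/= -[X in X + _]mulr1 exprMn -mulrDr mulf_neq0// expf_neq0.
Qed.

Lemma harmonic_cvg0 : (n.+1%:R^-1 : R) @[n --> \oo] --> (0 : R).
Proof. exact: cvg_harmonic. Qed.

(* The transform is regularized by [expR (- (`|y| / n))], which convolves [q]
   with the Poisson kernel. *)
Lemma fourier_inversion (q : R -> R) (M t : R) :
  leb.-integrable setT (EFin \o q) -> (forall s, `|q s| <= M) ->
  {for t, continuous q} -> cintegrable leb setT (fourier q) ->
  cintegral leb setT (fun y => cis (y * t) * fourier q y) = (2 * pi * q t)%:C.
Proof.
move=> qi qM qt Fi; have /integrableP[/measurable_EFinP mq _] := qi.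
have [Qi Qv] := cauchy_kernel.
have e0 (n : nat) : 0 < (n.+1%:R^-1 : R) by rewrite invr_gt0.
pose I n := cintegral leb setT
    (fun y : R => (expR (- (n.+1%:R^-1 * `|y|)))%:C * cis (y * t) * fourier q y).
have IE n : I n = (\int[leb]_v (q (n.+1%:R^-1 * v + t) * (2 / (1 + v ^+ 2))))%:C.
  by rewrite /I (fourier_poisson t (e0 n) qi).2 (poisson_rescale t (e0 n) qi qM).
have mQ : measurable_fun setT (fun v : R => 2 / (1 + v ^+ 2)).
  by have /integrableP[/measurable_EFinP] := Qi.
have [|||||_ H1] := @Rintegral_dominated_cvg R _ _ leb setT
  (fun n (v : R) => q (n.+1%:R^-1 * v + t) * (2 / (1 + v ^+ 2)))
  (fun v => q t * (2 / (1 + v ^+ 2))) (fun v => M * (2 / (1 + v ^+ 2))).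
- exact: measurableT.
- move=> n; apply: measurable_funM => //.
  exact: measurableT_comp mq (measurable_affine _ _).
- move=> v _; apply: cvgM; last exact: cvg_cst.
  apply: continuous_cvg; first exact: qt.
  rewrite -[X in _ --> X]add0r; apply: cvgD; last exact: cvg_cst.
  rewrite -[X in _ --> X](mul0r v); apply: cvgM; last exact: cvg_cst.
  exact: harmonic_cvg0.
- exact: (integrableZl measurableT M Qi).
- move=> n v _; rewrite normrM ler_pM// ger0_norm//.
  by rewrite divr_ge0// addr_ge0// sqr_ge0.
move: H1; rewrite RintegralZl// Qv => H1.
have mF := cintegrable_meas Fi.
have mc : cmeasurable setT (fun y : R => cis (y * t)).
  by apply: cmeasurable_cis; exact: measurable_funM.
have cvge (y : R) : expR (- (n.+1%:R^-1 * `|y|)) @[n --> \oo] --> (1 : R).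
  rewrite [X in _ --> X](_ : _ = expR (- (0 * `|y|))); last by rewrite mul0r oppr0 expR0.
  apply: continuous_cvg; first exact: continuous_expR.
  by apply: cvgN; apply: cvgM; [exact: harmonic_cvg0|exact: cvg_cst].
have cvgc (y c : R) : expR (- (n.+1%:R^-1 * `|y|)) * c @[n --> \oo] --> c.
  by rewrite -[X in _ --> X]mul1r; apply: cvgM; [exact: cvge|exact: cvg_cst].
have RI (z : R[i]) (a : R) : complex.Re (a%:C * z) = a * complex.Re z.
  by rewrite cReM/= mul0r subr0.
have II (z : R[i]) (a : R) : complex.Im (a%:C * z) = a * complex.Im z.
  by rewrite cImM/= mul0r addr0.
have [||||||R1 R2] := @cintegral_dominated_cvg R _ _ leb setT
  (fun n (y : R) => (expR (- (n.+1%:R^-1 * `|y|)))%:C * cis (y * t) * fourier q y)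
  (fun y => cis (y * t) * fourier q y) (fun y => normc (fourier q y)).
- exact: measurableT.
- move=> n; apply: cmeasurableM => //; apply: cmeasurableM => //.
  apply: cmeasurable_real; apply: measurableT_comp => //; apply: measurableT_comp => //.
  exact: measurable_funM.
- by move=> y _; under eq_fun do rewrite -mulrA RI; exact: cvgc.
- by move=> y _; under eq_fun do rewrite -mulrA II; exact: cvgc.
- exact: (cintegrable_normc measurableT Fi).
- move=> n y _; rewrite !normcM normc_cis mulr1 normc_real ger0_norm ?expR_ge0//.
  by rewrite ler_piMl ?normc_ge0// expR_le1 oppr_le0 mulr_ge0// invr_ge0.
have {}R1 : complex.Re (I n) @[n --> \oo] -->
   complex.Re (cintegral leb setT (fun y => cis (y * t) * fourier q y)) by exact: R1.
have {}R2 : complex.Im (I n) @[n --> \oo] -->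
   complex.Im (cintegral leb setT (fun y => cis (y * t) * fourier q y)) by exact: R2.
have {}IE := funext IE.
apply: complex_eqP.
  by apply: (cvg_unique _ R1) => //; rewrite IE /= mulrC; exact: H1.
by apply: (cvg_unique _ R2) => //; rewrite IE; exact: cvg_cst.
Qed.

Lemma poisson_integral_bound (q : R -> R) (M e t : R) : 0 < e ->
  leb.-integrable setT (EFin \o q) -> (forall s, `|q s| <= M) ->
  `|\int[leb]_s (q s * (2 * e / (e ^+ 2 + (t - s) ^+ 2)))| <= 2 * pi * M.
Proof.
move=> e0 qi qM; rewrite (poisson_rescale t e0 qi qM).
have /integrableP[/measurable_EFinP mq _] := qi.
have [Qi Qv] := cauchy_kernel.
have mQ : measurable_fun setT (fun v : R => 2 / (1 + v ^+ 2)).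
  by have /integrableP[/measurable_EFinP] := Qi.
have mqQ : measurable_fun setT (fun v : R => q (e * v + t) * (2 / (1 + v ^+ 2))).
  by apply: measurable_funM => //; exact: measurableT_comp mq (measurable_affine _ _).
have MQ := integrableZl measurableT M Qi.
have le v : `|q (e * v + t) * (2 / (1 + v ^+ 2))| <= M * (2 / (1 + v ^+ 2)).
  rewrite normrM ler_pM// ger0_norm//.
  by rewrite divr_ge0// addr_ge0// sqr_ge0.
have ii : leb.-integrable setT (fun v : R => (q (e * v + t) * (2 / (1 + v ^+ 2)))%:E).
  apply: (le_integrable measurableT _ _ MQ); first exact/measurable_EFinP.
  by move=> v _; rewrite lee_fin (le_trans (le v))//= ler_norm.
rewrite (le_trans (le_normr_Rintegral measurableT ii))//.
rewrite -Qv mulrC -RintegralZl//; apply: le_Rintegral => //.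
exact: (integrable_abse ii).
Qed.

Lemma normc_fourier_le (q : R -> R) y : leb.-integrable setT (EFin \o q) ->
  normc (fourier q y) <= 2 * \int[leb]_s `|q s|.
Proof.
move=> qi; apply: le_trans (normc_cintegral_le measurableT (cintegrable_fourier y qi)) _.
by under eq_Rintegral do rewrite normcM normc_cis mul1r normc_real.
Qed.

Lemma cmeasurable_fourier (q : R -> R) : leb.-integrable setT (EFin \o q) ->
  cmeasurable setT (fourier q).
Proof.
move=> qi; have [Fi _] := fourier_poisson 0 ltr01 qi.
have := cmeasurableM (f := fun y : R => (expR `|y|)%:C) _ (cintegrable_meas Fi).
have -> : (fun x : R => (expR `|x|)%:C *
    ((expR (- (1 * `|x|)))%:C * cis (x * 0) * fourier q x)) = fourier q.
  apply/funext => y; rewrite mulr0 cis0 mulr1 mulrA -rcM mul1r -expRD subrr expR0.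
  exact: mul1r.
by apply; apply: cmeasurable_real; exact: measurableT_comp.
Qed.

Lemma fourier_conj (q : R -> R) y : leb.-integrable setT (EFin \o q) ->
  cintegral leb setT (fun t : R => cis (y * t) * (q t)%:C) = (fourier q y)^*%C.
Proof.
move=> qi; have [_ fi] := cintegrable_fourier y qi.
apply: complex_eqP; rewrite /fourier /=.
  by apply: eq_Rintegral => s _; rewrite cosN sinN !mulr0 !subr0.
rewrite -mulN1r -RintegralZl//.
by apply: eq_Rintegral => s _; rewrite /= cosN sinN !mulr0; ring.
Qed.

Lemma fourier_L2 (k : R -> R) (M : R) :
  leb.-integrable setT (EFin \o k) -> (forall s, `|k s| <= M) ->
  leb.-integrable setT (fun y => (normc (fourier k y) ^+ 2)%:E).
Proof.
move=> ki kM; have /integrableP[/measurable_EFinP mk kfin] := ki.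
have mF := cmeasurable_fourier ki.
have mN : measurable_fun setT (fun y => normc (fourier k y) ^+ 2).
  by apply: measurable_funX; exact: measurable_normc.
pose C := 2 * \int[leb]_s `|k s|.
pose w (n : nat) (y : R) := expR (- (n.+1%:R^-1 * `|y|)).
have e0 (n : nat) : 0 < (n.+1%:R^-1 : R) by rewrite invr_gt0.
have mw n : measurable_fun setT (w n).
  by apply: measurableT_comp => //; apply: measurableT_comp => //; exact: measurable_funM.
have bound n : leb.-integrable setT (fun y => (w n y * normc (fourier k y) ^+ 2)%:E) /\
    \int[leb]_y (w n y * normc (fourier k y) ^+ 2) <=
    2 * pi * M * \int[leb]_s `|k s|.
  pose f (t y : R) : R[i] := (k t)%:C * ((w n y)%:C * cis (y * t) * fourier k y).
  have mf : cmeasurable setT (fun z : R * R => f z.1 z.2).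
    apply: cmeasurableM; first by apply: cmeasurable_real; exact: measurableT_comp mk measurable_fst.
    apply: cmeasurableM; last first.
      by split; [exact: measurableT_comp mF.1 measurable_snd|exact: measurableT_comp mF.2 measurable_snd].
    apply: cmeasurableM; last by apply: cmeasurable_cis; exact: measurable_funM.
    by apply: cmeasurable_real; exact: measurableT_comp (mw n) measurable_snd.
  have hi := integrable_tensor (integrable_abse ki)
     (integrableZl measurableT C (integrable_expR_abs (e0 n))).
  have fh x y : normc (f x y) <= `|k x| * (C * w n y).
    rewrite /f !normcM normc_cis mulr1 !normc_real ler_wpM2l// mulrC ler_pM ?normc_ge0//.
      exact: normc_fourier_le.
    by rewrite ger0_norm ?expR_ge0.
  have [f1 f2 fE] := lebesgue_fubini mf hi fh.
  have L t : cintegral leb setT (f t) =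
      (k t * \int[leb]_s (k s * (2 * n.+1%:R^-1 / (n.+1%:R^-1 ^+ 2 + (t - s) ^+ 2))))%:C.
    have [pi1 pv] := fourier_poisson t (e0 n) ki.
    by rewrite rcM -pv -cintegralZl.
  have Rr y : cintegral leb setT (f^~ y) = (w n y * normc (fourier k y) ^+ 2)%:C.
    have <- : (w n y)%:C * (fourier k y * (fourier k y)^*%C) =
      (w n y * normc (fourier k y) ^+ 2)%:C.
      rewrite rcM; congr (_ * _); rewrite normc_sqr.
      by case: (fourier k y) => a b; apply: complex_eqP => /=; ring.
    have ci : cintegrable leb setT (fun t : R => cis (y * t) * (k t)%:C).
      have := cintegrable_fourier (- y) ki.
      by under [X in cintegrable _ _ X -> _]eq_fun do rewrite mulNr opprK.
    rewrite -(fourier_conj y ki) mulrA -(cintegralZl ((w n y)%:C * fourier k y) measurableT ci).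
    by apply: eq_cintegral => t _; rewrite /f; ring.
  have {}f1 := eq_cintegrable (mu := leb) measurableT (fun t _ => L t) f1.
  have {}f2 := eq_cintegrable (mu := leb) measurableT (fun y _ => Rr y) f2.
  have {}fE := etrans (esym (eq_cintegral leb (fun t _ => L t)))
    (etrans fE (eq_cintegral leb (fun y _ => Rr y))).
  rewrite (cintegral_real leb _ measurableT) (cintegral_real leb _ measurableT) in fE.
  have {}fE := congr1 (@complex.Re R) fE.
  have {}f1 := f1.1; have {}f2 := f2.1.
  split; first exact: f2.
  rewrite -[leLHS]fE.
  rewrite -RintegralZl//; last exact: (integrable_abse ki).
  apply: le_Rintegral => //.
    exact: (integrableZl measurableT (2 * pi * M) (integrable_abse ki)).
  move=> t _; apply: le_trans (ler_norm _) _.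
  rewrite normrM mulrC ler_wpM2r//.
  exact: poisson_integral_bound.
apply/integrableP; split; first exact/measurable_EFinP.
under eq_integral do rewrite gee0_abs ?lee_fin ?exprn_ge0 ?normc_ge0//.
pose g n y := (w n y * normc (fourier k y) ^+ 2)%:E.
have g_ge0 n y : (0 <= g n y)%E by rewrite lee_fin mulr_ge0 ?expR_ge0 ?exprn_ge0 ?normc_ge0.
have mg n : measurable_fun setT (g n) by exact/measurable_EFinP/measurable_funM.
have ndg y : nondecreasing_seq (g ^~ y).
  move=> m n mn; rewrite lee_fin ler_wpM2r ?exprn_ge0 ?normc_ge0// ler_expR lerN2.
  by rewrite ler_wpM2r// lef_pV2 ?posrE// ler_nat ltnS.
have gcvg y : g n y @[n --> \oo] --> (normc (fourier k y) ^+ 2)%:E.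
  apply/cvg_EFin; first exact: nearW.
  rewrite -[X in _ --> X]mul1r; apply: cvgM; last exact: cvg_cst.
  rewrite [X in _ --> X](_ : _ = expR (- (0 * `|y|))); last by rewrite mul0r oppr0 expR0.
  apply: continuous_cvg; first exact: continuous_expR.
  by apply: cvgN; apply: cvgM; [exact: harmonic_cvg0|exact: cvg_cst].
have -> : (\int[leb]_y (normc (fourier k y) ^+ 2)%:E)%E =
    limn (fun n => \int[leb]_y g n y)%E.
  rewrite -(@monotone_convergence _ _ _ leb setT measurableT g)//.
  apply: eq_integral => y _; apply/esym/cvg_lim => //; exact: gcvg.
apply: (@le_lt_trans _ _ (2 * pi * M * \int[leb]_s `|k s|)%:E); last exact: ltry.
apply: lime_le.
  apply: ereal_nondecreasing_is_cvgn => m n mn; apply: ge0_le_integral => //.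
  - exact: mg.
  - exact: mg.
  - by move=> y _; exact: ndg.
apply: nearW => n; have [gi gb] := bound n.
by rewrite -(fineK (integrable_fin_num measurableT gi)) lee_fin.
Qed.

End inversion.

(** * Transforms of damped functions and of convolutions *)

Section convolution.
Context {R : realType}.
Notation leb := (@lebesgue_measure R).

Definition conv (u v : R -> R) (s : R) : R := \int[leb]_x (u (s - x) * v x).

Lemma integrable_conv1 (u v : R -> R) :
  leb.-integrable setT (EFin \o u) -> leb.-integrable setT (EFin \o v) ->
  leb.-integrable setT (EFin \o conv u v).
Proof. by move=> ui vi; exact: (integrable_Rfubini1 (integrable_conv ui vi)). Qed.

Lemma integrable_conv_section (u v : R -> R) (M : R) s :
  measurable_fun setT u -> (forall x, `|u x| <= M) ->
  leb.-integrable setT (EFin \o v) ->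
  leb.-integrable setT (fun x => (u (s - x) * v x)%:E).
Proof.
move=> mu uM vi; have [/measurable_EFinP mv _] := integrableP _ _ _ vi.
apply: (le_integrable measurableT _ _ (integrableZl measurableT M (integrable_abse vi))).
  apply/measurable_EFinP; apply: measurable_funM => //.
  by apply: measurableT_comp mu _; exact: measurable_funB.
move=> x _ /=; rewrite lee_fin normrM [leRHS]normrM normr_id ler_wpM2r//.
by rewrite (le_trans (uM _))// ler_norm.
Qed.

Lemma fourier_conv (u v : R -> R) (M y : R) : (forall x, `|u x| <= M) ->
  leb.-integrable setT (EFin \o u) -> leb.-integrable setT (EFin \o v) ->
  fourier (conv u v) y = fourier u y * fourier v y.
Proof.
move=> uM ui vi.
have [/measurable_EFinP mu _] := integrableP _ _ _ ui.
have [/measurable_EFinP mv _] := integrableP _ _ _ vi.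
pose f (s x : R) : R[i] := cis (- (y * s)) * (u (s - x) * v x)%:C.
have muv : measurable_fun setT (fun z : R * R => u (z.1 - z.2) * v z.2).
  apply: measurable_funM; last exact: measurableT_comp mv measurable_snd.
  by apply: measurableT_comp mu _; exact: measurable_funB.
have mf : cmeasurable setT (fun z : R * R => f z.1 z.2).
  apply: cmeasurableM; last exact: cmeasurable_real.
  apply: cmeasurable_cis; apply: measurableT_comp => //; apply: measurable_funM => //.
have hi := integrable_abse (integrable_conv ui vi).
have fh x z : normc (f x z) <= `|u (x - z) * v z|.
  by rewrite /f normcM normc_cis mul1r normc_real.
have [_ _ fE] := lebesgue_fubini mf hi fh.
have L (s : R) : cintegral leb setT (f s) = cis (- (y * s)) * (conv u v s)%:C.
  have ci : cintegrable leb setT (fun x => (u (s - x) * v x)%:C).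
    split; first exact: (integrable_conv_section s mu uM vi).
    exact: integrable0.
  rewrite -[(conv u v s)%:C](cintegral_real leb (fun x => u (s - x) * v x) measurableT).
  exact: (cintegralZl _ measurableT ci).
have U (x : R) : cintegral leb setT (f^~ x) =
    fourier u y * (cis (- (y * x)) * (v x)%:C).
  have ci := cintegrable_fourier y ui.
  rewrite /fourier -(cintegral_shift x ci) mulrC.
  rewrite -(cintegralZl _ measurableT (cintegrable_shift x ci)).
  apply: eq_cintegral => s _; rewrite /f.
  have -> : - (y * s) = - (y * x) + - (y * (s - x)) by ring.
  by rewrite cisD rcM; ring.
rewrite -(cintegralZl _ measurableT (cintegrable_fourier y vi)).
rewrite -[RHS](eq_cintegral leb (fun x _ => U x)) -fE.
by apply: eq_cintegral => s _; rewrite L.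
Qed.

Definition damp (a : R) (f : R -> R) (t : R) : R :=
  \1_(`]0, +oo[%classic) t * (expR (- (a * t)) * f t).

Lemma dampE a f t : damp a f t = if 0 < t then expR (- (a * t)) * f t else 0.
Proof.
rewrite /damp indicE mem_setE in_itv/= andbT; case: ifP => _.
  by rewrite mul1r.
by rewrite mul0r.
Qed.

Lemma laplace_fourier (f : R -> R) (a y : R) :
  laplace f (a +i* y) = fourier (damp a f) y.
Proof.
rewrite /laplace cintegral_mkcond /fourier; apply: eq_cintegral => t _.
rewrite /damp !rcM mulrCA mulrA.
have -> : - ((a +i* y) * t%:C) = - (a * t) +i* - (y * t).
  by apply: complex_eqP => /=; ring.
by rewrite cexpE; ring.
Qed.

Lemma measurable_damp a f : measurable_fun (`]0, +oo[%classic : set R) f ->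
  measurable_fun setT (damp a f).
Proof.
move=> mf.
rewrite (_ : damp a f = ((fun t => expR (- (a * t)) * f t) \_ `]0, +oo[)); last first.
  apply/funext => t; rewrite patchE /damp indicE; case: ifP => _; first by rewrite mul1r.
  by rewrite mul0r.
apply/(measurable_restrictT _ _).1; first exact: measurable_itv.
apply: measurable_funM => //; apply: measurableT_comp => //.
by apply: measurableT_comp => //; exact: measurable_funM.
Qed.

Lemma fourier_inversion_damp (f : R -> R) (a M t : R) : 0 < t ->
  leb.-integrable setT (EFin \o damp a f) ->
  (forall s, `|damp a f s| <= M) -> {for t, continuous f} ->
  cintegrable leb setT (fourier (damp a f)) ->
  cintegral leb setT (fun y => cis (y * t) * fourier (damp a f) y) =
  (2 * pi * (expR (- (a * t)) * f t))%:C.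
Proof.
move=> t0 fi fM fc ci; rewrite (fourier_inversion fi fM _ ci).
  by rewrite dampE t0.
rewrite /prop_for /continuous_at dampE t0.
apply: (@cvg_trans _ (expR (- (a * s)) * f s @[s --> t])).
  apply: near_eq_cvg; near=> s; rewrite dampE ifT//.
  by near: s; exact: lt_nbhsr.
suff h : {for t, continuous (fun s => expR (- (a * s)) * f s)} by exact: h.
apply: cvgM; last exact: fc.
apply: continuous_comp; last exact: continuous_expR.
by apply: cvgN; apply: cvgM; [exact: cvg_cst|exact: cvg_id].
Unshelve. all: by end_near. Qed.

Lemma integrable_damp1 a : 0 < a -> leb.-integrable setT (EFin \o damp a (cst 1)).
Proof.
move=> a0.
have /(integrable_mkcond (mu := leb) _ (measurable_itv _)) := integrable_expN a0.
apply: eq_integrable => // t _; rewrite patchE /= dampE mem_setE in_itv/= andbT.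
by case: ifP => _ //; rewrite mulr1.
Qed.

Lemma damp1_le1 a t : 0 <= a -> `|damp a (cst 1) t| <= 1.
Proof.
move=> a0; rewrite dampE; case: ifP => [t0|_]; last by rewrite normr0.
rewrite mulr1 ger0_norm ?expR_ge0// -expR0 ler_expR oppr_le0 mulr_ge0//.
exact: ltW.
Qed.

Lemma fourier_damp1 a y : 0 < a -> fourier (damp a (cst 1)) y = (a +i* y)^-1.
Proof.
move=> a0; rewrite -laplace_fourier /laplace.
have [_ <-] := @cintegral_cexp R (a +i* y) a0.
by apply: eq_cintegral => t _; rewrite /= mulr1.
Qed.

Definition expconv (b : R) (m : R -> R) (s : R) : R :=
  \int[leb]_(u in `[0, s]) (expR (- (b * (s - u))) * m u).

Lemma damp_expconv a b m : 0 <= a + b ->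
  leb.-integrable setT (EFin \o damp a m) ->
  measurable_fun (`]0, +oo[%classic : set R) m ->
  damp a (expconv b m) = conv (damp (a + b) (cst 1)) (damp a m).
Proof.
move=> ab0 mi mm; apply/funext => s; rewrite /conv dampE; case: ltP => s0; last first.
  transitivity (\int[leb]_(x in setT) (cst (0 : R) x)).
    by rewrite Rintegral_cst//= mul0r.
  apply: eq_Rintegral => x _; rewrite !dampE; case: (ltP 0 x) => x0.
    by rewrite ltNge (le_trans _ s0) ?mul0r// lerBlDr lerDl ltW.
  by rewrite mulr0.
have mE : measurable_fun setT (damp (a + b) (cst 1)).
  by apply: measurable_damp; exact: measurable_cst.
have ci := integrable_conv_section s mE (fun x => damp1_le1 x ab0) mi.
have -> : expconv b m s = \int[leb]_x (expR (a * s) *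
    (damp (a + b) (cst 1) (s - x) * damp a m x)).
  rewrite /expconv /Rintegral integral_itv_bndoo; last first.
    apply/measurable_EFinP; apply: measurable_funM.
      apply: measurableT_comp => //; apply: measurableT_comp => //.
      by apply: measurable_funM => //; exact: measurable_funB.
    apply: measurable_funS mm => //.
    by move=> x /=; rewrite !in_itv/= => /andP[->].
  congr fine; rewrite [LHS]integral_mkcond; apply: eq_integral => x _.
  rewrite patchE !mem_setE in_itv/= !dampE subr_gt0.
  case: (ltP 0 x) => x0; case: (ltP x s) => xs; rewrite ?mul0r ?mulr0//=.
  rewrite mulr1 [X in _ = (_ * X)%:E]mulrA !mulrA -!expRD; congr (expR _ * _)%:E; ring.
rewrite RintegralZl// mulrA -expRD.
by rewrite addrC subrr expR0 mul1r.
Qed.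

Lemma integrable_damp_expconv a b m : 0 < a + b ->
  leb.-integrable setT (EFin \o damp a m) ->
  measurable_fun (`]0, +oo[%classic : set R) m ->
  leb.-integrable setT (EFin \o damp a (expconv b m)).
Proof.
move=> ab0 mi mm; rewrite damp_expconv ?(ltW ab0)//.
by apply: integrable_conv1 => //; exact: integrable_damp1.
Qed.

Lemma fourier_expconv a b m y : 0 < a + b ->
  leb.-integrable setT (EFin \o damp a m) ->
  measurable_fun (`]0, +oo[%classic : set R) m ->
  fourier (damp a (expconv b m)) y = ((a + b) +i* y)^-1 * fourier (damp a m) y.
Proof.
move=> ab0 mi mm; rewrite damp_expconv ?(ltW ab0)//.
rewrite (fourier_conv _ (fun x => damp1_le1 x (ltW ab0)))//.
  by rewrite fourier_damp1.
exact: integrable_damp1.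
Qed.

Lemma damp_expconv_le a b m s : 0 < a + b ->
  leb.-integrable setT (EFin \o damp a m) ->
  measurable_fun (`]0, +oo[%classic : set R) m ->
  `|damp a (expconv b m) s| <= \int[leb]_u `|damp a m u|.
Proof.
move=> ab0 mi mm; rewrite damp_expconv ?(ltW ab0)// /conv.
have mE : measurable_fun setT (damp (a + b) (cst 1)).
  by apply: measurable_damp; exact: measurable_cst.
have ci := integrable_conv_section s mE (fun x => damp1_le1 x (ltW ab0)) mi.
rewrite (le_trans (le_normr_Rintegral measurableT ci))//.
apply: le_Rintegral => //.
- exact: (integrable_abse ci).
- exact: (integrable_abse mi).
- by move=> x _; rewrite normrM ler_piMl// damp1_le1// ltW.
Qed.

Lemma integrable_normc_resolvent (c : R) : 0 < c ->
  leb.-integrable setT (fun y => ((c ^+ 2 + y ^+ 2)^-1)%:E).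
Proof.
move=> c0; have ci0 : 0 < c^-1 by rewrite invr_gt0.
have H := integrableZl measurableT (2^-1 * c ^- 2) (integrable_affine 0 ci0 (cauchy_kernel (R := R)).1).
apply: eq_integrable H => // y _ /=; rewrite -EFinM; congr EFin.
rewrite addr0; have n0 : c ^+ 2 + y ^+ 2 != 0.
  by rewrite gt_eqF// ltr_pwDl ?sqr_ge0// exprn_gt0.
have cn0 : c != 0 by rewrite gt_eqF.
by field; rewrite n0 cn0.
Qed.

(* Cauchy-Schwarz on the line, via [2 |k^| / |c + iy| <= |k^|^2 + 1 / |c + iy|^2]. *)
Lemma cintegrable_fourier_resolvent (k : R -> R) (M c : R) : 0 < c ->
  leb.-integrable setT (EFin \o k) -> (forall s, `|k s| <= M) ->
  cintegrable leb setT (fun y => (c +i* y)^-1 * fourier k y).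
Proof.
move=> c0 ki kM; have L2 := fourier_L2 ki kM.
have n0 (y : R) : c ^+ 2 + y ^+ 2 != 0.
  by rewrite gt_eqF// ltr_pwDl ?sqr_ge0// exprn_gt0.
have mr : cmeasurable setT (fun y : R => (c +i* y)^-1).
  rewrite (_ : (fun y => _) = fourier (damp c (cst 1))); last first.
    by apply/funext => y; rewrite fourier_damp1.
  exact: cmeasurable_fourier (integrable_damp1 c0).
apply: (cintegrable_le (mu := leb)
  (h := fun y => (c ^+ 2 + y ^+ 2)^-1 + normc (fourier k y) ^+ 2)) => //.
- apply: cmeasurableM => //; exact: cmeasurable_fourier.
- exact: (integrableD measurableT (integrable_normc_resolvent c0) L2).
- move=> y _; rewrite normcM.
  have -> : (c ^+ 2 + y ^+ 2)^-1 = normc (c +i* y)^-1 ^+ 2.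
    by rewrite normcV exprVn normc_sqr.
  set p := normc _; set q := normc _.
  have := sqr_ge0 (p - q); have := sqr_ge0 p; have := sqr_ge0 q; nra.
Qed.

End convolution.

Lemma integral_bigcup_le {R : realType} {d} {T : measurableType d}
    (mu : {measure set T -> \bar R}) (F : nat -> set T) (f : T -> R) (C : R) :
  nondecreasing_seq F -> (forall n, measurable (F n)) ->
  measurable_fun (\bigcup_n F n) f -> (forall x, (\bigcup_n F n) x -> 0 <= f x) ->
  (forall n, (\int[mu]_(x in F n) (f x)%:E <= C%:E)%E) ->
  mu.-integrable (\bigcup_n F n) (EFin \o f) /\
  \int[mu]_(x in \bigcup_n F n) f x <= C.
Proof.
move=> ndF mF mf f0 fC.
have mU : measurable (\bigcup_n F n) by exact: bigcup_measurable.
have H : (\int[mu]_(x in \bigcup_n F n) (f x)%:E <= C%:E)%E.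
  have cv := @ge0_nondecreasing_set_cvg_integral _ _ _ F (EFin \o f) mu ndF mF.
  have {}cv := cv (fun i => measurable_funS mU (bigcup_sup I) ((measurable_EFinP _ _).2 mf)).
  have {}cv := cv (fun i x Fx => f0 x (ex_intro2 _ _ i I Fx)).
  rewrite -(cvg_lim _ cv)//; apply: lime_le; first exact: cvgP cv.
  exact: nearW.
have fi : mu.-integrable (\bigcup_n F n) (EFin \o f).
  apply/integrableP; split; first exact/measurable_EFinP.
  apply: le_lt_trans (ltry C); apply: le_trans H.
  rewrite le_eqVlt; apply/orP; left; apply/eqP; apply: eq_integral => x /set_mem Fx.
  by rewrite gee0_abs// lee_fin f0.
split=> //; rewrite -lee_fin /Rintegral fineK//; exact: integrable_fin_num.
Qed.

Section power_integrals.
Context {R : realType}.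
Notation leb := (@lebesgue_measure R).

Lemma continuous_powR (a x : R) : 0 < x -> {for x, continuous (fun t : R => t `^ a)}.
Proof.
move=> x0; apply: differentiable_continuous; apply/derivable1_diffP.
by apply: derivable_powR; rewrite in_itv/= x0.
Qed.

Lemma integral_powR (al a b : R) : al != 0 -> 0 < a -> a <= b ->
  (\int[leb]_(x in `[a, b]) (x `^ (al - 1))%:E = ((b `^ al - a `^ al) / al)%:E)%E.
Proof.
move=> al0 a0; rewrite le_eqVlt => /predU1P[<-|ab].
  by rewrite set_itv1 integral_set1 subrr mul0r.
have der (x : R) : 0 < x -> is_derive x (1 : R) (fun t : R => al^-1 * t `^ al) (x `^ (al - 1)).
  move=> x0; have H := is_derive1_powR al x0.
  have := is_deriveZ al^-1 H; rewrite /GRing.scale/= mulrA mulVf// mul1r.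
  exact.
have ct (x : R) : 0 < x -> {for x, continuous (fun t : R => al^-1 * t `^ al)}.
  by move=> x0; apply: cvgM; [exact: cvg_cst|exact: continuous_powR].
rewrite (@continuous_FTC2 _ _ (fun t : R => al^-1 * t `^ al))//.
- by rewrite -EFinD mulrC -[X in _ - X]mulrC; congr EFin; ring.
- apply: continuous_in_subspaceT => x /set_mem; rewrite /= in_itv/= => /andP[ax _].
  by apply: continuous_powR; exact: lt_le_trans ax.
- split.
  + move=> x; rewrite in_itv/= => /andP[ax _].
    by case: (der x (lt_trans a0 ax)).
  + by apply: cvg_at_right_filter; exact: ct.
  + by apply: cvg_at_left_filter; exact: ct (lt_trans a0 ab).
- move=> x; rewrite in_itv/= => /andP[ax _]; rewrite derive1E.
  by case: (der x (lt_trans a0 ax)).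
Qed.

Lemma integral_powR_0 (al b : R) : 0 < al -> 0 < b ->
  leb.-integrable `]0, b] (fun x => (x `^ (al - 1))%:E) /\
  \int[leb]_(x in `]0, b]) (x `^ (al - 1)) <= b `^ al / al.
Proof.
move=> al0 b0.
have UE : `]0, b]%classic = \bigcup_n (`[b / n.+1%:R, b]%classic : set R).
  apply/seteqP; split => x /=; rewrite in_itv/=.
    move=> /andP[x0 xb]; exists (Num.trunc (b / x)) => //=; rewrite in_itv/= xb andbT.
    rewrite ler_pdivrMr ?ltr0n// mulrC -ler_pdivrMr//.
    by rewrite ltW// truncnS_gt.
  move=> [n _]; rewrite /= in_itv/= => /andP[+ ->]; rewrite andbT.
  by apply: lt_le_trans; rewrite divr_gt0.
rewrite UE; apply: integral_bigcup_le.
- move=> m n mn; apply/subsetPset => x /=; rewrite !in_itv/= => /andP[+ ->].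
  rewrite andbT; apply: le_trans.
  by rewrite ler_wpM2l ?(ltW b0)// lef_pV2 ?posrE// ler_nat.
- by move=> n; exact: measurable_itv.
- by apply: measurable_funTS; exact: measurable_powR.
- by move=> x _; exact: powR_ge0.
- move=> n; rewrite integral_powR ?gt_eqF ?divr_gt0//; last first.
    by rewrite ler_pdivrMr ?ltr0n// ler_peMr ?(ltW b0)// ler1n.
  by rewrite lee_fin ler_wpM2r ?invr_ge0 ?(ltW al0)// gerBl powR_ge0.
Qed.

Lemma integrable_powR_1y (al : R) : al < 0 ->
  leb.-integrable `[1, +oo[ (fun x => (x `^ (al - 1))%:E).
Proof.
move=> al0.
have UE : `[1, +oo[%classic = \bigcup_n (`[1, n.+1%:R]%classic : set R).
  apply/seteqP; split => x /=; rewrite in_itv/=.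
    rewrite andbT => x0; exists (Num.trunc x) => //=; rewrite in_itv/= x0/=.
    by rewrite ltW// truncnS_gt.
  by move=> [n _]; rewrite /= !in_itv/= => /andP[->].
rewrite UE; apply: (integral_bigcup_le (C := - al^-1) _ _ _ _ _).1.
- move=> m n mn; apply/subsetPset => x /=; rewrite !in_itv/= => /andP[->]/=.
  by move=> /le_trans; apply; rewrite ler_nat.
- by move=> n; exact: measurable_itv.
- by apply: measurable_funTS; exact: measurable_powR.
- by move=> x _; exact: powR_ge0.
- move=> n; rewrite integral_powR ?lt_eqF// ?ler1n//.
  rewrite lee_fin (_ : - al^-1 = -1 / al); last by rewrite mulN1r.
  rewrite ler_wnM2r ?invr_le0 ?(ltW al0)//.
  by rewrite powR1 lerBrDr addNr powR_ge0.
Qed.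

End power_integrals.

Section decay.
Context {R : realType}.
Notation leb := (@lebesgue_measure R).

(* Translating by [h] flips the sign of [c], so that [2 \int c k] is
   [\int c(s) (k(s) - k(s - h))]; for a decreasing [k] the total mass of
   [k - k(. - h)] is twice that of [k] on [0, h]. *)
Lemma antiperiodic_integral_le (k c : R -> R) (h : R) : 0 < h ->
  leb.-integrable setT (EFin \o k) ->
  (forall x, x <= 0 -> k x = 0) -> (forall x, 0 <= k x) ->
  (forall x y, 0 < x -> x <= y -> k y <= k x) ->
  measurable_fun setT c -> (forall s, `|c s| <= 1) ->
  (forall s, c (s + h) = - c s) ->
  `|\int[leb]_s (c s * k s)| <= \int[leb]_(s in `]0, h]) k s.
Proof.
move=> h0 ki k0 kge0 kdec mc c1 ch.
have /integrableP[/measurable_EFinP mk _] := ki.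
have cki : leb.-integrable setT (fun s => (c s * k s)%:E).
  apply: (le_integrable measurableT _ _ ki); first exact/measurable_EFinP/measurable_funM.
  by move=> x _ /=; rewrite lee_fin normrM ler_piMl.
have ksi := integrable_shift h ki.
have ckhi := integrable_shift h cki.
have cE s : c (s - h) = - c s by rewrite -[in RHS](subrK h s) ch opprK.
have E1 : 2 * \int[leb]_s (c s * k s) = \int[leb]_s (c s * (k s - k (s - h))).
  rewrite mulr_natl mulr2n -[X in _ + X](Rintegral_shift h cki) -RintegralD//.
  by apply: eq_Rintegral => s _; rewrite cE; ring.
have Di := integrableB measurableT ki ksi.
have E2 : leb.-integrable setT (fun s => (`|k s - k (s - h)|)%:E) := integrable_abse Di.
have kI0 : leb.-integrable setT (fun s => (\1_(`]0, h]%classic) s * k s)%:E).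
  apply: (le_integrable measurableT _ _ ki).
    by apply/measurable_EFinP/measurable_funM => //; exact: measurable_indic.
  move=> x _ /=; rewrite lee_fin normrM ler_piMl// indicE.
  by case: (_ \in _); rewrite ?normr1 ?normr0.
have kIi : leb.-integrable setT (fun s => (2 * (\1_(`]0, h]%classic) s * k s))%:E).
  exact: (integrableZl measurableT 2 kI0).
have E3 : \int[leb]_s `|k s - k (s - h)| = 2 * \int[leb]_(s in `]0, h]) k s.
  transitivity (\int[leb]_s (2 * (\1_(`]0, h]%classic) s * k s) + (k (s - h) - k s))).
    apply: eq_Rintegral => s _; rewrite indicE mem_setE in_itv/=.
    case: ltP => s0 /=.
      case: leP => sh /=.
        by rewrite (k0 (s - h)) ?subr_le0// subr0 ger0_norm//; ring.
      rewrite mul0r mulr0 add0r ler0_norm ?opprB// subr_le0; apply: kdec.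
        by rewrite subr_gt0.
      by rewrite gerBl ltW.
    rewrite (k0 _ s0) (k0 (s - h)) ?subrr ?normr0; first by ring.
    by rewrite (le_trans _ s0)// gerBl ltW.
  rewrite RintegralD//; last exact: (integrableB measurableT ksi ki).
  rewrite RintegralB// (Rintegral_shift h ki) subrr addr0.
  rewrite RintegralZl//.
  congr (2 * _); rewrite [RHS]Rintegral_mkcond; apply: eq_Rintegral => s _.
  by rewrite patchE indicE; case: ifP => _; rewrite ?mul1r ?mul0r.
have two : 0 < (2 : R) by [].
rewrite -(ler_pM2l two) -{1}[2]gtr0_norm// -normrM E1 -E3.
have ii : leb.-integrable setT (fun s => (c s * (k s - k (s - h)))%:E).
  apply: (le_integrable measurableT _ _ E2).
    have /integrableP[/measurable_EFinP mks _] := ksi.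
    by apply/measurable_EFinP/measurable_funM => //; exact: measurable_funB.
  by move=> x _ /=; rewrite lee_fin normr_id normrM ler_piMl.
rewrite (le_trans (le_normr_Rintegral measurableT ii))//.
apply: le_Rintegral => //; first exact: (integrable_abse ii).
by move=> s _; rewrite normrM ler_piMl.
Qed.

Definition gker (al b u : R) : R := expR (- (b * u)) * u `^ (al - 1).

Lemma measurable_gker (D : set R) al b : measurable_fun D (gker al b).
Proof.
apply: measurable_funTS; apply: measurable_funM; last exact: measurable_powR.
by apply: measurableT_comp => //; apply: measurableT_comp => //; exact: measurable_funM.
Qed.

Section kernel.
Variables (al a b : R).
Hypotheses (al0 : 0 < al) (al1 : al < 1) (ab0 : 0 < a + b).
Notation k := (damp a (gker al b)).

Lemma damp_gkerE x : k x = if 0 < x then expR (- ((a + b) * x)) * x `^ (al - 1) else 0.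
Proof.
rewrite dampE; case: ifP => // _; rewrite /gker mulrA -expRD; congr (expR _ * _); ring.
Qed.

Lemma damp_gker_ge0 x : 0 <= k x.
Proof. by rewrite damp_gkerE; case: ifP => // _; rewrite mulr_ge0 ?expR_ge0 ?powR_ge0. Qed.

Lemma damp_gker_dec x y : 0 < x -> x <= y -> k y <= k x.
Proof.
move=> x0 xy; have y0 := lt_le_trans x0 xy.
rewrite !damp_gkerE x0 y0 ler_pM ?expR_ge0 ?powR_ge0//.
  by rewrite ler_expR lerN2 ler_wpM2l// ltW.
rewrite -[al - 1]opprB !powRN lef_pV2 ?posrE ?powR_gt0//.
by rewrite ge0_ler_powR// ?nnegrE ?subr_ge0 ?(ltW al1)// ltW.
Qed.

Lemma damp_gker_le x : 0 < x -> k x <= x `^ (al - 1).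
Proof.
move=> x0; rewrite damp_gkerE x0 ler_piMl ?powR_ge0//.
by rewrite -expR0 ler_expR oppr_le0 mulr_ge0// ltW.
Qed.

Lemma integrable_damp_gker : leb.-integrable setT (EFin \o k).
Proof.
have [/(integrable_mkcond (mu := leb) _ (measurable_itv _)) i1 _] := integral_powR_0 al0 ltr01.
have i2 := integrable_damp1 ab0.
have mk : measurable_fun setT k by apply: measurable_damp; exact: measurable_gker.
apply: (le_integrable measurableT _ _ (integrableD measurableT i1 i2)).
  exact/measurable_EFinP.
move=> x _; rewrite /= patchE mem_setE in_itv/= [damp _ (cst 1) _]dampE.
have [x0|x0] := ltP 0 x; last first.
  by rewrite damp_gkerE ltNge x0 /= normr0 lee_fin.
case: (leP x 1) => x1 /=.
  rewrite lee_fin ger0_norm ?damp_gker_ge0// (le_trans (damp_gker_le x0))// (le_trans _ (ler_norm _))//.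
  by rewrite lerDl mulr1 expR_ge0.
rewrite add0r lee_fin mulr1 damp_gkerE x0 normrM [X in X * _]ger0_norm ?expR_ge0//.
rewrite [leRHS]ger0_norm ?expR_ge0// ler_piMr ?expR_ge0// ger0_norm ?powR_ge0//.
have := ler_powR (ltW x1) (_ : al - 1 <= 0); rewrite powRr0; apply.
by rewrite subr_le0 ltW.
Qed.

Lemma integral_damp_gker_le h : 0 < h -> \int[leb]_(s in `]0, h]) k s <= h `^ al / al.
Proof.
move=> h0; have [i1 v1] := integral_powR_0 al0 h0.
apply: le_trans v1; apply: le_Rintegral => //.
  by apply: integrableS integrable_damp_gker.
by move=> x; rewrite /= in_itv/= => /andP[x0 _]; exact: damp_gker_le.
Qed.

Lemma normc_fourier_gker y : y != 0 ->
  normc (fourier k y) <= 2 * pi `^ al / al * `|y| `^ (- al).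
Proof.
move=> y0; have ny0 : 0 < `|y| by rewrite normr_gt0.
have h0 : 0 < pi / `|y| by rewrite divr_gt0// pi_gt0.
have k0 x : x <= 0 -> k x = 0 by move=> x0; rewrite damp_gkerE ltNge x0.
have B (c : R -> R) : measurable_fun setT c -> (forall s, `|c s| <= 1) ->
    (forall s, c (s + pi / `|y|) = - c s) ->
    `|\int[leb]_s (c s * k s)| <= pi `^ al / al * `|y| `^ (- al).
  move=> mc c1 ch.
  apply: le_trans (antiperiodic_integral_le h0 integrable_damp_gker k0
     damp_gker_ge0 damp_gker_dec mc c1 ch) _.
  apply: le_trans (integral_damp_gker_le h0) _.
  rewrite powRM ?pi_ge0 ?invr_ge0// mulrAC.
  by rewrite -[`|y|^-1]powR_inv1// -powRrM mulN1r.
have sgy : y = Num.sg y * `|y| by exact: numEsg.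
have yh s : - (y * (s + pi / `|y|)) = - (y * s) + - (Num.sg y * pi).
  rewrite mulrDr opprD; congr (_ - _).
  by rewrite mulrA mulrAC {1}sgy mulfK// gt_eqF.
have [cpi spi] : cos (- (Num.sg y * pi)) = -1 /\ sin (- (Num.sg y * pi)) = 0.
  rewrite cosN sinN; have [s0|s0|s0] := sgrP y.
  - by move: y0; rewrite s0 eqxx.
  - by rewrite mul1r cospi sinpi oppr0.
  - by rewrite mulN1r cosN sinN cospi sinpi !oppr0.
have [mcos msin] : cmeasurable setT (fun s : R => cis (- (y * s))).
  by apply: cmeasurable_cis; apply: measurableT_comp => //; exact: measurable_funM.
apply: le_trans (normc_le_ReIm _) _.
rewrite (_ : _ * `|y| `^ _ =
  pi `^ al / al * `|y| `^ (- al) + pi `^ al / al * `|y| `^ (- al)); last by ring.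
rewrite lerD//.
  rewrite /fourier/=; under eq_Rintegral do rewrite mulr0 subr0.
  apply: B => // s; first by rewrite ler_norml cos_geN1 cos_le1.
  rewrite yh cosD cpi spi; ring.
rewrite /fourier/=; under eq_Rintegral do rewrite mulr0 add0r.
apply: B => // s; first by rewrite ler_norml sin_geN1 sin_le1.
rewrite yh sinD cpi spi; ring.
Qed.

End kernel.

Lemma cintegrable_resolvent_fourier_gker (al a b c : R) :
  0 < al -> al < 1 -> 0 < a + b -> 0 < c ->
  cintegrable leb setT (fun y => (c +i* y)^-1 * fourier (damp a (gker al b)) y).
Proof.
move=> al0 al1 ab0 c0.
have ki := integrable_damp_gker al0 al1 ab0.
pose C0 := c^-1 * (2 * \int[leb]_s `|damp a (gker al b) s|).
pose C1 := 2 * pi `^ al / al.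
have al0' : - al < 0 by rewrite oppr_lt0.
have /(integrable_mkcond (mu := leb) _ (measurable_itv _)) p1 := integrable_powR_1y al0'.
pose P (x : R) : R := \1_(`[1, +oo[%classic) x * x `^ (- al - 1).
have Pi : leb.-integrable setT (EFin \o P).
  move: p1; apply: eq_integrable => // x _; rewrite patchE /P /= indicE.
  by case: ifP => _; rewrite ?mul1r ?mul0r.
have Ii : leb.-integrable setT (fun x : R => (C0 * \1_(`[-1, 1]%classic) x)%:E).
  exact: (integrableZl measurableT C0 (integrable_indic_itv (-1) 1 true false)).
have Hi := integrableD measurableT Ii
  (integrableZl measurableT C1 (integrableD measurableT Pi (integrable_reflect Pi))).
have mr : cmeasurable setT (fun y : R => (c +i* y)^-1).
  rewrite (_ : (fun y => _) = fourier (damp c (cst 1))); last first.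
    by apply/funext => y; rewrite fourier_damp1.
  exact: cmeasurable_fourier (integrable_damp1 c0).
have P0 x : 0 <= P x by rewrite /P mulr_ge0 ?powR_ge0// indicE; case: (_ \in _).
have C00 : 0 <= C0 by rewrite mulr_ge0 ?invr_ge0 ?(ltW c0)// mulr_ge0// Rintegral_ge0.
have C10 : 0 <= C1 by rewrite divr_ge0 ?(ltW al0)// mulr_ge0 ?powR_ge0.
apply: (cintegrable_le (mu := leb) measurableT _ Hi).
  apply: cmeasurableM => //; exact: cmeasurable_fourier.
move=> y _; rewrite normcM normcV.
have [y1|y1] := leP `|y| 1.
  rewrite (le_trans (y := C0))//.
    rewrite ler_pM ?invr_ge0 ?normc_ge0//.
      rewrite lef_pV2 ?posrE//; last first.
        by apply: lt_le_trans (le_Re_normc _); rewrite /= gtr0_norm.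
      by apply: le_trans (le_Re_normc _); rewrite /= ler_norm.
    exact: normc_fourier_le.
  rewrite indicE mem_setE in_itv/= -ler_norml y1 mulr1 lerDl.
  by rewrite mulr_ge0// addr_ge0.
have y0 : y != 0 by rewrite -normr_gt0 (lt_trans _ y1).
have ny0 : 0 < `|y| by rewrite normr_gt0.
rewrite (le_trans (y := `|y|^-1 * (C1 * `|y| `^ (- al))))//.
  rewrite ler_pM ?invr_ge0 ?normc_ge0//; last exact: normc_fourier_gker.
  rewrite lef_pV2 ?posrE//; first exact: (le_Im_normc (c +i* y)).
  exact: lt_le_trans (le_Im_normc (c +i* y)).
have -> : `|y|^-1 * (C1 * `|y| `^ (- al)) = C1 * `|y| `^ (- al - 1).
  rewrite powRB; last by apply/implyP => _; rewrite gt_eqF.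
  by rewrite powRr1// mulrCA [`|y|^-1 * _]mulrC.
have -> : `|y| `^ (- al - 1) = P y + P (- y).
  rewrite /P !indicE !mem_setE !in_itv/= !andbT.
  move: y1; case: (ltP 0 y) => s0.
    rewrite gtr0_norm// => y1; rewrite (ltW y1) mul1r.
    by rewrite [1 <= - y]leNgt (lt_trans _ ltr01) ?oppr_lt0//= mul0r addr0.
  rewrite ler0_norm// => y1; rewrite (ltW y1) mul1r.
  by rewrite leNgt (le_lt_trans s0 ltr01)//= mul0r add0r.
by rewrite lerDr mulr_ge0// indicE; case: (_ \in _).
Qed.

End decay.

(** * The variance of the fractional Ornstein-Uhlenbeck process *)

Section kernel_integral.
Context {R : realType}.
Notation leb := (@lebesgue_measure R).
Variables (al b c : R).
Hypotheses (al0 : 0 < al) (al1 : al < 1).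

Let j (u : R) : R := expR ((b - c) * u) * u `^ (al - 1).

Let powR00 : (0 : R) `^ (al - 1) = 0.
Proof. by rewrite powR0// subr_eq0 lt_eqF. Qed.

Let measurable_j (D : set R) : measurable_fun D j.
Proof.
apply: measurable_funTS; apply: measurable_funM; last exact: measurable_powR.
by apply: measurableT_comp => //; exact: measurable_funM.
Qed.

Lemma integrable_exp_powR (T : R) : 0 < T -> leb.-integrable `[0, T] (EFin \o j).
Proof.
move=> T0.
have [/(integrable_mkcond (mu := leb) _ (measurable_itv _)) i1 _] := integral_powR_0 al0 T0.
apply/(integrable_mkcond (mu := leb) _ (measurable_itv _)).
have i2 := integrableZl measurableT (expR (`|b - c| * T)) i1.
apply: (le_integrable measurableT _ _ i2).
  apply/(measurable_restrictT _ (measurable_itv _)).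
  exact/measurable_EFinP.
move=> x _; rewrite !patchE !mem_setE !in_itv/=.
case: (ltgtP 0 x) => [x0|x0|<-] /=.
- case: (leP x T) => xT /=; last by rewrite normr0 lee_fin.
  rewrite lee_fin /j normrM [leRHS]normrM ler_wpM2r// [leLHS](ger0_norm (expR_ge0 _)) [leRHS](ger0_norm (expR_ge0 _)) ler_expR.
  rewrite (le_trans (ler_norm _))// normrM (gtr0_norm x0).
  by rewrite ler_wpM2l.
- by rewrite normr0 lee_fin.
- by rewrite (ltW T0)/= /j powR00 mulr0 normr0 lee_fin.
Qed.

Lemma expconv_gkerE s : 0 < s ->
  expconv b (gker al c) s = expR (- (b * s)) * \int[leb]_(u in `[0, s]) j u.
Proof.
move=> s0; rewrite /expconv -(RintegralZl (mu := leb) _ (measurable_itv _) (integrable_exp_powR s0)).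
apply: eq_Rintegral => u _; rewrite /gker /j !mulrA -!expRD; congr (expR _ * _); ring.
Qed.

Let cvgj u : 0 < u -> {for u, continuous j}.
Proof.
move=> u0; apply: cvgM; last exact: continuous_powR.
apply: continuous_comp; last exact: continuous_expR.
by apply: cvgM; [exact: cvg_cst|exact: cvg_id].
Qed.

Lemma continuous_expconv_gker s : 0 < s -> {for s, continuous (expconv b (gker al c))}.
Proof.
move=> s0.
pose F (x : R) := expR (- (b * x)) * \int[leb]_(u in `[0, x]) j u.
have FE : {near nbhs s, F =1 expconv b (gker al c)}.
  by near=> x; rewrite /F -expconv_gkerE//; near: x; exact: lt_nbhsr.
rewrite /prop_for /continuous_at -(nbhs_singleton FE).
apply: cvg_trans; first exact: (near_eq_cvg FE).
apply: cvgM.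
  apply: continuous_comp; last exact: continuous_expR.
  by apply: cvgN; apply: cvgM; [exact: cvg_cst|exact: cvg_id].
have s1 : s < s + 1 by rewrite ltrDl.
have [df _] := @continuous_FTC1_closed _ j 0 s (s + 1) s1
  (integrable_exp_powR (lt_trans s0 s1)) s0 (cvgj s0).
by apply: differentiable_continuous; exact/derivable1_diffP.
Unshelve. all: by end_near. Qed.

Hypothesis bc : c <= b.

Lemma expconv_gker_ge s : 0 < s -> expR (- (b * s)) * s `^ al <= expconv b (gker al c) s.
Proof.
move=> s0; rewrite expconv_gkerE// ler_wpM2l ?expR_ge0//.
have -> : s `^ al = s * s `^ (al - 1) by rewrite mulr_powRB1// ltW.
rewrite -(Rintegral_itv_obnd_cbnd (b := BRight s)); last first.
  by apply: integrableS (integrable_exp_powR s0) => //; apply: subset_itvr; rewrite bnd_simp.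
have -> : s * s `^ (al - 1) = \int[leb]_(u in `]0, s]) (cst (s `^ (al - 1)) u).
  rewrite Rintegral_cst//= lebesgue_measure_itv/= lte_fin s0 -EFinB/= subr0.
  by rewrite mulrC.
apply: le_Rintegral => //.
- apply/measurable_bounded_integrable => //.
    have H : leb `]0, s]%classic = s%:E.
      by rewrite lebesgue_measure_itv/= lte_fin s0 -EFinB subr0.
    by have := ltry s; rewrite -H.
  by apply: filterS (nbhs_pinfty_ge (num_real `|s `^ (al - 1)|)) => M HM x _.
- by apply: integrableS (integrable_exp_powR s0) => //; apply: subset_itvr; rewrite bnd_simp.
- move=> u; rewrite /= in_itv/= => /andP[u0 us]; rewrite /j -[leLHS]mul1r.
  rewrite ler_pM ?powR_ge0//.
    by rewrite -expR0 ler_expR mulr_ge0 ?subr_ge0// ltW.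
  rewrite -[al - 1]opprB !powRN lef_pV2 ?posrE ?powR_gt0//.
  by rewrite ge0_ler_powR// ?nnegrE ?subr_ge0 ?(ltW al1)// ltW.
Qed.

End kernel_integral.

Lemma Rintegral_eq0 {R : realType} {d} {T : measurableType d}
    (mu : {measure set T -> \bar R}) (D : set T) (f : T -> R) :
  (forall x, D x -> f x = 0) -> \int[mu]_(x in D) f x = 0.
Proof. by move=> f0; rewrite /Rintegral integral0_eq// => x Dx; rewrite f0. Qed.

Section variance_integral.
Context {R : realType}.
Notation leb := (@lebesgue_measure R).

Lemma Rintegral_reverse (s : R) (f : R -> R) : leb.-integrable setT (EFin \o f) ->
  \int[leb]_u f (s - u) = \int[leb]_u f u.
Proof.
move=> fi; rewrite [RHS](Rintegral_reflect fi).
rewrite -(Rintegral_shift s (integrable_reflect fi)).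
by apply: eq_Rintegral => u _; rewrite opprB.
Qed.

Variables (al T : R).
Hypotheses (al0 : 0 < al) (al1 : al < 1) (T0 : 0 < T).

Let I1 (x : R) : R := \1_(`[0, T]%classic) x.
Let D (z : R * R) : R :=
  I1 z.1 * (I1 z.2 * (expR (- z.1 - z.2) * `|z.2 - z.1| `^ (al - 1))).
Let D1 (z : R * R) : R := if z.2 < z.1 then D z else 0.

Let powR00 : (0 : R) `^ (al - 1) = 0.
Proof. by rewrite powR0// subr_eq0 lt_eqF. Qed.

Let I1E x : I1 x = if 0 <= x <= T then 1 else 0.
Proof. by rewrite /I1 indicE mem_setE in_itv/=; case: ifP. Qed.

Let mI1 : measurable_fun setT I1.
Proof. exact: measurable_indic. Qed.

Let mD : measurable_fun setT D.
Proof.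
apply: measurable_funM; first exact: measurableT_comp mI1 measurable_fst.
apply: measurable_funM; first exact: measurableT_comp mI1 measurable_snd.
apply: measurable_funM.
  apply: measurableT_comp => //; apply: measurable_funB => //.
  exact: measurableT_comp.
apply: (@measurableT_comp _ _ _ _ _ _ (fun t : R => t `^ (al - 1))).
  exact: measurable_powR.
by apply: measurableT_comp => //; exact: measurable_funB.
Qed.

Let integrable_D : (leb \x leb)%E.-integrable setT (EFin \o D).
Proof.
have [/(integrable_mkcond (mu := leb) _ (measurable_itv _)) i1 _] := integral_powR_0 al0 T0.
pose w0 (r : R) : R := \1_(`]0, T]%classic) r * r `^ (al - 1).
have wi : leb.-integrable setT (EFin \o w0).
  move: i1; apply: eq_integrable => // x _; rewrite patchE /w0 /= indicE.
  by case: ifP => _; rewrite ?mul1r ?mul0r.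
have ww := integrableD measurableT wi (integrable_reflect wi).
have vi : leb.-integrable setT (EFin \o I1) := integrable_indic_itv 0 T true false.
have H := integrable_conv (u := fun r => w0 r + w0 (- r)) ww vi.
have w00 r : 0 <= w0 r by rewrite /w0 mulr_ge0 ?powR_ge0// indicE; case: (_ \in _).
have w0E r : w0 r = if 0 < r <= T then r `^ (al - 1) else 0.
  by rewrite /w0 indicE mem_setE in_itv/=; case: ifP => _; rewrite ?mul1r ?mul0r.
apply: (le_integrable measurableT _ _ H); first exact/measurable_EFinP.
move=> [s u] _ /=; rewrite lee_fin /D /= [X in _ <= `|_ * X|]I1E !I1E.
case: ifP => [/andP[s0 sT]|_]; last by rewrite mul0r normr0.
case: ifP => [/andP[u0 uT]|_]; last by rewrite mul0r !mulr0 normr0.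
rewrite !mul1r mulr1 [leLHS]ger0_norm ?mulr_ge0 ?expR_ge0 ?powR_ge0// [leRHS]ger0_norm ?addr_ge0//.
apply: (@le_trans _ _ (`|u - s| `^ (al - 1))).
  by rewrite ler_piMl ?powR_ge0// -expR0 ler_expR -opprD oppr_le0 addr_ge0.
rewrite !w0E opprB; case: (ltgtP u s) => [us|su|->].
- rewrite ltr0_norm ?subr_lt0// opprB subr_gt0 us/= lerBlDr (le_trans sT) ?lerDl//.
  by case: ifP => _ //; exact: powR_ge0.
- have us' : u - s <= T by rewrite lerBlDr (le_trans uT)// lerDl.
  rewrite gtr0_norm ?subr_gt0// su us'/=.
  by rewrite ?lerDr; case: ifP => _ //; exact: powR_ge0.
- by rewrite subrr normr0 powR00 ltxx add0r.
Qed.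

Let D_sym s u : D (s, u) = D (u, s).
Proof. by rewrite /D /= distrC [- s - u]addrC; ring. Qed.

Let mD1 : measurable_fun setT D1.
Proof.
apply: measurable_fun_ifT => //.
by apply: measurable_fun_ltr; [exact: measurable_snd|exact: measurable_fst].
Qed.

Let integrable_D1 : (leb \x leb)%E.-integrable setT (EFin \o D1).
Proof.
apply: (le_integrable measurableT _ _ integrable_D); first exact/measurable_EFinP.
by move=> z _ /=; rewrite lee_fin /D1; case: ifP => _ //; rewrite normr0.
Qed.

Let D_split s u : D (s, u) = D1 (s, u) + D1 (u, s).
Proof.
rewrite /D1 /=; case: (ltgtP u s) => [us|su|->]; rewrite ?addr0 ?add0r//.
by rewrite /D /= subrr normr0 powR00; ring.
Qed.

Let D1_section s : \int[leb]_u D1 (s, u) = I1 s * expconv 2 (gker al 1) s.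
Proof.
rewrite I1E; case: ifP => [/andP[s0 sT]|sN]; last first.
  by rewrite mul0r Rintegral_eq0// => u _; rewrite /D1/D/= I1E sN mul0r; case: ifP.
have [s0'|s0'] := ltP 0 s; last first.
  have -> : s = 0 by apply/eqP; rewrite eq_le s0 s0'.
  rewrite mul1r /expconv set_itv1 Rintegral_set1.
  rewrite Rintegral_eq0// => u _; rewrite /D1/D/= [I1 u]I1E.
  by case: (leP 0 u) => u0 //=; rewrite mul0r mulr0.
have := integrable_exp_powR 2 1 al0 al1 s0'.
move=> /(integrable_mkcond (mu := leb) _ (measurable_itv _)) ji.
pose f (r : R) : R := \1_(`[0, s]%classic) r * (expR (- (2 * (s - r))) * gker al 1 r).
have fE r : f r = if 0 <= r <= s then expR (- (2 * (s - r))) * gker al 1 r else 0.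
  by rewrite /f indicE mem_setE in_itv/=; case: ifP => _; rewrite ?mul1r ?mul0r.
have fi : leb.-integrable setT (EFin \o f).
  have := integrableZl measurableT (expR (- (2 * s))) ji.
  apply: eq_integrable => // r _; rewrite patchE mem_setE in_itv/= fE.
  case: ifP => _; last exact: mule0.
  rewrite -EFinM /gker !mulrA -!expRD; congr (expR _ * _)%:E; ring.
rewrite mul1r /expconv [RHS]Rintegral_mkcond.
transitivity (\int[leb]_u f u).
  rewrite -(Rintegral_reverse s fi); apply: eq_Rintegral => u _.
  rewrite fE /D1 /D/= subr_ge0 lerBlDr lerDl !I1E s0 sT/= mul1r.
  case: (ltgtP u s) => [us|us|->]/=.
  - rewrite (le_trans (ltW us) sT) andbT; case: (leP 0 u) => u0; last by rewrite mul0r.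
    rewrite mul1r /gker mulrA -expRD distrC gtr0_norm ?subr_gt0//.
    by congr (expR _ * _); ring.
  - by [].
  - by rewrite subrr /gker powR00 !mulr0; case: ifP.
by apply: eq_Rintegral => r _; rewrite patchE fE mem_setE in_itv/=.
Qed.

Lemma double_integral_kernel :
  \int[leb]_(s in `[0, T]) \int[leb]_(u in `[0, T]) (expR (- s - u) * `|u - s| `^ (al - 1)) =
  2 * \int[leb]_(s in `[0, T]) expconv 2 (gker al 1) s.
Proof.
have E1 : \int[leb]_(s in `[0, T]) \int[leb]_(u in `[0, T]) (expR (- s - u) * `|u - s| `^ (al - 1)) =
    \int[leb]_s \int[leb]_u D (s, u).
  rewrite [LHS]Rintegral_mkcond; apply: eq_Rintegral => s _; rewrite patchE mem_setE in_itv/=.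
  case: ifP => sT.
    rewrite [LHS]Rintegral_mkcond; apply: eq_Rintegral => u _.
    rewrite patchE mem_setE in_itv/= /D/= !I1E sT mul1r.
    by case: ifP => _; rewrite ?mul1r ?mul0r.
  by rewrite Rintegral_eq0// => u _; rewrite /D/= I1E sT mul0r.
rewrite E1 (Rintegral_fubini1 integrable_D).
transitivity (\int[(leb \x leb)%E]_z (D1 z + D1 (z.2, z.1))).
  by apply: eq_Rintegral => -[s u] _; exact: D_split.
rewrite RintegralD//; last exact: (integrable_prod_swap integrable_D1).
rewrite -(Rintegral_fubini1 integrable_D1).
rewrite -(Rintegral_fubini2 (integrable_prod_swap integrable_D1)) /=.
have HX : \int[leb]_s \int[leb]_u D1 (s, u) =
    \int[leb]_(s in `[0, T]) expconv 2 (gker al 1) s.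
  rewrite [RHS]Rintegral_mkcond; apply: eq_Rintegral => s _.
  rewrite D1_section I1E patchE mem_setE in_itv/=.
  by case: ifP; rewrite ?mul1r ?mul0r.
by rewrite HX mulr_natl mulr2n.
Qed.

End variance_integral.

Section variance_facts.
Context {R : realType}.
Notation leb := (@lebesgue_measure R).

Lemma damp0_expconv (b : R) (m : R -> R) : damp 0 (expconv b m) = expconv b m.
Proof.
apply/funext => s; rewrite dampE mul0r oppr0 expR0 mul1r; case: ltP => // s0.
rewrite /expconv; have [->|s0'] := eqVneq s 0; first by rewrite set_itv1 Rintegral_set1.
by rewrite set_itv_ge ?Rintegral_set0// bnd_simp -ltNge lt_neqAle s0' s0.
Qed.

Lemma Rintegral_dilate (c t : R) (f : R -> R) : 0 < c ->
  leb.-integrable `[0, c * t] (EFin \o f) ->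
  \int[leb]_(s in `[0, c * t]) f s = c * \int[leb]_(s in `[0, t]) f (c * s).
Proof.
move=> c0 fi.
pose h (s : R) : R := if 0 <= s <= c * t then f s else 0.
have hi : leb.-integrable setT (EFin \o h).
  move: fi => /(integrable_mkcond (mu := leb) _ (measurable_itv _)).
  by apply: eq_integrable => // s _; rewrite patchE mem_setE in_itv/= /h; case: ifP.
transitivity (\int[leb]_s h s).
  by rewrite Rintegral_mkcond; apply: eq_Rintegral => s _; rewrite patchE mem_setE in_itv/= /h.
rewrite (Rintegral_affine 0 c0 hi); congr (c * _).
rewrite [RHS]Rintegral_mkcond; apply: eq_Rintegral => s _.
by rewrite patchE mem_setE in_itv/= /h addr0 pmulr_rge0// ler_pM2l.
Qed.

Variables (H theta : R).
Hypotheses (H_gt : 1 / 2 < H) (H_lt : H < 1) (theta_gt0 : 0 < theta).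

Let al : R := 2 * H - 1.
Let al0 : 0 < al. Proof. by rewrite /al subr_gt0 mulrC -ltr_pdivrMr. Qed.
Let al1 : al < 1.
Proof. by rewrite /al ltrBlDr -[ltRHS]/(2 : R) -[ltRHS]mulr1 ltr_pM2l. Qed.
Let c : R := theta^-1.
Let c0 : 0 < c. Proof. by rewrite invr_gt0. Qed.

Let b20 : 0 < 0 + 2 * c. Proof. by rewrite add0r mulr_gt0. Qed.
Let b10 : 0 < 0 + c. Proof. by rewrite add0r. Qed.

(* [rateV] is [V2'] up to the constant [2 H (2 H - 1)]. *)
Definition rateV : R -> R := expconv (2 * c) (gker al c).

Lemma expconv_gker_dilate s : 0 < s ->
  expconv 2 (gker al 1) (c * s) = c `^ al * rateV s.
Proof.
move=> s0; have cs0 : 0 < c * s by rewrite mulr_gt0.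
have ii : leb.-integrable `[0, c * s]
    (EFin \o (fun u : R => expR (- (2 * (c * s - u))) * gker al 1 u)).
  have := integrableZl (mu := leb) (measurable_itv _) (expR (- (2 * (c * s))))
    (integrable_exp_powR 2 1 al0 al1 cs0).
  apply: eq_integrable => // r _; rewrite /= -EFinM /gker !mulrA -!expRD.
  by congr (expR _ * _)%:E; ring.
rewrite /expconv (Rintegral_dilate c0 ii).
have jj : leb.-integrable `[0, s]
    (EFin \o (fun u : R => expR (- (2 * c * (s - u))) * gker al c u)).
  have := integrableZl (mu := leb) (measurable_itv _) (expR (- (2 * c * s)))
    (integrable_exp_powR (2 * c) c al0 al1 s0).
  apply: eq_integrable => // r _; rewrite /= -EFinM /gker !mulrA -!expRD.
  by congr (expR _ * _)%:E; ring.
rewrite /rateV /expconv -(RintegralZl (mu := leb) (c `^ al) (measurable_itv _) jj).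
have cal : c `^ al = c * c `^ (al - 1) by rewrite mulr_powRB1// ltW.
have jj' : leb.-integrable `[0, s] (EFin \o (fun u : R =>
    c `^ (al - 1) * (expR (- (2 * c * (s - u))) * gker al c u))).
  exact: (integrableZl (mu := leb) (measurable_itv _) _ jj).
have -> : \int[leb]_(s1 in `[0, s]) (expR (- (2 * (c * s - c * s1))) * gker al 1 (c * s1)) =
   \int[leb]_(u in `[0, s]) (c `^ (al - 1) * (expR (- (2 * c * (s - u))) * gker al c u)).
  apply: eq_Rintegral => u; rewrite inE/= in_itv/= => /andP[u0 _].
  rewrite /gker powRM ?(ltW c0)//.
  have -> : - (2 * (c * s - c * u)) = - (2 * c * (s - u)) by ring.
  by rewrite mul1r; ring.
rewrite -(RintegralZl (mu := leb) _ (measurable_itv _) jj').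
by apply: eq_Rintegral => u _; rewrite cal !mulrA.
Qed.

Lemma integrable_rateV : leb.-integrable setT (EFin \o rateV).
Proof.
rewrite -[rateV]damp0_expconv; apply: integrable_damp_expconv => //.
  exact: integrable_damp_gker.
exact: measurable_gker.
Qed.

Lemma rateV_ge0 t : 0 <= rateV t.
Proof.
by apply: Rintegral_ge0 => u _; rewrite mulr_ge0 ?expR_ge0// mulr_ge0 ?expR_ge0 ?powR_ge0.
Qed.

Definition boundV : R := \int[leb]_u `|damp 0 (gker al c) u|.

Lemma rateV_le t : `|rateV t| <= boundV.
Proof.
rewrite -[rateV]damp0_expconv; apply: damp_expconv_le => //.
  exact: integrable_damp_gker.
exact: measurable_gker.
Qed.

Lemma continuous_rateV t : 0 < t -> {for t, continuous rateV}.
Proof. by move=> t0; exact: continuous_expconv_gker. Qed.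

Lemma rateV_ge t : 0 < t -> expR (- (2 * c * t)) * t `^ al <= rateV t.
Proof.
move=> t0; apply: expconv_gker_ge => //.
by rewrite -[leLHS]mul1r ler_wpM2r ?(ltW c0)// ler1n.
Qed.

Let K : R := 2 * (H * (2 * H - 1)).

Lemma V2E t : 0 < t -> V2 H theta t = K * \int[leb]_(s in `[0, t]) rateV s.
Proof.
move=> t0; have ct0 : 0 < c * t by rewrite mulr_gt0.
rewrite /V2 [t / theta]mulrC -/c.
have -> : 2 * H - 2 = al - 1 by rewrite /al; ring.
rewrite (double_integral_kernel al0 al1 ct0).
have ei : leb.-integrable `[0, c * t] (EFin \o expconv 2 (gker al 1)).
  rewrite -[expconv _ _]damp0_expconv.
  apply: (integrableS (mu := leb) measurableT (measurable_itv _) (@subsetT _ _)).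
  apply: integrable_damp_expconv; rewrite ?add0r//; last exact: measurable_gker.
  by apply: integrable_damp_gker; rewrite ?add0r.
rewrite (Rintegral_dilate c0 ei).
have ri : leb.-integrable `[0, t] (EFin \o rateV).
  exact: (integrableS (mu := leb) measurableT (measurable_itv _) (@subsetT _ _) integrable_rateV).
have -> : \int[leb]_(s in `[0, t]) expconv 2 (gker al 1) (c * s) =
   c `^ al * \int[leb]_(s in `[0, t]) rateV s.
  rewrite -(RintegralZl (mu := leb) _ (measurable_itv _) ri).
  apply: eq_Rintegral => s; rewrite inE/= in_itv/= => /andP[].
  rewrite le_eqVlt => /predU1P[<- _|s0 _]; last exact: expconv_gker_dilate.
  by rewrite mulr0 /rateV /expconv set_itv1 !Rintegral_set1 mulr0.
have cc : c * c `^ al = theta `^ (- (2 * H)).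
  rewrite -[X in X * _](powRr1 (ltW c0)) -powRD; last by apply/implyP => _; rewrite gt_eqF.
  rewrite /c -[theta^-1]powR_inv1 ?ltW// -powRrM; congr (_ `^ _); rewrite /al; ring.
have tt : theta `^ (2 * H) * theta `^ (- (2 * H)) = 1.
  by rewrite powRN mulfV// gt_eqF// powR_gt0.
transitivity (K * (theta `^ (2 * H) * theta `^ (- (2 * H))) *
  \int[leb]_(s in `[0, t]) rateV s); last by rewrite tt mulr1.
by rewrite -cc /K; ring.
Qed.

Lemma is_derive_V2 (t : R) : 0 < t -> is_derive t (1 : R) (V2 H theta) (K * rateV t).
Proof.
move=> t0; pose F (x : R) := K * \int[leb]_(s in `[0, x]) rateV s.
have ri : leb.-integrable `[0, t + 1] (EFin \o rateV).
  exact: (integrableS (mu := leb) measurableT (measurable_itv _) (@subsetT _ _) integrable_rateV).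
have t1 : t < t + 1 by rewrite ltrDl.
have [df dE] := @continuous_FTC1_closed _ rateV 0 t (t + 1) t1 ri t0 (continuous_rateV t0).
have dF : is_derive t (1 : R) (fun x : R => \int[leb]_(s in `[0, x]) rateV s) (rateV t).
  by apply: DeriveDef; [exact: df|rewrite -derive1E; exact: dE].
have FE : {near nbhs t, F =1 V2 H theta}.
  by near=> x; rewrite /F -V2E//; near: x; exact: lt_nbhsr.
exact: (near_eq_is_derive FE (is_deriveZ K dF)).
Unshelve. all: by end_near. Qed.

Lemma dV2E (t : R) : 0 < t -> dV2 H theta t = K * rateV t.
Proof. by move=> t0; rewrite /dV2 derive1E; case: (is_derive_V2 t0). Qed.

Lemma V2_gt0 t : 0 < t -> 0 < V2 H theta t.
Proof.
move=> t0; rewrite V2E//.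
have K0 : 0 < K by rewrite mulr_gt0// mulr_gt0// (lt_trans _ H_gt).
rewrite mulr_gt0//.
pose k := expR (- (2 * c * t)) * (t / 2) `^ al.
have t20 : 0 < t / 2 by rewrite divr_gt0.
have k0 : 0 < k by rewrite mulr_gt0 ?expR_gt0 ?powR_gt0.
have ki : leb.-integrable setT (fun x : R => (k * \1_(`[t / 2, t]%classic) x)%:E).
  exact: (integrableZl measurableT k (integrable_indic_itv (t / 2) t true false)).
apply: (@lt_le_trans _ _ (\int[leb]_x (k * \1_(`[t / 2, t]%classic) x))).
  rewrite (RintegralZl _ measurableT); last exact: (integrable_indic_itv (t / 2) t true false).
  rewrite mulr_gt0// /Rintegral integral_indic//= setIT lebesgue_measure_itv/= lte_fin.
  have tt : t / 2 < t by rewrite ltr_pdivrMr// ltr_pMr// ltr1n.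
  by rewrite tt -EFinB/= subr_gt0.
rewrite [leRHS]Rintegral_mkcond; apply: le_Rintegral => //.
  have ri : leb.-integrable `[0, t] (EFin \o rateV).
    exact: (integrableS (mu := leb) measurableT (measurable_itv _) (@subsetT _ _) integrable_rateV).
  move: ri => /(integrable_mkcond (mu := leb) _ (measurable_itv _)).
  by apply: eq_integrable => // s _; rewrite /= !patchE; case: ifP.
move=> s _; rewrite patchE indicE !mem_setE !in_itv/=.
case: (leP (t / 2) s) => s2 /=; last first.
  by rewrite mulr0; case: ifP => // _; exact: rateV_ge0.
have s0 : 0 < s := lt_le_trans t20 s2.
rewrite (ltW s0)/=; case: (leP s t) => st /=; last by rewrite mulr0.
rewrite mulr1; apply: le_trans (rateV_ge s0).
rewrite ler_pM ?expR_ge0 ?powR_ge0//.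
  by rewrite ler_expR lerN2 ler_wpM2l// mulr_ge0// ltW.
by rewrite ge0_ler_powR ?nnegrE// ltW.
Qed.

Lemma V2_le t : 0 < t -> V2 H theta t <= K * boundV * t.
Proof.
move=> t0; rewrite V2E// -mulrA ler_wpM2l//.
  by rewrite mulr_ge0// mulr_ge0 ?(ltW al0)// (le_trans _ (ltW H_gt)).
have -> : boundV * t = \int[leb]_(s in `[0, t]) (cst boundV s).
  rewrite Rintegral_cst//= lebesgue_measure_itv/= lte_fin t0 -EFinB/= subr0.
  by [].
apply: le_Rintegral => //.
- exact: (integrableS (mu := leb) measurableT (measurable_itv _) (@subsetT _ _) integrable_rateV).
- apply/measurable_bounded_integrable => //.
    have HH : leb `[0, t]%classic = t%:E.
      by rewrite lebesgue_measure_itv/= lte_fin t0 -EFinB subr0.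
    by have := ltry t; rewrite -HH.
  by apply: filterS (nbhs_pinfty_ge (num_real `|boundV|)) => M HM x _.
- by move=> s _; apply: le_trans (ler_norm _) (rateV_le s).
Qed.

End variance_facts.

(** * The density of the fractional Ornstein-Uhlenbeck process *)

Section gaussian_profile.
Context {R : realType}.
Notation leb := (@lebesgue_measure R).
Variable x : R.
Hypothesis x0 : x != 0.

(* [pH H theta t x] is [gprofile (V2 H theta t)]. *)
Definition gprofile (v : R) : R :=
  (Num.sqrt (2 * pi * v))^-1 * expR (- (x ^+ 2 / (2 * v))).

Definition dgprofile (v : R) : R :=
  gprofile v * (x ^+ 2 / (2 * v ^+ 2) - (2 * v)^-1).

Let pi2_gt0 : 0 < 2 * pi :> R. Proof. by rewrite mulr_gt0// pi_gt0. Qed.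

Lemma gprofile_ge0 v : 0 <= gprofile v.
Proof. by rewrite mulr_ge0 ?expR_ge0// invr_ge0 sqrtr_ge0. Qed.

Lemma is_derive_gprofile (v : R) : 0 < v ->
  is_derive v (1 : R) gprofile (dgprofile v).
Proof.
move=> v0.
have w0 : 0 < 2 * pi * v by rewrite mulr_gt0.
pose G (v : R) := (2 * pi) `^ (- 2^-1) * v `^ (- 2^-1) * expR (- (x ^+ 2 / 2 * v^-1)).
have GE (y : R) : 0 < y -> G y = gprofile y.
  move=> y0; have z0 : 0 < 2 * pi * y by rewrite mulr_gt0.
  rewrite /G /gprofile -powRM ?(ltW y0) ?(ltW pi2_gt0)// powRN powR12_sqrt ?(ltW z0)//.
  by rewrite invfM mulrA.
have GN : {near nbhs v, G =1 gprofile}.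
  by near=> y; apply: GE; near: y; exact: lt_nbhsr.
apply: (near_eq_is_derive GN).
have H1 := is_derive1_powR (- 2^-1) v0.
have vn0 : v != 0 by rewrite gt_eqF.
have H2 : is_derive v (1 : R) (fun y : R => y^-1) (- v ^- 2).
  have := is_deriveV vn0 (is_derive_id v (1 : R)).
  by rewrite /GRing.scale/= mulr1.
have H2' : is_derive v (1 : R) (fun y : R => - (x ^+ 2 / 2 * y^-1)) (x ^+ 2 / 2 * v ^- 2).
  have := is_deriveN (is_deriveZ (x ^+ 2 / 2) H2).
  by rewrite /GRing.scale/= mulrN opprK.
have H3 : is_derive v (1 : R) (fun y : R => expR (- (x ^+ 2 / 2 * y^-1)))
    (expR (- (x ^+ 2 / 2 * v^-1)) * (x ^+ 2 / 2 * v ^- 2)).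
  exact: (@is_derive1_comp _ expR (fun y : R => - (x ^+ 2 / 2 * y^-1)) v _ _
    (is_derive_expR _) H2').
have H4 := is_deriveM (is_deriveZ ((2 * pi) `^ (- 2^-1)) H1) H3.
apply: (is_derive_eq H4); rewrite /dgprofile -(GE _ v0) /G /GRing.scale/=.
have -> : v `^ (- 2^-1 - 1) = v `^ (- 2^-1) / v.
  by rewrite powRB ?powRr1 ?(ltW v0)//; apply/implyP => _.
rewrite -[_ *: v `^ (- 2^-1)]/((2 * pi) `^ (- 2^-1) * v `^ (- 2^-1)).
by field.
Unshelve. all: by end_near. Qed.

Let mu : R := x ^+ 2 / 8.
Let mu0 : 0 < mu. Proof. by rewrite divr_gt0// exprn_even_gt0. Qed.

Lemma gprofile_expR_le v : 0 < v -> gprofile v * (1 + mu / v) ^+ 4 <= 1 + v^-1.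
Proof.
move=> v0; have w0 : 0 < 2 * pi * v by rewrite mulr_gt0.
have r0 : 0 < v^-1 by rewrite invr_gt0.
have e1 : expR (- (x ^+ 2 / (2 * v))) * (1 + mu / v) ^+ 4 <= 1.
  have : 1 + mu / v <= expR (mu / v) by exact: expR_ge1Dx.
  rewrite -(ler_pXn2r (n := 4))// ?nnegrE ?expR_ge0 ?addr_ge0 ?divr_ge0 ?(ltW mu0) ?(ltW v0) ?sqr_ge0//.
  rewrite -expRM_natl => h.
  apply: (@le_trans _ _ (expR (- (x ^+ 2 / (2 * v))) * expR (4%:R * (mu / v)))).
    by rewrite ler_wpM2l ?expR_ge0.
  rewrite -expRD (_ : _ + _ = 0) ?expR0//.
  by rewrite /mu; field; rewrite gt_eqF.
have e2 : (Num.sqrt (2 * pi * v))^-1 <= 1 + v^-1.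
  set y := (Num.sqrt (2 * pi * v))^-1.
  have y2 : y ^+ 2 = (2 * pi * v)^-1 by rewrite exprVn sqr_sqrtr// ltW.
  have : y <= 1 + y ^+ 2 by have := sqr_ge0 (y - 1/2); nra.
  move=> /le_trans; apply; rewrite lerD2l y2 lef_pV2 ?posrE//.
  rewrite ler_peMl ?(ltW v0)//; have := pi_ge2 R; lra.
rewrite /gprofile -[_ * expR _ * _]mulrA.
rewrite -[leRHS]mulr1 ler_pM ?invr_ge0 ?sqrtr_ge0//.
by rewrite mulr_ge0 ?expR_ge0// exprn_ge0// addr_ge0// divr_ge0 ?ltW.
Qed.

Let boundA : R := 1 + mu^-1.
Let boundB : R := (x ^+ 2 / 2) / mu ^+ 2 + (2 * mu)^-1.

Let boundA_ge0 : 0 <= boundA. Proof. by rewrite addr_ge0// invr_ge0 ltW. Qed.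
Let boundB_ge0 : 0 <= boundB.
Proof.
have m0 := ltW mu0; apply: addr_ge0; last by rewrite invr_ge0 mulr_ge0.
by rewrite divr_ge0 ?sqr_ge0// divr_ge0 ?sqr_ge0.
Qed.

Let step1 v : 0 < v -> gprofile v * (1 + mu / v) ^+ 3 <= boundA.
Proof.
move=> v0; have p0 : 0 < 1 + mu / v by rewrite ltr_pwDl// divr_ge0 ?ltW.
rewrite -(ler_pM2r p0) -mulrA -exprSr (le_trans (gprofile_expR_le v0))//.
rewrite /boundA mulrDl mul1r mulrDr mulr1 mulrA mulVf ?gt_eqF// mul1r.
have : 0 < mu^-1 by rewrite invr_gt0.
have : 0 < v^-1 by rewrite invr_gt0.
have : 0 < mu / v by rewrite divr_gt0.
lra.
Qed.

Lemma gprofile_le v : 0 < v -> gprofile v <= boundA / mu * v.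
Proof.
move=> v0; have p1 : 1 <= 1 + mu / v by rewrite lerDl divr_ge0 ?ltW.
rewrite -ler_pdivrMr// ler_pdivlMr//.
apply: le_trans (step1 v0); rewrite -mulrA ler_wpM2l ?gprofile_ge0//.
apply: (@le_trans _ _ (1 + mu / v)); first by rewrite mulrC lerDr.
by rewrite ler_eXnr.
Qed.

Let dg_factor_le v : 0 < v ->
  `|x ^+ 2 / (2 * v ^+ 2) - (2 * v)^-1| <= boundB * (1 + mu / v) ^+ 2.
Proof.
move=> v0; have m0 : 0 < mu / v by rewrite divr_gt0.
have h1 : 0 <= x ^+ 2 / (2 * v ^+ 2) by rewrite divr_ge0 ?sqr_ge0// mulr_ge0 ?sqr_ge0.
have h2 : 0 <= (2 * v)^-1 by rewrite invr_ge0 mulr_ge0// ltW.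
rewrite (le_trans (ler_normB _ _))// (ger0_norm h1) (ger0_norm h2).
have -> : x ^+ 2 / (2 * v ^+ 2) = (x ^+ 2 / 2) / mu ^+ 2 * (mu / v) ^+ 2.
  by field; rewrite ?gt_eqF.
have -> : (2 * v)^-1 = (2 * mu)^-1 * (mu / v).
  by field; rewrite ?gt_eqF.
set q := (1 + mu / v) ^+ 2.
have -> : boundB * q = x ^+ 2 / 2 / mu ^+ 2 * q + (2 * mu)^-1 * q by rewrite -mulrDl.
apply: lerD; apply: ler_wpM2l.
- by rewrite divr_ge0 ?sqr_ge0// divr_ge0 ?sqr_ge0.
- by rewrite /q ler_sqr ?nnegrE ?addr_ge0 ?(ltW m0)// lerDr.
- by rewrite invr_ge0 mulr_ge0// ltW.
- by rewrite /q; nra.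
Qed.

Lemma dgprofile_le v : 0 < v -> `|dgprofile v| <= boundA * boundB.
Proof.
move=> v0; have m0 : 0 < mu / v by rewrite divr_gt0.
have p1 : 1 <= 1 + mu / v by rewrite lerDl ltW.
have A1 : `|x ^+ 2 / (2 * v ^+ 2) - (2 * v)^-1| <= boundB * (1 + mu / v) ^+ 2.
  exact: dg_factor_le.
rewrite /dgprofile normrM (ger0_norm (gprofile_ge0 _)).
apply: (@le_trans _ _ (gprofile v * (boundB * (1 + mu / v) ^+ 2))).
  by rewrite ler_wpM2l ?gprofile_ge0.
rewrite mulrCA mulrC ler_wpM2r//; apply: le_trans (step1 v0).
by rewrite ler_wpM2l ?gprofile_ge0//; exact: ler_weXn2l.
Qed.

Lemma dgprofile_le_linear v : 0 < v -> `|dgprofile v| <= boundA * boundB / mu * v.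
Proof.
move=> v0; have m0 : 0 < mu / v by rewrite divr_gt0.
have p1 : 1 <= 1 + mu / v by rewrite lerDl ltW.
rewrite -ler_pdivrMr//; apply: (@le_trans _ _ (gprofile v * (1 + mu / v) ^+ 3 * (boundB / mu))).
  have g0 := gprofile_ge0 v; have f := dg_factor_le v0.
  rewrite /dgprofile normrM (ger0_norm g0); move: g0 f p1 m0.
  set G := gprofile v; set E := `|_ - _|; set m := mu / v => g0 f p1 m0.
  apply: (@le_trans _ _ (G * (boundB * (1 + m) ^+ 2) / v)).
    by rewrite ler_wpM2r ?invr_ge0 ?(ltW v0)// ler_wpM2l.
  have -> : G * (boundB * (1 + m) ^+ 2) / v = G * (1 + m) ^+ 2 * (boundB / mu) * m.
    by rewrite {3}/m; field; rewrite ?gt_eqF.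
  have -> : G * (1 + m) ^+ 3 * (boundB / mu) = G * (1 + m) ^+ 2 * (boundB / mu) * (1 + m).
    by rewrite exprSr; ring.
  apply: ler_wpM2l; last by rewrite lerDr.
  by apply: mulr_ge0; [apply: mulr_ge0 => //; exact: sqr_ge0|apply: divr_ge0 => //; exact: ltW].
rewrite -[leRHS]mulrA; apply: ler_wpM2r; last exact: step1.
by apply: divr_ge0 => //; exact: ltW.
Qed.

Lemma gprofile_bound v : 0 < v -> gprofile v <= boundA.
Proof.
move=> v0; apply: le_trans (step1 v0); rewrite -[leLHS]mulr1 ler_wpM2l ?gprofile_ge0//.
by rewrite exprn_ege1// lerDl divr_ge0 ?ltW.
Qed.

Lemma continuous_dgprofile (v : R) : 0 < v -> {for v, continuous dgprofile}.
Proof.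
move=> v0; have vn0 : v != 0 by rewrite gt_eqF.
apply: cvgM.
  have [d _] := is_derive_gprofile v0.
  by apply: differentiable_continuous; exact/derivable1_diffP.
apply: cvgB.
  apply: cvgM; first exact: cvg_cst.
  apply: cvgV; first by rewrite mulf_neq0// expf_neq0.
  by apply: cvgM; [exact: cvg_cst|exact: exprn_continuous].
apply: cvgV; first by rewrite mulf_neq0.
by apply: cvgM; [exact: cvg_cst|exact: cvg_id].
Qed.

End gaussian_profile.

Section density_profile.
Context {R : realType}.
Notation leb := (@lebesgue_measure R).
Variables (H theta x : R).
Hypotheses (H_gt : 1 / 2 < H) (H_lt : H < 1) (theta_gt0 : 0 < theta) (x0 : x != 0).

Let K : R := 2 * (H * (2 * H - 1)).
Let V := V2 H theta.
Let f (t : R) : R := pH H theta t x.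

Let K0 : 0 < K.
Proof.
have h : 0 < 2 * H - 1 by rewrite subr_gt0 mulrC -ltr_pdivrMr.
by rewrite mulr_gt0// mulr_gt0// (lt_trans _ H_gt).
Qed.

(* The time derivative of [pH H theta ^~ x]. *)
Definition dpH (t : R) : R := dgprofile x (V2 H theta t) * (2 * (H * (2 * H - 1)) * rateV H theta t).

Let is_derive_pH (t : R) : 0 < t -> is_derive t (1 : R) f (dpH t).
Proof.
move=> t0; have V0 := V2_gt0 H_gt H_lt theta_gt0 t0.
exact: (is_derive1_comp (is_derive_gprofile x V0) (is_derive_V2 H_gt H_lt theta_gt0 t0)).
Qed.

Let continuous_V (t : R) : 0 < t -> {for t, continuous V}.
Proof.
move=> t0; have [d _] := is_derive_V2 H_gt H_lt theta_gt0 t0.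
by apply: differentiable_continuous; exact/derivable1_diffP.
Qed.

Lemma continuous_pH (t : R) : 0 < t -> {for t, continuous (fun t => pH H theta t x)}.
Proof.
move=> t0; have [d _] := is_derive_pH t0.
by apply: differentiable_continuous; exact/derivable1_diffP.
Qed.

Lemma pH_ge0 t : 0 <= pH H theta t x.
Proof. exact: gprofile_ge0. Qed.

Lemma pH_bound : exists M, forall t, 0 < t -> pH H theta t x <= M.
Proof.
by eexists => t t0; apply: gprofile_bound => //; exact: V2_gt0.
Qed.

Let continuous_dpH (t : R) : 0 < t -> {for t, continuous dpH}.
Proof.
move=> t0; apply: cvgM.
  apply: continuous_comp; first exact: continuous_V.
  by apply: continuous_dgprofile; exact: V2_gt0.
by apply: cvgM; [exact: cvg_cst|exact: continuous_rateV].
Qed.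

Lemma measurable_dpH : measurable_fun (`]0, +oo[%classic : set R) dpH.
Proof.
apply: open_continuous_measurable_fun => //.
by move=> t /set_mem; rewrite /= in_itv/= andbT; exact: continuous_dpH.
Qed.

Let dpH_le : exists M, forall t, 0 < t -> `|dpH t| <= M * rateV H theta t.
Proof.
have [C HC] : exists C, forall v, 0 < v -> `|dgprofile x v| <= C.
  by eexists => v v0; exact: (dgprofile_le x0 v0).
exists (C * K) => t t0; rewrite /dpH normrM.
rewrite [X in _ * X]ger0_norm; last by rewrite mulr_ge0 ?(ltW K0)// rateV_ge0.
rewrite [leLHS]mulrA; apply: ler_wpM2r; first exact: rateV_ge0.
apply: ler_wpM2r; first exact: ltW.
by apply: HC; exact: V2_gt0.
Qed.

Lemma integrable_damp_dpH a : 0 <= a -> leb.-integrable setT (EFin \o damp a dpH).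
Proof.
move=> a0; have [M HM] := dpH_le.
apply: (le_integrable measurableT _ _ (integrableZl measurableT M (integrable_rateV H_gt H_lt theta_gt0))).
  by apply/measurable_EFinP; apply: measurable_damp; exact: measurable_dpH.
move=> t _ /=; rewrite lee_fin dampE; case: ltP => t0; last by rewrite normr0.
rewrite normrM ger0_norm ?expR_ge0// (le_trans _ (ler_norm _))//.
apply: le_trans (HM _ t0); rewrite ler_piMl//.
by rewrite -expR0 ler_expR oppr_le0 mulr_ge0// ltW.
Qed.

Lemma damp_dpH_bound a : 0 <= a -> exists M, forall t, `|damp a dpH t| <= M.
Proof.
move=> a0; have [M HM] := dpH_le.
exists (`|M| * boundV H theta) => t; rewrite dampE; case: ltP => t0; last first.
  by rewrite normr0 mulr_ge0//; apply: Rintegral_ge0.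
rewrite normrM ger0_norm ?expR_ge0//; apply: (@le_trans _ _ `|dpH t|).
  by rewrite ler_piMl// -expR0 ler_expR oppr_le0 mulr_ge0// ltW.
apply: le_trans (HM _ t0) _; apply: le_trans (ler_norm _) _; rewrite normrM ler_wpM2l//.
exact: rateV_le.
Qed.

Lemma pH_expconv (t : R) : 0 < t -> pH H theta t x = expconv 0 dpH t.
Proof.
move=> t0.
pose F (s : R) := if 0 < s then f s else 0.
pose k (s : R) := if 0 < s then dpH s else 0.
have nearE (s : R) (g : R -> R) : 0 < s -> {near nbhs s, g =1 (fun s => if 0 < s then g s else 0)}.
  by move=> s0; near=> r; rewrite ifT//; near: r; exact: lt_nbhsr.
have V_at0 (C : R) : C * V s @[s --> 0^'+] --> (0 : R).
  have VE : forall s, 0 < s -> `|C * V s| <= `|C| * (K * boundV H theta) * s.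
    move=> s s0; rewrite normrM -mulrA ler_wpM2l//.
    rewrite ger0_norm; last exact: ltW (V2_gt0 H_gt H_lt theta_gt0 s0).
    exact: V2_le.
  have B : `|C| * (K * boundV H theta) * s @[s --> 0^'+] --> (0 : R).
    rewrite -[X in _ --> X](mulr0 (`|C| * (K * boundV H theta))).
    apply: cvgM; first exact: cvg_cst.
    by apply: cvg_at_right_filter; exact: cvg_id.
  apply/cvgr0Pnorm_le => /= e e0.
  move/cvgr0Pnorm_le : B => /(_ e e0) B.
  near=> s; have s0 : 0 < s by near: s; exact: nbhs_right_gt.
  apply: le_trans (VE _ s0) _; apply: le_trans (ler_norm _) _.
  by near: s.
have sq (h : R -> R) (C : R) : (forall s, 0 < s -> `|h s| <= C * V s) ->
    (fun s => if 0 < s then h s else 0) s @[s --> 0^'+] --> (0 : R).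
  move=> hC; apply/cvgr0Pnorm_le => /= e e0.
  have /cvgr0Pnorm_le /(_ e e0) B := V_at0 C.
  near=> s; have s0 : 0 < s by near: s; exact: nbhs_right_gt.
  rewrite s0; apply: le_trans (hC _ s0) _; apply: le_trans (ler_norm _) _.
  by near: s.
have kc s : 0 < s -> {for s, continuous k}.
  move=> s0; rewrite /prop_for /continuous_at {2}/k s0.
  apply: cvg_trans (continuous_dpH s0); apply: near_eq_cvg.
  exact: nearE.
have Fc s : 0 < s -> {for s, continuous F}.
  move=> s0; rewrite /prop_for /continuous_at {2}/F s0.
  apply: cvg_trans (continuous_pH s0); apply: near_eq_cvg.
  exact: nearE.
have Fd (s : R) : 0 < s -> is_derive s (1 : R) F (k s).
  move=> s0; rewrite /k s0; exact: (near_eq_is_derive (nearE s f s0) (is_derive_pH s0)).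
have k_at0 : k s @[s --> 0^'+] --> k 0.
  have [C HC] : exists C, forall v, 0 < v -> `|dgprofile x v| <= C * v.
    by eexists => v v0; exact: (dgprofile_le_linear x0 v0).
  rewrite {2}/k ltxx; apply: (sq dpH (C * (K * boundV H theta))) => s s0.
  rewrite /dpH normrM [leRHS]mulrAC; apply: ler_pM => //.
    exact: HC (V2_gt0 H_gt H_lt theta_gt0 s0).
  rewrite normrM (gtr0_norm K0) ler_wpM2l ?(ltW K0)//.
  exact: rateV_le.
have F_at0 : F s @[s --> 0^'+] --> F 0.
  rewrite {2}/F ltxx; apply: (sq f _) => s s0.
  rewrite ger0_norm; last exact: gprofile_ge0.
  exact: (gprofile_le x0 (V2_gt0 H_gt H_lt theta_gt0 s0)).
have FTC := @continuous_FTC2 _ k F 0 t t0.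
have {}FTC : (\int[leb]_(s in `[0%R, t]) (k s)%:E = (F t)%:E - (F 0)%:E)%E.
  apply: FTC.
  - apply/(continuous_within_itvP _ t0); split; [| exact: k_at0 |].
    + by move=> s; rewrite in_itv/= => /andP[s0 _]; exact: kc.
    + by apply: cvg_at_left_filter; exact: kc.
  - split; [| exact: F_at0 |].
    + by move=> s; rewrite in_itv/= => /andP[s0 _]; case: (Fd s s0).
    + by apply: cvg_at_left_filter; exact: Fc.
  - by move=> s; rewrite in_itv/= => /andP[s0 _]; rewrite derive1E; case: (Fd s s0).
transitivity (F t - F 0); first by rewrite /F ltxx t0 subr0.
rewrite -[LHS]/(fine ((F t)%:E - (F 0)%:E)%E) -FTC /expconv /Rintegral.
have mk : measurable_fun `]0, t[ dpH.
  by apply: measurable_funS measurable_dpH => // s; rewrite /= !in_itv/= => /andP[->].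
rewrite [in RHS]integral_itv_bndoo; last first.
  apply/measurable_EFinP; apply: measurable_funM => //.
  apply: measurableT_comp => //; apply: measurableT_comp => //.
  by apply: measurable_funM => //; exact: measurable_funB.
rewrite [in LHS]integral_itv_bndoo; last first.
  apply/measurable_EFinP; apply: eq_measurable_fun mk => s.
  by rewrite inE/= in_itv/= /k => /andP[->].
congr fine; apply: eq_integral => s; rewrite inE/= in_itv/= /k => /andP[-> _].
by rewrite mul0r oppr0 expR0 mul1r.
Unshelve. all: by end_near. Qed.

Lemma damp_pH a : damp a (fun t => pH H theta t x) = damp a (expconv 0 dpH).
Proof. by apply/funext => t; rewrite !dampE; case: ltP => // t0; rewrite pH_expconv. Qed.

Lemma fourier_pH a y : 0 < a ->
  fourier (damp a (fun t => pH H theta t x)) y = (a +i* y)^-1 * fourier (damp a dpH) y.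
Proof.
move=> a0; rewrite damp_pH fourier_expconv ?addr0//.
- exact: integrable_damp_dpH (ltW a0).
- exact: measurable_dpH.
Qed.

Lemma integrable_damp_pH a : 0 < a ->
  leb.-integrable setT (EFin \o damp a (fun t => pH H theta t x)).
Proof.
move=> a0; rewrite damp_pH; apply: integrable_damp_expconv; rewrite ?addr0//.
- exact: integrable_damp_dpH (ltW a0).
- exact: measurable_dpH.
Qed.

Lemma cintegrable_fourier_pH a : 0 < a ->
  cintegrable leb setT (fourier (damp a (fun t => pH H theta t x))).
Proof.
move=> a0; have [M HM] := damp_dpH_bound (ltW a0).
rewrite (_ : fourier _ = fun y => (a +i* y)^-1 * fourier (damp a dpH) y); last first.
  by apply/funext => y; exact: fourier_pH.
exact: (cintegrable_fourier_resolvent a0 (integrable_damp_dpH (ltW a0)) HM).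
Qed.

Lemma fourier_inversion_pH a t : 0 < a -> 0 < t ->
  cintegral leb setT (fun y => cis (y * t) * fourier (damp a (fun t => pH H theta t x)) y) =
  (2 * pi * (expR (- (a * t)) * pH H theta t x))%:C.
Proof.
move=> a0 t0; have [M HM] := pH_bound.
have M0 : 0 <= M by apply: le_trans (HM _ t0); exact: pH_ge0.
apply: (fourier_inversion_damp t0 (integrable_damp_pH a0) (M := M)).
- move=> s; rewrite dampE; case: ltP => s0; last by rewrite normr0.
  rewrite ger0_norm ?mulr_ge0 ?expR_ge0 ?pH_ge0//; apply: le_trans (HM _ s0).
  by rewrite ler_piMl ?pH_ge0// -expR0 ler_expR oppr_le0 mulr_ge0 ?ltW.
- exact: continuous_pH.
- exact: cintegrable_fourier_pH.
Qed.

End density_profile.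

Section variance_rate_transform.
Context {R : realType}.
Notation leb := (@lebesgue_measure R).

Variables (H theta a : R).
Hypotheses (H_gt : 1 / 2 < H) (H_lt : H < 1) (theta_gt0 : 0 < theta).
Hypothesis a_gt : 0 < a + theta^-1.

Let al : R := 2 * H - 1.
Let al0 : 0 < al. Proof. by rewrite /al subr_gt0 mulrC -ltr_pdivrMr. Qed.
Let al1 : al < 1.
Proof. by rewrite /al ltrBlDr -[X in _ < X]/(2 : R) -[ltRHS]mulr1 ltr_pM2l. Qed.
Let K : R := 2 * (H * (2 * H - 1)).
Let b : R := 2 * theta^-1.
Let ab0 : 0 < a + b.
Proof. by rewrite /b mulr_natl mulr2n addrA ltr_pwDr// ?invr_gt0// ltW. Qed.

Let gi : leb.-integrable setT (EFin \o damp a (gker al theta^-1)).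
Proof. exact: integrable_damp_gker. Qed.

Let mg : measurable_fun (`]0, +oo[%classic : set R) (gker al theta^-1).
Proof. exact: measurable_gker. Qed.

Let damp_dV2E : damp a (dV2 H theta) = fun t => K * damp a (rateV H theta) t.
Proof.
apply/funext => t; rewrite !dampE; case: ltP => t0; last by rewrite mulr0.
by rewrite dV2E// mulrCA.
Qed.

Lemma integrable_damp_dV2 : leb.-integrable setT (EFin \o damp a (dV2 H theta)).
Proof.
rewrite damp_dV2E; exact: (integrableZl measurableT K (integrable_damp_expconv ab0 gi mg)).
Qed.

Let fourier_dV2 y : fourier (damp a (dV2 H theta)) y =
  K%:C * (((a + b) +i* y)^-1 * fourier (damp a (gker al theta^-1)) y).
Proof.
rewrite -(fourier_expconv y ab0 gi mg) damp_dV2E /fourier.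
rewrite -cintegralZl; [|exact: measurableT|].
  by apply: eq_cintegral => s _; rewrite rcM mulrCA.
exact: (cintegrable_fourier y (integrable_damp_expconv ab0 gi mg)).
Qed.

Lemma cintegrable_fourier_dV2 :
  cintegrable leb setT (fourier (damp a (dV2 H theta))).
Proof.
apply: (eq_cintegrable (mu := leb) (f := fun y => K%:C * (((a + b) +i* y)^-1 * fourier (damp a (gker al theta^-1)) y))).
- exact: measurableT.
- by move=> y _; rewrite fourier_dV2.
- by apply: cintegrableZl; [exact: measurableT|exact: cintegrable_resolvent_fourier_gker].
Qed.

Lemma fourier_inversion_dV2 t : 0 < t ->
  cintegral leb setT (fun y => cis (y * t) * fourier (damp a (dV2 H theta)) y) =
  (2 * pi * (expR (- (a * t)) * dV2 H theta t))%:C.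
Proof.
move=> t0; have bd s : `|damp a (dV2 H theta) s| <= `|K| * \int[leb]_u `|damp a (gker al theta^-1) u|.
  by rewrite damp_dV2E normrM ler_wpM2l//; exact: damp_expconv_le.
apply: (fourier_inversion_damp t0 integrable_damp_dV2 bd _ cintegrable_fourier_dV2).
rewrite /prop_for /continuous_at dV2E//.
apply: (@cvg_trans _ (K * rateV H theta s @[s --> t])).
  apply: near_eq_cvg; near=> s; rewrite dV2E//.
  by near: s; exact: lt_nbhsr.
suff h : {for t, continuous (fun s => K * rateV H theta s)} by exact: h.
apply: cvgM; first exact: cvg_cst.
exact: continuous_rateV.
Unshelve. all: by end_near. Qed.

End variance_rate_transform.

(** * The subordinator and its inverse *)

Section distribution_functions.
Context {R : realType} {d} {T : measurableType d} (P : probability T R).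

Lemma fine_prob_le1 (A : set T) : measurable A -> fine (P A) <= 1.
Proof.
by move=> mA; rewrite -lee_fin fineK ?fin_num_measure//; exact: probability_le1.
Qed.

Lemma le_fine_prob (A B : set T) : measurable A -> measurable B -> A `<=` B ->
  fine (P A) <= fine (P B).
Proof.
by move=> mA mB AB; rewrite fine_le ?fin_num_measure// le_measure ?inE.
Qed.

Variable X : T -> R.
Hypothesis mX : measurable_fun setT X.

Lemma measurable_le_set (t : R) : measurable [set w | X w <= t].
Proof.
rewrite (_ : [set w | _] = setT `&` X @^-1` `]-oo, t]); first exact: mX.
by rewrite setTI; apply/seteqP; split => w; rewrite /= in_itv.
Qed.

Lemma prob_le_lt_right (t c : R) : fine (P [set w | X w <= t]) < c ->
  exists2 s, t < s & fine (P [set w | X w <= s]) < c.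
Proof.
pose Y : {mfun T >-> R} := HB.pack X (isMeasurableFun.Build _ _ _ _ X mX).
have YE s : P [set w | X w <= s] = cdf (Y : {RV P >-> R}) s.
  by rewrite /cdf /distribution /pushforward; congr (P _); apply/seteqP; split => w; rewrite /= in_itv.
move=> h; have := @cdf_right_continuous _ _ _ P Y t.
rewrite -[X in _ --> X]fineK ?fin_num_measure// => /fine_cvg; rewrite -(YE t) => /cvgr_lt /(_ _ h) near_lt.
near (at_right t) => s; exists s.
  by near: s; exact: nbhs_right_gt.
by rewrite YE; near: s; exact: near_lt.
Unshelve. all: by end_near. Qed.

End distribution_functions.

Section two_variable_measurability.
Context {R : realType}.

Lemma measurable_fun_rcontinuous_monotone (M : R -> R -> R) :
  (forall t, measurable_fun setT (M t)) ->
  (forall u, {homo M^~ u : s t / s <= t}) ->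
  (forall t u c, M t u < c -> exists2 s, t < s & M s u < c) ->
  measurable_fun setT (fun z : R * R => M z.1 z.2).
Proof.
move=> mM ndM rcM.
apply: (measurability (@RGenInftyO.G R)); first exact: RGenInftyO.measurableE.
move=> _ [_] [c] -> <-; rewrite setTI.
rewrite (_ : _ @^-1` _ = \bigcup_(q : rat) ([set t : R | t < ratr q] `*` [set u | M (ratr q) u < c])).
  apply: bigcupT_measurable_rat => q; apply: measurableX.
    rewrite (_ : [set t | _] = `]-oo, ratr q[%classic); first exact: measurable_itv.
    by apply/seteqP; split => t; rewrite /= in_itv.
  rewrite (_ : [set u | _] = setT `&` M (ratr q) @^-1` `]-oo, c[); first exact: mM.
  by rewrite setTI; apply/seteqP; split => u; rewrite /= in_itv.
apply/seteqP; split => [[t u]|[t u] [q _] [/= tq Mq]] /=; rewrite in_itv/=.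
  move=> /rcM [s ts Ms]; have [q] := rat_in_itvoo ts.
  rewrite in_itv/= => /andP[tq qs]; exists q => //; split => //=.
  by apply: le_lt_trans Ms; apply: ndM; exact: ltW.
by apply: le_lt_trans Mq; apply: ndM; exact: ltW.
Qed.

End two_variable_measurability.

Section laplace_distribution_function.
Context {R : realType} {d} {T : measurableType d} (P : probability T R).
Notation leb := (@lebesgue_measure R).
Variable X : T -> R.
Hypotheses (mX : measurable_fun setT X) (X0 : forall w, 0 <= X w).

Let cintegral_indic (A : set T) : measurable A ->
  cintegrable P setT (fun w => (\1_A w)%:C) /\
  cintegral P setT (fun w => (\1_A w)%:C) = (fine (P A))%:C.
Proof.
move=> mA; split; last first.
  rewrite cintegral_real; last exact: measurableT.
  by rewrite /Rintegral integral_indic ?setIT//; exact: measurableT.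
apply: (cintegrable_le measurableT _ (finite_measure_integrable_cst P 1 measurableT)).
  by apply: cmeasurable_real; exact: measurable_indic.
by move=> w _; rewrite normc_real indicE; case: (w \in A); rewrite ?normr1 ?normr0.
Qed.

Let laplace_step (l : R[i]) (c : R) : Hstar l -> 0 <= c ->
  laplace (fun t => (c <= t)%R%:R) l = l^-1 * cexp (- (l * c%:C)).
Proof.
move=> l0 c0; have [ei eE] := cintegral_cexp l0.
pose g (t : R) := (\1_(`]0, +oo[%classic : set R) t)%:C * cexp (- (l * t%:C)).
have gi : cintegrable leb setT g by exact: (proj1 (cintegrable_mkcond leb _ (measurable_itv _)) ei).
have gE : cintegral leb setT g = l^-1 by rewrite -eE [RHS]cintegral_mkcond.
have mS := cintegrable_meas (cintegrable_shift c gi).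
rewrite /laplace cintegral_mkcond mulrC -gE -(cintegral_shift c gi).
rewrite -cintegralZl; [|exact: measurableT|exact: cintegrable_shift].
apply: cintegral_ae_eq; first exact: measurableT.
- apply: cmeasurableM; first by apply: cmeasurable_real; exact: measurable_indic.
  apply: cmeasurableM.
    apply: cmeasurable_cexp; apply: cmeasurableN; apply: cmeasurableM; first exact: cmeasurable_cst.
    by apply: cmeasurable_real; exact: measurable_id.
  apply: cmeasurable_real.
  apply: nondecreasing_measurable => // s t st; rewrite ler_nat.
  by case: (leP c s) => // cs; rewrite (le_trans cs st).
- by apply: cmeasurableM => //; exact: cmeasurable_cst.
apply: (@ae_eq_neq _ c) => t _ tc; rewrite /g !indicE !mem_setE !in_itv/= !andbT subr_gt0.
rewrite [c <= t]le_eqVlt eq_sym (negPf tc)/=.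
case: (ltP c t) => ct; last by rewrite !mulr0 mul0r mulr0.
rewrite (le_lt_trans c0 ct) !mul1r mulr1 -cexpD; congr cexp.
by rewrite rmorphB mulrBr opprB addKr.
Qed.

Lemma laplace_prob_le (l : R[i]) : Hstar l ->
  laplace (fun t => fine (P [set w | X w <= t])) l =
  l^-1 * cintegral P setT (fun w => cexp (- (l * (X w)%:C))).
Proof.
case: l => a b l0; have a0 : 0 < a by [].
rewrite laplace_fourier /fourier.
pose f (t : R) (w : T) : R[i] := cis (- (b * t)) * (damp a (cst 1) t * (X w <= t)%R%:R)%:C.
pose h (z : R * T) : R := damp a (cst 1) z.1 * cst 1 z.2.
have mle : measurable_fun setT (fun z : R * T => ((X z.2 <= z.1)%R%:R : R)).
  rewrite (_ : (fun z => _) = \1_([set z : R * T | X z.2 <= z.1])).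
    apply: measurable_indic.
    rewrite (_ : [set z | _] = setT `&` (fun z : R * T => z.1 - X z.2) @^-1` `[0, +oo[).
      apply: (@measurable_funB _ _ _ _ fst (X \o snd)) => //.
      exact: measurableT_comp.
    by rewrite setTI; apply/seteqP; split => z; rewrite /= in_itv/= andbT subr_ge0.
  by apply/funext => z; rewrite indicE mem_setE.
have mdamp : measurable_fun setT (damp a (cst (1 : R))).
  by apply: measurable_damp; exact: measurable_cst.
have mf : cmeasurable setT (fun z : R * T => f z.1 z.2).
  apply: cmeasurableM.
    apply: cmeasurable_cis; apply: measurableT_comp => //; apply: measurable_funM => //.
  apply: cmeasurable_real; apply: measurable_funM => //.
  exact: measurableT_comp.
have hi : (leb \x P)%E.-integrable setT (EFin \o h).
  apply: integrable_tensor; first exact: integrable_damp1.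
  exact: finite_measure_integrable_cst.
have fh x y : normc (f x y) <= h (x, y).
  rewrite /f ComplexField.Normc.normcM normc_cis mul1r normc_real /h/= mulr1.
  have d0 : 0 <= damp a (cst 1) x by rewrite dampE; case: ifP => //; rewrite mulr1 expR_ge0.
  by rewrite normrM (ger0_norm d0) ler_piMr//; case: (X y <= x); rewrite ?normr1 ?normr0.
transitivity (cintegral leb setT (fun t => cintegral P setT (f t))).
  apply: eq_cintegral => t _.
  have [ii iE] := cintegral_indic (measurable_le_set mX t).
  transitivity (cintegral P setT (fun w => (cis (- (b * t)) * (damp a (cst 1) t)%:C) *
      (\1_([set w | X w <= t]) w)%:C)); last first.
    by apply: eq_cintegral => w _; rewrite /f rcM mulrA indicE mem_setE.
  rewrite cintegralZl ?iE; [|exact: measurableT|exact: ii].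
  rewrite -mulrA -rcM !dampE; case: ifP => _; last by rewrite mul0r.
  by rewrite mulr1.
rewrite (cintegral_fubini (m1 := leb) (m2 := P) mf hi fh).
rewrite -cintegralZl; [|exact: measurableT|].
  apply: eq_cintegral => w _; rewrite -(laplace_step l0 (X0 w)) laplace_fourier.
  apply: eq_cintegral => t _; rewrite /f !dampE; case: ifP => _; last by rewrite mul0r.
  by rewrite mulr1.
apply: (cintegrable_le measurableT _ (finite_measure_integrable_cst P 1 measurableT)).
  apply: cmeasurable_cexp; apply: cmeasurableN; apply: cmeasurableM; first exact: cmeasurable_cst.
  exact: cmeasurable_real.
move=> w _; rewrite normc_cexp/= mulr0 subr0 -expR0 ler_expR oppr_le0.
by rewrite mulr_ge0// ltW.
Qed.

End laplace_distribution_function.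

Section inverse_of_subordinator.
Context {R : realType} {d} {T : measurableType d} (P : probability T R).
Notation leb := (@lebesgue_measure R).
Variable sigma : R -> T -> R.
Hypothesis hs : subordinator P sigma.

Let passage t w : set R := [set y | 0 < y /\ t < sigma y w].

Let passage_lb t w : has_lbound (passage t w).
Proof. by exists 0 => y [/ltW]. Qed.

Let le_of_lt_inverse t u w : 0 <= t -> 0 <= u -> u < inverse_process sigma t w -> sigma u w <= t.
Proof.
move=> t0 u0 uE; rewrite leNgt; apply/negP => tu.
have u1 : 0 < u.
  rewrite lt_neqAle u0 andbT; apply/eqP => ue; move: tu.
  by rewrite -ue (sub_0 hs) ltNge t0.
by move: uE; rewrite ltNge => /negP; apply; exact: (ge_inf (passage_lb t w) (conj u1 tu)).
Qed.

Let le_inverse_of_le t u w : 0 <= u -> sigma u w <= t ->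
  inverse_process sigma t w = 0 \/ u <= inverse_process sigma t w.
Proof.
move=> u0 su; rewrite /inverse_process -/(passage t w).
have [->|/set0P ne] := eqVneq (passage t w) set0; first by left; rewrite inf0.
right; apply: lb_le_inf ne _ => y [y0 ty]; rewrite leNgt; apply/negP => yu.
have := sub_nondecreasing hs w (ltW y0) (ltW yu).
by move/(lt_le_trans ty); rewrite ltNge su.
Qed.

Lemma inverse_survival (t u : R) (f : R -> R) : 0 < t -> 0 <= u ->
  is_pdf P (inverse_process sigma t) f ->
  \int[leb]_(y in `]u, +oo[) f y = fine (P [set w | sigma u w <= t]).
Proof.
move=> t0 u0 [mE mf f0 fP].
pose E := inverse_process sigma t.
have null c : P [set w | E w = c] = 0%E.
  have := fP [set c] (measurable_set1 c).
  rewrite (_ : _ @^-1` _ = [set w | E w = c]) // => ->.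
  by rewrite integral_set1.
have mc c : measurable [set w | E w = c].
  by rewrite -[X in measurable X]setTI; exact: (mE measurableT [set c] (measurable_set1 c)).
rewrite /Rintegral -(fP _ (measurable_itv _)); congr fine; apply/eqP; rewrite eq_le; apply/andP; split.
  apply: le_measure; rewrite ?inE.
  - by rewrite -[X in measurable X]setTI; exact: (mE measurableT _ (measurable_itv _)).
  - exact: (measurable_le_set (sub_measurable hs u0)).
  - by move=> w; rewrite /= in_itv/= andbT; apply: le_of_lt_inverse => //; exact: ltW.
have m1 : measurable (E @^-1` `]u, +oo[).
  by rewrite -[X in measurable X]setTI; exact: (mE measurableT _ (measurable_itv _)).
apply: (@le_trans _ _ (P (E @^-1` `]u, +oo[ `|` ([set w | E w = u] `|` [set w | E w = 0])))).
  apply: le_measure; rewrite ?inE.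
  - exact: (measurable_le_set (sub_measurable hs u0)).
  - by apply: measurableU => //; exact: measurableU.
  - move=> w /= h; case: (le_inverse_of_le u0 h); first by right; right.
    by rewrite le_eqVlt => /orP[/eqP uE|uE]; [right; left; rewrite uE|left; rewrite in_itv/= andbT].
rewrite (measureU0 m1)//; first exact: measurableU.
rewrite measureU0; [exact: null|exact: mc|exact: mc|exact: null].
Qed.

(* The value 1 for [u <= 0] keeps [surv t] monotone on the whole line. *)
Definition surv (t u : R) : R := if 0 < u then fine (P [set w | sigma u w <= t]) else 1.

Lemma surv_ge0 t u : 0 <= surv t u.
Proof. by rewrite /surv; case: ifP => // _; exact: fine_ge0. Qed.

Lemma surv_le1 t u : surv t u <= 1.
Proof.
rewrite /surv; case: ifP => // u0.
by apply: fine_prob_le1; exact: (measurable_le_set (sub_measurable hs (ltW u0))).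
Qed.

Lemma measurable_surv : measurable_fun setT (fun z : R * R => surv z.1 z.2).
Proof.
apply: measurable_fun_rcontinuous_monotone.
- move=> t; apply: nonincreasing_measurable => // u v uv; rewrite {1}/surv.
  case: ifP => v0; last first.
    by rewrite /surv ifF//; apply/negbTE; move/negbT: v0; rewrite -!leNgt; exact: le_trans.
  rewrite /surv; case: ifP => u0; last first.
    by apply: fine_prob_le1; exact: (measurable_le_set (sub_measurable hs (ltW v0))).
  apply: le_fine_prob.
  + exact: (measurable_le_set (sub_measurable hs (ltW v0))).
  + exact: (measurable_le_set (sub_measurable hs (ltW u0))).
  + by move=> w /=; apply: le_trans; exact: (sub_nondecreasing hs w (ltW u0) uv).
- move=> u s t st; rewrite /surv; case: ifP => // u0; apply: le_fine_prob.
  + exact: (measurable_le_set (sub_measurable hs (ltW u0))).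
  + exact: (measurable_le_set (sub_measurable hs (ltW u0))).
  + by move=> w /= /le_trans; exact.
- move=> t u c; rewrite /surv; case: ifP => u0 h.
    exact: (prob_le_lt_right (sub_measurable hs (ltW u0)) h).
  by exists (t + 1) => //; rewrite ltrDl.
Qed.

(* The time change turns [phi (E t)] into an average of [phi'] against the
   survival function of [E t]. *)
Lemma expectation_inverse (t : R) (f k : R -> R) : 0 < t ->
  is_pdf P (inverse_process sigma t) f ->
  measurable_fun (`]0, +oo[%classic : set R) k ->
  leb.-integrable setT (EFin \o damp 0 k) ->
  \int[leb]_(y in `]0, +oo[) (expconv 0 k y * f y) = \int[leb]_u (damp 0 k u * surv t u).
Proof.
move=> t0 pf mk ki; have [mE mf f0 fP] := pf.
have fi : leb.-integrable setT (EFin \o f).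
  apply/integrableP; split; first exact/measurable_EFinP.
  under eq_integral do rewrite /= ger0_norm//.
  by rewrite -fP// preimage_setT probability_setT ltry.
pose D (z : R * R) : R := f z.1 * (damp 0 k z.2 * (z.2 < z.1)%R%:R).
have mD : measurable_fun setT D.
  apply: measurable_funM; first exact: measurableT_comp.
  apply: measurable_funM; first by apply: measurableT_comp => //; exact: measurable_damp.
  rewrite (_ : (fun z => _) = \1_([set z : R * R | z.2 < z.1])).
    apply: measurable_indic.
    rewrite (_ : [set z | _] = setT `&` (fun z : R * R => z.1 - z.2) @^-1` `]0, +oo[).
      exact: measurable_funB.
    by rewrite setTI; apply/seteqP; split => z; rewrite /= in_itv/= andbT subr_gt0.
  by apply/funext => z; rewrite indicE mem_setE.
have Di : (leb \x leb)%E.-integrable setT (EFin \o D).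
  have ti := integrable_tensor (m1 := leb) (m2 := leb) fi ki.
  apply: (le_integrable measurableT _ _ ti); first exact/measurable_EFinP.
  move=> z _ /=; rewrite lee_fin /D !normrM ler_wpM2l//.
  by case: (z.2 < z.1); rewrite ?normr1 ?normr0 ?mulr1 ?mulr0.
have := Rintegral_fubini (m1 := leb) (m2 := leb) Di.
have -> : \int[leb]_y \int[leb]_u D (y, u) = \int[leb]_(y in `]0, +oo[) (expconv 0 k y * f y).
  rewrite [RHS]Rintegral_mkcond; apply: eq_Rintegral => y _; rewrite patchE mem_setE in_itv/= andbT.
  rewrite /D/=; case: ltP => y0; last first.
    transitivity (\int[leb]_(x in setT) (cst (0 : R) x)); last by rewrite Rintegral_cst//= mul0r.
    apply: eq_Rintegral => u _ /=; rewrite dampE; case: ltP => u0; last by rewrite mul0r mulr0.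
    by rewrite ltNge (le_trans y0 (ltW u0)) !mulr0.
  rewrite RintegralZl => //; last first.
    apply: (le_integrable (mu := leb) measurableT _ _ ki).
      apply/measurable_EFinP; apply: measurable_funM; first exact: measurable_damp.
      rewrite (_ : (fun u => _) = \1_(`]-oo, y[%classic)); first exact: measurable_indic.
      by apply/funext => u; rewrite indicE mem_setE in_itv.
    move=> u _ /=; rewrite lee_fin normrM.
    by case: (u < y); rewrite ?normr1 ?normr0 ?mulr1 ?mulr0.
  rewrite mulrC; congr (_ * _).
  transitivity (\int[leb]_(u in `]0, y[) (expR (- (0 * (y - u))) * k u)); last first.
    rewrite /expconv /Rintegral [in RHS]integral_itv_bndoo//.
    apply/measurable_EFinP; apply: measurable_funM.
      apply: measurableT_comp => //; apply: measurableT_comp => //.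
      by apply: measurable_funM => //; exact: measurable_funB.
    by apply: measurable_funS mk => // u; rewrite /= !in_itv/= => /andP[->].
  rewrite [RHS]Rintegral_mkcond; apply: eq_Rintegral => u _.
  rewrite patchE mem_setE in_itv/= dampE !mul0r; case: ltP => u0/=; last by rewrite mul0r.
  by case: ltP => uy; rewrite ?mulr1 ?mulr0.
move=> ->; apply: eq_Rintegral => u _; rewrite /D/=.
rewrite dampE /surv; case: ltP => u0; last first.
  rewrite mul0r; transitivity (\int[leb]_(x in setT) (cst (0 : R) x)); last by rewrite Rintegral_cst//= mul0r.
  by apply: eq_Rintegral => y _ /=; rewrite mul0r mulr0.
rewrite -(inverse_survival t0 (ltW u0) pf).
rewrite Rintegral_mkcond -RintegralZl => //; last first.
  have := integrableS (mu := leb) measurableT (measurable_itv `]u, +oo[) (@subsetT _ _) fi.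
  move/(integrable_mkcond (mu := leb) _ (measurable_itv _)).
  by apply: eq_integrable => // y _; rewrite /= !patchE; case: ifP.
apply: eq_Rintegral => y _; rewrite patchE mem_setE in_itv/= andbT.
by case: (u < y); rewrite ?mulr1 ?mulr0 ?mul0r// mulrC.
Qed.

End inverse_of_subordinator.

Lemma damp1_mul {R : realType} (a t : R) (f : R -> R) :
  damp a (cst 1) t * f t = damp a f t.
Proof. by rewrite !dampE; case: ifP => _; rewrite ?mul0r// mulr1. Qed.

Lemma le_damp {R : realType} (a t : R) (f g : R -> R) : `|f t| <= `|g t| ->
  `|damp a f t| <= `|damp a g t|.
Proof.
by move=> fg; rewrite !dampE; case: ifP => // _; rewrite !normrM ler_wpM2l.
Qed.

Section laplace_time_change.
Context {R : realType} {d} {T : measurableType d} (P : probability T R).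
Notation leb := (@lebesgue_measure R).
Variables (nu : {measure set R -> \bar R}) (sigma : R -> T -> R).
Hypothesis hsigma : driftless_subordinator P nu sigma.
Let hs := proj1 hsigma.

Let sigma_ge0 (y : R) w : 0 <= y -> 0 <= sigma y w.
Proof. by move=> y0; rewrite -(sub_0 hs w); exact: (sub_nondecreasing hs). Qed.

Let laplace_surv (l : R[i]) (u : R) : Hstar l -> 0 < u ->
  laplace ((surv P sigma)^~ u) l = l^-1 * cexp (- (laplace_exponent nu l * u%:C)).
Proof.
move=> l0 u0; have u0' := ltW u0.
rewrite [laplace_exponent nu l * _]mulrC -(proj2 hsigma u l u0' l0).
rewrite -(laplace_prob_le P (sub_measurable hs u0') (fun w => sigma_ge0 w u0') l0).
by rewrite /surv u0.
Qed.

Lemma laplace_survival (k q : R -> R) (l : R[i]) : Hstar l ->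
  measurable_fun (`]0, +oo[%classic : set R) k ->
  leb.-integrable setT (EFin \o damp 0 k) ->
  (forall t, 0 < t -> q t = \int[leb]_u (damp 0 k u * surv P sigma t u)) ->
  laplace q l = l^-1 * laplace k (laplace_exponent nu l).
Proof.
case: l => a b l0 mk ki qE; have a0 : 0 < a by [].
have ln0 : a +i* b != 0 by apply/eqP => -[a00 _]; move: a0; rewrite a00 ltxx.
set Psi := laplace_exponent nu _.
pose f (t u : R) : R[i] :=
  cis (- (b * t)) * (damp a (cst 1) t * (damp 0 k u * surv P sigma t u))%:C.
pose h (z : R * R) : R := damp a (cst 1) z.1 * `|damp 0 k z.2|.
have mdamp : measurable_fun setT (damp a (cst (1 : R))).
  by apply: measurable_damp; exact: measurable_cst.
have mks : measurable_fun setT (fun z : R * R => damp 0 k z.2 * surv P sigma z.1 z.2).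
  apply: measurable_funM; last exact: measurable_surv.
  by apply: measurableT_comp => //; exact: measurable_damp.
have mf : cmeasurable setT (fun z : R * R => f z.1 z.2).
  apply: cmeasurableM.
    apply: cmeasurable_cis; apply: measurableT_comp => //; apply: measurable_funM => //.
  apply: cmeasurable_real; apply: measurable_funM => //.
  exact: measurableT_comp.
have hi : (leb \x leb)%E.-integrable setT (EFin \o h).
  exact: (integrable_tensor (m1 := leb) (m2 := leb) (integrable_damp1 a0) (integrable_abse ki)).
have ks_le t u : `|damp 0 k u * surv P sigma t u| <= `|damp 0 k u|.
  by rewrite normrM ler_piMr// (ger0_norm (surv_ge0 P sigma t u)); exact: (surv_le1 hs).
have fh t u : normc (f t u) <= h (t, u).
  rewrite /f ComplexField.Normc.normcM normc_cis mul1r normc_real /h/=.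
  have d0 : 0 <= damp a (cst 1) t by rewrite dampE; case: ifP => //; rewrite mulr1 expR_ge0.
  by rewrite normrM (ger0_norm d0) ler_wpM2l.
have [_ i2 E] := lebesgue_fubini mf hi fh.
have E1 t : cintegral leb setT (f t) = cis (- (b * t)) * (damp a q t)%:C.
  have ii : leb.-integrable setT (EFin \o (fun u => damp 0 k u * surv P sigma t u)).
    apply: (le_integrable measurableT _ _ ki).
      by apply/measurable_EFinP; exact: (measurableT_comp mks (@measurable_pair1 _ _ _ _ t)).
    by move=> u _ /=; rewrite lee_fin.
  transitivity (cintegral leb setT (fun u => cis (- (b * t)) *
      (damp a (cst 1) t * (damp 0 k u * surv P sigma t u))%:C)); first by [].
  rewrite cintegralZl; [|exact: measurableT|].
    congr (_ * _); rewrite cintegral_real; last exact: measurableT.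
    have -> : \int[leb]_u (damp a (cst 1) t * (damp 0 k u * surv P sigma t u)) =
        damp a (cst 1) t * \int[leb]_u (damp 0 k u * surv P sigma t u).
      exact: (RintegralZl (mu := leb) _ measurableT ii).
    congr (_%:C); rewrite dampE [RHS]dampE; case: ltP => t0; last by rewrite mul0r.
    by rewrite mulr1 qE.
  split; last exact: (integrable0 leb setT).
  exact: (integrableZl (mu := leb) measurableT (damp a (cst 1) t) ii).
have E2 u : cintegral leb setT (f^~ u) = (a +i* b)^-1 *
    ((\1_(`]0, +oo[) u)%:C * (cexp (- (Psi * u%:C)) * (k u)%:C)).
  have si : leb.-integrable setT (EFin \o damp a ((surv P sigma)^~ u)).
    apply: (le_integrable measurableT _ _ (integrable_damp1 a0)).
      apply/measurable_EFinP; apply: measurable_damp; apply: measurable_funTS.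
      exact: (measurableT_comp (measurable_surv hs) (@measurable_pair2 _ _ _ _ u)).
    have s1 t : `|surv P sigma t u| <= `|1 : R|.
      by rewrite normr1 (ger0_norm (surv_ge0 P sigma t u)); exact: (surv_le1 hs).
    by move=> t _; exact: (@le_damp R a t ((surv P sigma)^~ u) (cst 1) (s1 t)).
  transitivity (cintegral leb setT (fun t => (damp 0 k u)%:C *
      (cis (- (b * t)) * (damp a ((surv P sigma)^~ u) t)%:C))).
    apply: eq_cintegral => t _; rewrite /f [RHS]mulrCA -rcM; congr (_ * _%:C).
    by rewrite [LHS]mulrCA; congr (_ * _); exact: (damp1_mul a t ((surv P sigma)^~ u)).
  rewrite cintegralZl; [|exact: measurableT|exact: (cintegrable_fourier b si)].
  rewrite -[cintegral _ _ _]/(fourier (damp a ((surv P sigma)^~ u)) b) -laplace_fourier.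
  have -> : \1_(`]0, +oo[%classic : set R) u = (0 < u)%R%:R :> R.
    by rewrite indicE mem_setE in_itv/= andbT.
  rewrite (dampE 0 k); case: ltP => u0; last by rewrite !mul0r mulr0.
  rewrite (laplace_surv l0 u0) mul0r oppr0 expR0 !mul1r [LHS]mulrC -mulrA.
  by congr (_ * _).
rewrite laplace_fourier /fourier.
transitivity (cintegral leb setT (fun t => cintegral leb setT (f t))).
  by apply: eq_cintegral => t _; rewrite E1.
rewrite {}E /laplace [X in _ = _ * X]cintegral_mkcond.
rewrite -[LHS](mulKf ln0); congr (_ * _).
rewrite -cintegralZl; [|exact: measurableT|exact: i2].
apply: eq_cintegral => u _; rewrite E2.
by rewrite mulVKf.
Qed.

End laplace_time_change.

(** * Evaluation of the operator *)

Lemma cmeasurable_comp {R : realType} {d1 d2} {T1 : measurableType d1}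
    {T2 : measurableType d2} (D : set T1) (g : T2 -> R[i]) (h : T1 -> T2) :
  cmeasurable setT g -> measurable_fun D h -> cmeasurable D (fun x => g (h x)).
Proof. by move=> [g1 g2] mh; split; [exact: measurableT_comp g1 mh|exact: measurableT_comp g2 mh]. Qed.

Section complex_limits.
Context {R : realType}.
Notation leb := (@lebesgue_measure R).

Lemma cvg_complex {F : set_system R} {FF : Filter F} (f : R -> R[i]^o) (l : R[i]^o) :
  complex.Re (f r) @[r --> F] --> complex.Re l ->
  complex.Im (f r) @[r --> F] --> complex.Im l ->
  f r @[r --> F] --> l.
Proof.
move=> /cvgrPdist_le fr /cvgrPdist_le fi; apply/cvgrPdist_le => -[e e'].
rewrite ltcE/= => /andP[/eqP e'0 e0]; rewrite {e'}e'0.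
have e20 : 0 < e / 2 by rewrite divr_gt0.
near=> r.
rewrite -[leLHS]/((normc (l - f r))%:C) lecR.
apply: le_trans (normc_le_ReIm _) _; rewrite cReD cImD cReN cImN [e]splitr lerD//.
  by near: r; exact: fr.
by near: r; exact: fi.
Unshelve. all: by end_near. Qed.

Lemma cvg_cintegral_symmetric (f : R -> R[i]) : cintegrable leb setT f ->
  cintegral leb `[- r, r] f @[r --> +oo] --> (cintegral leb setT f : R[i]^o).
Proof.
move=> fi; have mf := cintegrable_meas fi.
have dc (u : nat -> R) : u n @[n --> \oo] --> +oo ->
    complex.Re (cintegral leb `[- u n, u n] f) @[n --> \oo] --> complex.Re (cintegral leb setT f) /\
    complex.Im (cintegral leb `[- u n, u n] f) @[n --> \oo] --> complex.Im (cintegral leb setT f).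
  move=> uy.
  pose f_ n x := (\1_(`[- u n, u n]%classic) x)%:C * f x.
  have fE n : cintegral leb `[- u n, u n] f = cintegral leb setT (f_ n) by exact: cintegral_mkcond.
  have near_f x : \forall n \near \oo, f x = f_ n x.
    near=> n; rewrite /f_ indicE mem_set ?mul1r//= in_itv/= -ler_norml.
    by near: n; move/cvgryPge : uy; exact.
  suff [h1 h2] : complex.Re (cintegral leb setT (f_ n)) @[n --> \oo] --> complex.Re (cintegral leb setT f) /\
      complex.Im (cintegral leb setT (f_ n)) @[n --> \oo] --> complex.Im (cintegral leb setT f).
    by split; [apply: cvg_trans h1|apply: cvg_trans h2]; apply: near_eq_cvg; near=> n; rewrite fE.
  apply: (@cintegral_dominated_cvg _ _ _ leb setT f_ f (fun x => normc (f x)) measurableT).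
  - move=> n; apply: cmeasurableM => //; apply: cmeasurable_real; exact: measurable_indic.
  - move=> x _; apply: cvg_near_cst.
    by move: (near_f x); apply: filterS => n <-.
  - move=> x _; apply: cvg_near_cst.
    by move: (near_f x); apply: filterS => n <-.
  - exact: (cintegrable_normc measurableT fi).
  - move=> n x _; rewrite /f_ normcM normc_real indicE; case: (x \in _).
      by rewrite normr1 mul1r.
    by rewrite normr0 mul0r normc_ge0.
apply: cvg_complex.
  apply/cvg_pinftyP => u uy; exact: (dc u uy).1.
apply/cvg_pinftyP => u uy; exact: (dc u uy).2.
Unshelve. all: by end_near. Qed.

End complex_limits.

Section truncated_double_integral.
Context {R : realType}.
Notation leb := (@lebesgue_measure R).
Variables (G F : R -> R[i]) (M : R).
Hypotheses (Gi : cintegrable leb setT G) (GM : forall y, normc (G y) <= M).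
Hypothesis Fi : cintegrable leb setT F.
Let mG := cintegrable_meas Gi.
Let mF := cintegrable_meas Fi.

Lemma cintegrable_translate_mul (D : set R) w : measurable D ->
  cintegrable leb D (fun z => G (w - z) * F z).
Proof.
move=> mD.
have mB : measurable_fun D (fun z : R => w - z) by exact: measurable_funB.
have hi := integrableS (mu := leb) measurableT mD (@subsetT _ _)
  (integrableZl measurableT M (cintegrable_normc measurableT Fi)).
apply: (cintegrable_le (mu := leb) (h := fun z => M * normc (F z)) mD _ hi).
  apply: cmeasurableM; last exact: (cmeasurableS measurableT (@subsetT _ _) mF).
  exact: (cmeasurable_comp mG mB).
by move=> z _; rewrite normcM ler_wpM2r// normc_ge0.
Qed.

Lemma cintegral_truncated_double (D : set R) (t : R) : measurable D ->
  cintegrable leb setT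
    (fun w => cis (w * t) * cintegral leb D (fun z => G (w - z) * F z)) /\
  cintegral leb setT
    (fun w => cis (w * t) * cintegral leb D (fun z => G (w - z) * F z)) =
  cintegral leb setT (fun y => cis (y * t) * G y) *
  cintegral leb D (fun z => cis (z * t) * F z).
Proof.
move=> mD.
pose FD z := (\1_D z)%:C * F z.
have FDi : cintegrable leb setT FD.
  apply: (cintegrable_le measurableT _ (cintegrable_normc measurableT Fi)).
    by apply: cmeasurableM => //; apply: cmeasurable_real; exact: measurable_indic.
  move=> z _; rewrite normcM normc_real indicE; case: (z \in D).
    by rewrite normr1 mul1r.
  by rewrite normr0 mul0r normc_ge0.
pose f w z := cis (w * t) * (G (w - z) * FD z).
pose h (z : R * R) := normc (G (z.1 - z.2)) * normc (FD z.2).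
have mB : measurable_fun setT (fun z : R * R => z.1 - z.2) by exact: measurable_funB.
have mcis : cmeasurable setT (fun w : R => cis (w * t)).
  by apply: cmeasurable_cis; exact: measurable_funM.
have mf : cmeasurable setT (fun z : R * R => f z.1 z.2).
  apply: cmeasurableM.
    by apply: cmeasurable_cis; apply: measurable_funM.
  apply: cmeasurableM.
    exact: (cmeasurable_comp mG mB).
  exact: (cmeasurable_comp (cintegrable_meas FDi) (@measurable_snd _ _ _ _)).
have hi : (leb \x leb)%E.-integrable setT (EFin \o h).
  exact: (integrable_conv (cintegrable_normc measurableT Gi) (cintegrable_normc measurableT FDi)).
have fh w z : normc (f w z) <= h (w, z).
  by rewrite /f normcM normc_cis mul1r [leLHS]normcM.
have [i1 _ E] := lebesgue_fubini mf hi fh.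
have E1 w : cintegral leb setT (f w) =
    cis (w * t) * cintegral leb D (fun z => G (w - z) * F z).
  rewrite [in RHS]cintegral_mkcond -cintegralZl; [|exact: measurableT|].
    by apply: eq_cintegral => z _; rewrite /f /FD; congr (_ * _); rewrite mulrCA.
  by apply/(cintegrable_mkcond leb _ mD); exact: cintegrable_translate_mul.
have Gci : cintegrable leb setT (fun y => cis (y * t) * G y).
  apply: (cintegrable_le measurableT _ (cintegrable_normc measurableT Gi)).
    exact: cmeasurableM.
  by move=> y _; rewrite normcM normc_cis mul1r.
have Fci : cintegrable leb setT (fun z => cis (z * t) * FD z).
  apply: (cintegrable_le measurableT _ (cintegrable_normc measurableT FDi)).
    by apply: cmeasurableM; [exact: mcis|exact: (cintegrable_meas FDi)].
  by move=> y _; rewrite normcM normc_cis mul1r.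
have E2 z : cintegral leb setT (f^~ z) =
    cintegral leb setT (fun y => cis (y * t) * G y) * (cis (z * t) * FD z).
  rewrite -(cintegral_shift z Gci) [RHS]mulrC.
  rewrite -cintegralZl; [|exact: measurableT|exact: (cintegrable_shift z Gci)].
  apply: eq_cintegral => w _; rewrite /f.
  have -> : w * t = z * t + (w - z) * t by ring.
  by rewrite cisD; ring.
split.
  by apply: (eq_cintegrable (mu := leb) measurableT _ i1) => w _; rewrite E1.
transitivity (cintegral leb setT (fun w => cintegral leb setT (f w))).
  by apply: eq_cintegral => w _; rewrite E1.
rewrite {}E [X in _ * X]cintegral_mkcond.
rewrite -cintegralZl; [|exact: measurableT|].
  by apply: eq_cintegral => z _; rewrite E2 /FD; congr (_ * _); rewrite mulrCA.
apply: (eq_cintegrable (mu := leb) measurableT _ Fci) => z _.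
by rewrite /FD mulrCA.
Qed.

End truncated_double_integral.

Lemma ae_eq_map2 {R : realType} {d} {T : measurableType d}
    (mu : {measure set T -> \bar R}) {V W : Type} (D : set T) (h : T -> V -> W) (f g : T -> V) :
  ae_eq mu D f g -> ae_eq mu D (fun x => h x (f x)) (fun x => h x (g x)).
Proof. by apply: filterS => x /[apply] ->. Qed.

Section Lhat_evaluation.
Context {R : realType}.
Notation leb := (@lebesgue_measure R).
Variables (H theta c1 c2 x : R) (Psi : R[i] -> R[i]) (v : R[i] -> R -> R[i]).
Hypotheses (H_gt : 1 / 2 < H) (H_lt : H < 1) (theta_gt0 : 0 < theta).
Hypotheses (c2_gt0 : 0 < c2) (c12 : - (1 / theta) < c1 - c2) (x0 : x != 0).

Let a : R := c1 - c2.
Let a_gt : 0 < a + theta^-1.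
Proof. by rewrite -[a]opprK addrC subr_gt0 ltrNl -[theta^-1]mul1r. Qed.

Let G : R -> R[i] := fourier (damp a (dV2 H theta)).
Let F : R -> R[i] := fourier (damp c2 (fun t => pH H theta t x)).
Let F' (z : R) : R[i] := inv_value Psi v x (c2 +i* z).

Hypothesis mF' : cmeasurable setT F'.
Hypothesis F'E : ae_eq leb setT F F'.

Let Gi : cintegrable leb setT G.
Proof. exact: cintegrable_fourier_dV2. Qed.

Let Fi : cintegrable leb setT F.
Proof. exact: cintegrable_fourier_pH. Qed.

Let F'i : cintegrable leb setT F'.
Proof. by apply: (cintegrable_ae_eq (mu := leb) measurableT mF' _ Fi); exact: F'E. Qed.

Let GM y : normc (G y) <= 2 * \int[leb]_s `|damp a (dV2 H theta) s|.
Proof. by apply: normc_fourier_le; exact: integrable_damp_dV2. Qed.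

Let integrand_zE w : integrand_z H theta c1 c2 Psi v x w = fun z => G (w - z) * F' z.
Proof. by apply/funext => z; rewrite /integrand_z laplace_fourier. Qed.

Let integrand_wE r t w : integrand_w H theta c1 c2 Psi v x r t w =
  (expR (c1 * t))%:C * (cis (w * t) * cintegral leb `[- r, r] (fun z => G (w - z) * F' z)).
Proof.
rewrite /integrand_w integrand_zE mulrA; congr (_ * _).
have -> : (c1 +i* w) * t%:C = (c1 * t) +i* (w * t) by apply: complex_eqP => /=; ring.
exact: cexpE.
Qed.

Lemma cintegrable_integrand_z r w :
  cintegrable leb `[- r, r] (integrand_z H theta c1 c2 Psi v x w).
Proof.
rewrite integrand_zE; apply: (cintegrable_translate_mul Gi GM F'i w); exact: measurable_itv.
Qed.

Lemma cintegrable_integrand_w r t :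
  cintegrable leb setT (integrand_w H theta c1 c2 Psi v x r t).
Proof.
rewrite (_ : integrand_w _ _ _ _ _ _ _ _ _ = fun w => (expR (c1 * t))%:C *
  (cis (w * t) * cintegral leb `[- r, r] (fun z => G (w - z) * F' z))); last first.
  by apply/funext => w; exact: integrand_wE.
apply: cintegrableZl; first exact: measurableT.
exact: (cintegral_truncated_double Gi GM F'i t (measurable_itv _)).1.
Qed.

Let integral_wE r t : 0 < t -> integral_w H theta c1 c2 Psi v x t r =
  (2 * pi * (expR (c2 * t) * dV2 H theta t))%:C *
  cintegral leb `[- r, r] (fun z => cis (z * t) * F' z).
Proof.
move=> t0; have [i1 iE] := cintegral_truncated_double Gi GM F'i t (measurable_itv `[- r, r]).
transitivity (cintegral leb setT (fun w => (expR (c1 * t))%:C *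
  (cis (w * t) * cintegral leb `[- r, r] (fun z => G (w - z) * F' z)))).
  by apply: eq_cintegral => w _; exact: integrand_wE.
rewrite cintegralZl; [|exact: measurableT|exact: i1].
rewrite iE (fourier_inversion_dV2 H_gt H_lt theta_gt0 a_gt t0) mulrA -rcM; congr (_%:C * _).
rewrite [LHS]mulrCA; congr (_ * _); rewrite mulrA -expRD; congr (expR _ * _).
by rewrite /a; ring.
Qed.

Lemma cvg_integral_w t : 0 < t ->
  integral_w H theta c1 c2 Psi v x t r @[r --> +oo] -->
  ((4 * pi ^+ 2 * (dV2 H theta t * pH H theta t x))%:C : R[i]^o).
Proof.
move=> t0.
have mcis : cmeasurable setT (fun w : R => cis (w * t)).
  by apply: cmeasurable_cis; exact: measurable_funM.
have F'ci : cintegrable leb setT (fun z => cis (z * t) * F' z).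
  apply: (cintegrable_le (mu := leb) measurableT _ (cintegrable_normc measurableT F'i)).
    by apply: cmeasurableM; [exact: mcis|exact: mF'].
  by move=> y _; rewrite normcM normc_cis mul1r.
have E : cintegral leb setT (fun z => cis (z * t) * F' z) =
    (2 * pi * (expR (- (c2 * t)) * pH H theta t x))%:C.
  rewrite -(fourier_inversion_pH H_gt H_lt theta_gt0 x0 c2_gt0 t0); symmetry.
  apply: cintegral_ae_eq.
  - exact: measurableT.
  - by apply: cmeasurableM; [exact: mcis|exact: (cintegrable_meas Fi)].
  - by apply: cmeasurableM; [exact: mcis|exact: mF'].
  - exact: (@ae_eq_map2 R _ _ leb R[i] R[i] setT (fun (z : R) u => cis (z * t) * u) F F' F'E).
have -> : (4 * pi ^+ 2 * (dV2 H theta t * pH H theta t x))%:C =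
    (2 * pi * (expR (c2 * t) * dV2 H theta t))%:C *
    cintegral leb setT (fun z => cis (z * t) * F' z).
  rewrite E -rcM expRN; congr (_%:C); field.
  by rewrite gt_eqF ?expR_gt0.
rewrite (_ : integral_w _ _ _ _ _ _ _ _ = fun r =>
  (2 * pi * (expR (c2 * t) * dV2 H theta t))%:C *
  cintegral leb `[- r, r] (fun z => cis (z * t) * F' z)); last first.
  by apply/funext => r; exact: integral_wE.
exact: (@cvgZl_tmp R[i] R[i]^o _ _ _ _ _ _ (cvg_cintegral_symmetric F'ci)).
Qed.

Lemma cintegrable_opL l : 0 <= complex.Re l ->
  cintegrable leb `]0, +oo[
    (fun s => cexp (- (l * s%:C)) * (dV2 H theta s)%:C * (pH H theta s x)%:C).
Proof.
move=> l0; have [M HM] := pH_bound H_gt H_lt theta_gt0 x0.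
pose K : R := 2 * (H * (2 * H - 1)).
have mo : measurable (`]0, +oo[%classic : set R) by exact: measurable_itv.
have ri := integrableS (mu := leb) measurableT mo (@subsetT _ _) (integrable_rateV H_gt H_lt theta_gt0).
have mr : measurable_fun (`]0, +oo[%classic : set R) (rateV H theta).
  by have /integrableP[/measurable_EFinP] := ri.
apply: (cintegrable_le (mu := leb) mo _ (integrableZl (mu := leb) mo (`|K| * M) ri)).
  apply: cmeasurableM; first apply: cmeasurableM.
  - apply: cmeasurable_cexp; apply: cmeasurableN; apply: cmeasurableM; first exact: cmeasurable_cst.
    by apply: cmeasurable_real; exact: measurable_id.
  - apply: cmeasurable_real.
    apply: (eq_measurable_fun (fun t => K * rateV H theta t)); last exact: measurable_funM.
    by move=> t /set_mem; rewrite /= in_itv/= andbT => t0; rewrite dV2E.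
  - apply: cmeasurable_real; apply: open_continuous_measurable_fun => //.
    by move=> t /set_mem; rewrite /= in_itv/= andbT; exact: continuous_pH.
move=> t; rewrite /= in_itv/= andbT => t0.
rewrite !normcM normc_cexp !normc_real dV2E// normrM -/K.
rewrite (ger0_norm (rateV_ge0 _ _ _)) (ger0_norm (pH_ge0 _ _ _ _)).
apply: (@le_trans _ _ (1 * (`|K| * rateV H theta t) * M)); last by rewrite mul1r mulrAC.
apply: ler_pM; [by rewrite ?mulr_ge0 ?expR_ge0 ?rateV_ge0|exact: pH_ge0| |exact: HM].
rewrite ler_wpM2r ?mulr_ge0 ?rateV_ge0//.
rewrite -expR0 ler_expR cReN oppr_le0 cReM/= mulr0 subr0.
by rewrite mulr_ge0// ltW.
Qed.

Lemma Lhat_eval l : 0 <= complex.Re (Psi l) ->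
  Lhat_well_defined H theta c1 c2 Psi v l x /\
  Lhat H theta c1 c2 Psi v l x = opL H theta (pH H theta) (Psi l) x.
Proof.
move=> Psi0; have gi := cintegrable_opL Psi0.
pose g (s : R) := cexp (- (Psi l * s%:C)) * (dV2 H theta s)%:C * (pH H theta s x)%:C.
have pi0 : 4 * pi ^+ 2 != 0 :> R by rewrite mulf_neq0// expf_neq0// gt_eqF// pi_gt0.
have E : {in (`]0, +oo[%classic : set R), (fun t => (4 * pi ^+ 2)%:C * g t) =1
    integrand_t H theta c1 c2 Psi v l x}.
  move=> t /set_mem; rewrite /= in_itv/= andbT => t0.
  rewrite /integrand_t (cvg_lim (@norm_hausdorff _ _) (cvg_integral_w t0)) /g !rcM.
  by rewrite -!mulrA; ring.
have mo : measurable (`]0, +oo[%classic : set R) by exact: measurable_itv.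
split.
  split.
  - by move=> r w _; exact: cintegrable_integrand_z.
  - by move=> t r _ _; exact: cintegrable_integrand_w.
  - by move=> t t0; apply/cvg_ex; eexists; exact: (cvg_integral_w t0).
  - by apply: (eq_cintegrable (mu := leb) mo E); apply: cintegrableZl; [exact: mo|exact: gi].
rewrite /Lhat -(eq_cintegral leb E) cintegralZl; [|exact: mo|exact: gi].
by rewrite [LHS]mulrA -rcM (mulVf pi0) [LHS]mul1r.
Qed.

End Lhat_evaluation.

Section local_inverses.
Context {R : realType}.
Notation leb := (@lebesgue_measure R).
Variables (Psi : R[i] -> R[i]) (c : R).

Let S : set R := [set z : R | exists phi, local_inverse Psi (c +i* z) phi].

Lemma open_local_inverse : open S.
Proof.
rewrite openE => z [phi [U [oU Uz Uphi]]].
have near_U : \forall y \near z, U (c +i* y).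
  have cz : ((c +i* y : R[i]^o) @[y --> z] --> (c +i* z : R[i]^o)).
    by apply: cvg_complex; [exact: cvg_cst|exact: cvg_id].
  exact: (cz U (open_nbhs_nbhs (conj oU Uz))).
apply: filterS near_U => y Uy; exists phi.
by exists U.
Qed.

Variables (v : R[i] -> R -> R[i]) (x : R) (F : R -> R[i]).
Hypothesis branchE : forall z phi, local_inverse Psi (c +i* z) phi ->
  branch_value v x (c +i* z) phi = F z.

Let inv_valueE z : inv_value Psi v x (c +i* z) = (\1_S z)%:C * F z.
Proof.
rewrite /inv_value indicE; have [Sz|Sz] := pselect (S z).
  rewrite mem_set// mul1r; have [phi hphi] := Sz.
  apply: xget_unique; first by exists phi => //; exact: branchE.
  by move=> y [psi /branchE <-].
rewrite memNset// mul0r; apply: xgetPN => y [phi hphi _].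
by apply: Sz; exists phi.
Qed.

Lemma cmeasurable_inv_value : cmeasurable setT F ->
  cmeasurable setT (fun z => inv_value Psi v x (c +i* z)).
Proof.
move=> mF; rewrite (_ : (fun z => _) = fun z => (\1_S z)%:C * F z); last first.
  by apply/funext => z; exact: inv_valueE.
apply: cmeasurableM => //; apply: cmeasurable_real; apply: measurable_indic.
by apply: open_measurable; exact: open_local_inverse.
Qed.

Lemma ae_eq_inv_value :
  {ae leb, forall z : R, exists phi, local_inverse Psi (c +i* z) phi} ->
  ae_eq leb setT F (fun z => inv_value Psi v x (c +i* z)).
Proof.
move=> [N [mN N0 SN]]; exists N; split => // z /= h; apply: SN => /= Sz; apply: h => _.
by rewrite inv_valueE indicE mem_set// mul1r.
Qed.

End local_inverses.

Lemma Re_laplace_exponent_ge0 {R : realType} (nu : {measure set R -> \bar R}) (l : R[i]) :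
  Hstar l -> 0 <= complex.Re (laplace_exponent nu l).
Proof.
case: l => a b l0; have a0 : 0 < a by [].
apply: Rintegral_ge0 => t; rewrite /= in_itv/= andbT => t0.
rewrite !mulr0 subr0 add0r subr_ge0.
apply: (@le_trans _ _ (expR (- (a * t)) * 1)).
  by rewrite ler_wpM2l ?expR_ge0// cos_le1.
by rewrite mulr1 -expR0 ler_expR oppr_le0 mulr_ge0// ltW.
Qed.

Lemma density_transform (R : realType) (H theta : R)
    (H_gt : 1 / 2 < H) (H_lt : H < 1) (theta_gt0 : 0 < theta)
    (d : measure_display) (T : measurableType d) (P : probability T R)
    (nu : {measure set R -> \bar R})
    (sigma : R -> T -> R) (hsigma : driftless_subordinator P nu sigma)
    (fE : R -> R -> R)
    (hfE : forall t, 0 < t -> is_pdf P (inverse_process sigma t) (fE t))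
    (p : R -> R -> R)
    (hpE : forall t x, 0 < t ->
       p t x = \int[lebesgue_measure]_(y in `]0, +oo[) (pH H theta y x * fE t y))
    (x : R) (x0 : x != 0) (l : R[i]) : Hstar l ->
  laplace (fun t => p t x) l = l^-1 * laplace (dpH H theta x) (laplace_exponent nu l).
Proof.
move=> l0; have mk := measurable_dpH x H_gt H_lt theta_gt0.
have ki := integrable_damp_dpH H_gt H_lt theta_gt0 x0 (lexx 0).
apply: (laplace_survival hsigma l0 mk ki) => t t0.
rewrite hpE// -(expectation_inverse (proj1 hsigma) t0 (hfE t t0) mk ki).
apply: eq_Rintegral => y /set_mem; rewrite /= in_itv/= andbT => y0.
by rewrite (pH_expconv H_gt H_lt theta_gt0 x0 y0).
Qed.

Lemma branch_value_density_transform (R : realType) (H theta c2 x : R)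
    (H_gt : 1 / 2 < H) (H_lt : H < 1) (theta_gt0 : 0 < theta)
    (c2_gt0 : 0 < c2) (x0 : x != 0) (Psi : R[i] -> R[i]) (v : R[i] -> R -> R[i]) :
  (forall l, Hstar l -> v l x = l^-1 * laplace (dpH H theta x) (Psi l)) ->
  forall z phi, local_inverse Psi (c2 +i* z) phi ->
  branch_value v x (c2 +i* z) phi = fourier (damp c2 (fun t => pH H theta t x)) z.
Proof.
move=> vE z phi [U [_ Uz Uphi]]; have [_ h0 hz] := Uphi _ Uz.
rewrite /branch_value vE// hz laplace_fourier (fourier_pH H_gt H_lt theta_gt0 x0 z c2_gt0).
rewrite mulrA; congr (_ * _); rewrite [LHS]mulrAC divff ?mul1r//.
by apply/eqP => e0; move: h0; rewrite e0 /Hstar /= ltxx.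
Qed.

Unset Implicit Arguments.
Set Strict Implicit.
Set Printing Implicit Defensive.

Theorem lemma6p7 (R : realType) (H theta c1 c2 : R)
    (H_gt : 1 / 2 < H) (H_lt : H < 1) (theta_gt0 : 0 < theta)
    (c1_lt0 : c1 < 0) (c2_gt0 : 0 < c2) (c12 : - (1 / theta) < c1 - c2)
    (d : measure_display) (T : measurableType d) (P : probability T R)
    (B : R -> T -> R) (hB : fractional_brownian_motion P H B)
    (nu : {measure set R -> \bar R}) (hnu : infinite_levy_measure nu)
    (sigma : R -> T -> R) (hsigma : driftless_subordinator P nu sigma)
    (hindep : indep_processes P (fOU theta B) (inverse_process sigma))
    (fE : R -> R -> R)
    (hfE : forall t, 0 < t -> is_pdf P (inverse_process sigma t) (fE t))
    (hEH : forall t, 0 < t ->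
       (\int[P]_w (inverse_process sigma t w `^ (- H))%:E < +oo)%E)
    (p : R -> R -> R)
    (hp : forall t, 0 < t ->
       is_pdf P (fun w => fOU theta B (inverse_process sigma t w) w) (p t))
    (hpE : forall t x, 0 < t ->
       p t x = \int[lebesgue_measure]_(y in `]0, +oo[)
                 (pH H theta y x * fE t y))
    (* The operator is built from the values of local inverses of Psi on the
       line Re = c2: they are required to exist for almost every z. *)
    (hinv : {ae (@lebesgue_measure R), forall z : R,
       exists phi, local_inverse (laplace_exponent nu) (c2 +i* z) phi}) :
  let Psi := laplace_exponent nu in
  let pbar (l : R[i]) (x : R) := laplace (fun t => p t x) l in
  Lhat_domain H theta c1 c2 Psi pbar [set x | x != 0] /\
  (forall (l : R[i]) (x : R), Hstar l -> x != 0 ->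
     Lhat H theta c1 c2 Psi pbar l x = opL H theta (pH H theta) (Psi l) x).
Proof.
move=> Psi pbar.
have vE x : x != 0 -> forall l, Hstar l ->
    pbar l x = l^-1 * laplace (dpH H theta x) (Psi l).
  move=> x0 l l0.
  exact: (density_transform H_gt H_lt theta_gt0 hsigma hfE hpE x0 l0).
have bE x (x0 : x != 0) :=
  branch_value_density_transform H_gt H_lt theta_gt0 c2_gt0 x0 (vE x x0).
have eval x l : x != 0 -> Hstar l ->
    Lhat_well_defined H theta c1 c2 Psi pbar l x /\
    Lhat H theta c1 c2 Psi pbar l x = opL H theta (pH H theta) (Psi l) x.
  move=> x0 l0.
  have mF := cintegrable_meas (cintegrable_fourier_pH H_gt H_lt theta_gt0 x0 c2_gt0).
  apply: (Lhat_eval H_gt H_lt theta_gt0 c2_gt0 c12 x0).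
  - exact: (cmeasurable_inv_value (bE x x0) mF).
  - exact: (ae_eq_inv_value (bE x x0) hinv).
  - exact: Re_laplace_exponent_ge0.
split=> [l x l0 x0|l x l0 x0]; last exact: (eval x l x0 l0).2.
split; last exact: (eval x l x0 l0).1.
by move=> z _ phi1 phi2 h1 h2; rewrite (bE x x0 z phi1 h1) (bE x x0 z phi2 h2).
Qed.
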